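(* Let $\mathcal{A}$ be an o-minimal structure on the real field, $k\in\mathbb{N}$, and let $\mathcal{F}^k$ be the sheaf on the definable site $X_{\mathcal{A}}(\mathbb{R}^2)$ defined in the context. If $W\in X_{\mathcal{A}}(\mathbb{R}^2)$ has only cuspidal singularities, then $$\mathcal{F}^k(W)=W^{k,2}(W).$$ Consequently, if $U,V\in X_{\mathcal{A}}(\mathbb{R}^2)$ are such that $U$, $V$, $U\cap V$ and $U\cup V$ have only cuspidal singularities, then the sequence $$0\to W^{k,2}(U\cup V)\to W^{k,2}(U)\oplus W^{k,2}(V)\to W^{k,2}(U\cap V)\to 0$$ (restrictions, then difference of restrictions) is exact.
   Context: $\mathbb{N}$ is the set of nonnegative integers; ''definable'' means definable in $\mathcal{A}$. $X_{\mathcal{A}}(\mathbb{R}^2)$ is the site of open bounded definable subsets of $\mathbb{R}^2$, with finite coverings. $\partial U=\overline{U}\setminus U$. $W^{k,2}(\mathbb{R}^2)$ is the usual $L^2$-based Sobolev space, and for $U\subset\mathbb{R}^2$ open, $W^{k,2}(U)=\{f\in\mathcal{D}'(U):\exists F\in W^{k,2}(\mathbb{R}^2),\ F|_U=f\}$. $W^{k,2}_{loc}(U)$ is the space of distributions on $U$ that are locally in $W^{k,2}$ in $U$. Regions between curves. Let $\gamma_1,\gamma_2:[0,a[\to\mathbb{R}^2$ be definable $C^1$-curves with $\gamma_1(0)=\gamma_2(0)=p_0$, parametrized by the distance to $p_0$: $\gamma_i(t)=p_0+te^{i\theta_i(t)}$ (identifying $\mathbb{R}^2$ with $\mathbb{C}$),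 with $0<\theta_2(t)-\theta_1(t)<2\pi$ for $t>0$. For small $r>0$ put $R(r,\gamma_1,\gamma_2)=\{p_0+te^{i\theta}: t\in]0,r[,\ \theta_1(t)<\theta<\theta_2(t)\}$. The angle $\angle(\gamma_1'(0),\gamma_2'(0))\in[0,2\pi]$ is the anticlockwise angle, i.e. the limit of $\theta_2(t)-\theta_1(t)$ as $t\to0$. Local types. For $U\in X_{\mathcal{A}}(\mathbb{R}^2)$ and $p_0\in\partial U$, for some (small) $r>0$ the set $U_0:=B(p_0,r)\cap U$ is of one of the following types, and the space $\widehat{\mathcal{F}}^k(U_0)$ is defined in each case: - $(C_1)$ punctured disk: $U_0=B(p_0,r)\setminus\{p_0\}$; $\widehat{\mathcal{F}}^k(U_0)=W^{k,2}(U_0)$. - $(C_2)$ sector (Lipschitz): $U_0=R(r,\gamma_1,\gamma_2)$ with $\angle(\gamma_1'(0),\gamma_2'(0))\neq0,2\pi$; $\widehat{\mathcal{F}}^k(U_0)=W^{k,2}(U_0)$. - $(C_3)$ cusp: $U_0=R(r,\gamma_1,\gamma_2)$ with $\angle(\gamma_1'(0),\gamma_2'(0))=0$; $\widehat{\mathcal{F}}^k(U_0)=W^{k,2}(U_0)$. - $(C_4)$ cusp complement: $U_0=R(r,\gamma_1,\gamma_2)$ with $\angle(\gamma_1'(0),\gamma_2'(0))=2\pi$. Choose definable $C^1$-curves $\gamma_3,\gamma_4$ starting at $p_0$, lying in $U_0$ in the anticlockwise order $\gamma_1,\gamma_3,\gamma_4,\gamma_2$, with $\angle(\gamma_1'(0),\gamma_3'(0))\notin\{0,2\pi\}$,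 $\angle(\gamma_4'(0),\gamma_2'(0))\notin\{0,2\pi\}$, $\angle(\gamma_3'(0),\gamma_4'(0))\neq0$; then $\widehat{\mathcal{F}}^k(U_0)$ is the kernel of $W^{k,2}(R(r,\gamma_1,\gamma_4))\oplus W^{k,2}(R(r,\gamma_3,\gamma_2))\to W^{k,2}(R(r,\gamma_3,\gamma_4))$ (difference of restrictions), identified with the set of $f\in\mathcal{D}'(U_0)$ whose restrictions to $R(r,\gamma_1,\gamma_4)$ and $R(r,\gamma_3,\gamma_2)$ are in $W^{k,2}$ of these sets. It does not depend on the choice of $\gamma_3,\gamma_4$. - $(C_5)$ arc complement: $U_0=B(p_0,r)\setminus \mathrm{Im}(\gamma)$ for a definable $C^1$-curve $\gamma$ with $\gamma(0)=p_0$. Choose definable $C^1$-curves $\gamma_1,\gamma_2$ starting at $p_0$ (in anticlockwise order $\gamma,\gamma_1,\gamma_2,\gamma$) with $\angle(\gamma_1'(0),\gamma_2'(0))\neq2\pi$, $\angle(\gamma_1'(0),\gamma'(0))\neq0$, $\angle(\gamma'(0),\gamma_2'(0))\neq0$; then $\widehat{\mathcal{F}}^k(U_0)$ is the kernel of $W^{k,2}(R(r,\gamma,\gamma_2))\oplus W^{k,2}(R(r,\gamma_1,\gamma))\to W^{k,2}(R(r,\gamma_1,\gamma_2))$, again independent of choices and identified with a space of distributions on $U_0$. - $(C_6)$: $U_0$ is a disjoint union of sets of types $C_2,C_3,C_4$; $\widehat{\mathcal{F}}^k(U_0)$ is the direct sum of the $\widehat{\mathcal{F}}^k$ of the connected components.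 The sheaf $\mathcal{F}^k$: for $U\in X_{\mathcal{A}}(\mathbb{R}^2)$, $\mathcal{F}^k(U)$ is the set of $f\in W^{k,2}_{loc}(U)$ such that for each $x\in\partial U$ there is $r>0$ such that $B(x,r)\cap U$ is of one of the types $C_1,\dots,C_6$ and $f|_{B(x,r)\cap U}\in\widehat{\mathcal{F}}^k(B(x,r)\cap U)$. Restriction maps are restrictions of distributions. A set $W\in X_{\mathcal{A}}(\mathbb{R}^2)$ has only cuspidal singularities if at every point of $\partial W$, $W$ is locally Lipschitz (type $C_2$) or of type $C_3$. *)

(* Defs.v *)
From mathcomp Require Import all_boot all_order all_algebra.
From mathcomp Require Import complex.
From mathcomp Require Import all_classical all_reals all_analysis.

Set Implicit Arguments.
Unset Strict Implicit.
Unset Printing Implicit Defensive.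

Import Order.TTheory GRing.Theory Num.Theory.
Import numFieldNormedType.Exports.

Local Open Scope classical_set_scope.
Local Open Scope ring_scope.
Local Open Scope complex_scope.

(** * O-minimal structures on the real field *)

(* The order axiom is redundant (x < y iff y - x is a nonzero square). In
   [omin_tame] the members of [s] are arbitrary intervals, points (`[a, a])
   and unbounded intervals included. *)
Record ominimal (R : realType) := Ominimal {
  definable :> forall n : nat, set (set 'rV[R]_n);
  omin_setT : forall n, definable [set: 'rV[R]_n];
  omin_setU : forall n (S T : set 'rV[R]_n),
    definable S -> definable T -> definable (S `|` T);
  omin_setC : forall n (S : set 'rV[R]_n), definable S -> definable (~` S);
  omin_prod : forall m n (S : set 'rV[R]_m) (T : set 'rV[R]_n),
    definable S -> definable T ->
    definable [set v : 'rV[R]_(m + n) | S (lsubmx v) /\ T (rsubmx v)];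
  omin_proj : forall m n (S : set 'rV[R]_(m + n)),
    definable S -> definable [set lsubmx v | v in S];
  omin_diag : forall n (i j : 'I_n),
    definable [set v : 'rV[R]_n | v ord0 i = v ord0 j];
  omin_lt : definable [set v : 'rV[R]_2 | v 0 0 < v 0 1];
  omin_add : definable [set v : 'rV[R]_3 | v 0 0 + v 0 1 = v 0 2];
  omin_mul : definable [set v : 'rV[R]_3 | v 0 0 * v 0 1 = v 0 2];
  omin_tame : forall S : set 'rV[R]_1, definable S <->
    exists s : seq (interval R), S = [set v | has (fun I => v 0 0 \in I) s]
}.

(** * The definable site of the plane *)

Notation plane R := (R * R)%type.

Section Plane.
Context {R : realType}.
Implicit Types (p q : plane R) (U V : set (plane R)) (r t : R).

(* [ball] on [R * R] is a square, hence this Euclidean disc. *)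
Definition disc p r : set (plane R) :=
  [set q | (q.1 - p.1) ^+ 2 + (q.2 - p.2) ^+ 2 < r ^+ 2].

Definition boundary U : set (plane R) := closure U `\` U.

Definition definable2 (A : ominimal R) U :=
  A 2%N [set v | U (v 0 0, v 0 1)].

Definition site (A : ominimal R) : set (set (plane R)) :=
  [set U | [/\ open U, bounded_set U & definable2 A U]].

End Plane.

(** * Distributions on open subsets of the plane *)

Section Distributions.
Context {R : realType}.
Implicit Types (U V K : set (plane R)) (phi psi : plane R -> R).

(* [dpart i j phi] is the i-th partial derivative in the first variable of the
   j-th partial derivative in the second variable. *)
Definition pderive (b : bool) phi : plane R -> R :=
  fun x => 'D_(if b then (1, 0) else (0, 1)) phi x.

Definition dpart (i j : nat) phi : plane R -> R :=
  iter i (pderive true) (iter j (pderive false) phi).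

(* All iterated partial derivatives, in any order, exist and are continuous. *)
Definition smooth phi := forall s : seq bool,
  let psi := foldr pderive phi s in
  continuous psi /\
  forall x, derivable psi x (1, 0) /\ derivable psi x (0, 1).

Definition supp phi : set (plane R) := closure [set x | phi x != 0].

Definition test U : set (plane R -> R) :=
  [set phi | [/\ smooth phi, compact (supp phi) & supp phi `<=` U]].

(* Complex-valued distributions are continuous C-linear forms on complex test
   functions; such a form is the same thing as a continuous R-linear map from
   real test functions to C, and it is represented here in that way. *)
Definition functional := (plane R -> R) -> R[i].

(* D'(U). The last clause fixes the value of the functional where it is
   irrelevant, so that equality in D'(U) is equality of functions. *)
Definition distribution U : set functional := [set T |
  [/\ forall (a : R) phi psi, test U phi -> test U psi ->
        T (a *: phi + psi) = a%:C * T phi + T psi,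
      forall K, compact K -> K `<=` U -> exists (c : R) (m : nat),
        forall phi (M : R), test U phi -> supp phi `<=` K ->
        (forall i j, (i + j <= m)%N -> forall x, `|dpart i j phi x| <= M) ->
        `|T phi| <= (c * M)%:C
    & forall phi, ~ test U phi -> T phi = 0]].

(* Restriction D'(U) -> D'(V); meaningful when V is contained in U. *)
Definition res V (T : functional) : functional :=
  fun phi => if `[< test V phi >] then T phi else 0.

(** * Sobolev spaces *)

Definition lebesgue2 := (@lebesgue_measure R \x @lebesgue_measure R)%E.

Definition L2 : set (plane R -> R) :=
  [set g | measurable_fun setT g /\ finite_norm lebesgue2 2%:E g].

Definition Sobolev_plane (k : nat) : set functional := [set F |
  distribution setT F /\
  forall i j, (i + j <= k)%N -> exists2 g : (plane R -> R) * (plane R -> R),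
    L2 g.1 /\ L2 g.2 &
    forall phi, test setT phi ->
      (-1) ^+ (i + j) * F (dpart i j phi) =
      Rintegral lebesgue2 setT (fun x => g.1 x * phi x) +i*
      Rintegral lebesgue2 setT (fun x => g.2 x * phi x)].

Definition Sobolev (k : nat) U : set functional :=
  [set f | distribution U f /\ exists2 F, Sobolev_plane k F & res U F = f].

Definition Sobolev_loc (k : nat) U : set functional :=
  [set f | distribution U f /\
    forall x, U x -> exists r : R,
      [/\ 0 < r, disc x r `<=` U & Sobolev k (disc x r) (res (disc x r) f)]].

End Distributions.

(** * Definable curves and regions between curves *)

Section LocalTypes.
Context {R : realType} (A : ominimal R).
Implicit Types (p : plane R) (r a t : R) (th : R -> R) (D : set (plane R)).

Definition polar p t (theta : R) : plane R :=
  (p.1 + t * cos theta, p.2 + t * sin theta).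

Definition definable_on a (gamma : R -> plane R) :=
  A 3%N [set v | 0 <= v 0 0 < a /\ gamma (v 0 0) = (v 0 1, v 0 2)].

(* C^1 on [0, a[, with a one-sided derivative at 0. *)
Definition C1_on a (gamma : R -> plane R) :=
  exists2 gamma' : R -> plane R, {within `[0, a[, continuous gamma'} &
    forall t, 0 <= t < a ->
      (s - t)^-1 *: (gamma s - gamma t) @[s --> within `[0, a[ t^'] -->
      gamma' t.

(* [th] is the argument of a definable C^1 curve issued from [p] and
   parametrized by the distance to [p], namely t |-> p + t e^{i th t}. The
   argument of such a curve has a continuous determination on ]0, a[, whose
   limit at 0 is an argument of the tangent vector. *)
Definition curve p a th :=
  [/\ 0 < a, {within `[0, a[, continuous th},
      definable_on a (fun t => polar p t (th t)) &
      C1_on a (fun t => polar p t (th t))].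

Definition angle th1 th2 : R := lim ((th2 t - th1 t) @[t --> 0^'+]).

Definition region p r th1 th2 : set (plane R) :=
  [set q | exists t theta,
    [/\ 0 < t < r, th1 t < theta < th2 t & q = polar p t theta]].

(* Both curves are defined beyond [r], so that nothing degenerates at the
   outer boundary of the region. *)
Definition curve_pair p r a th1 th2 :=
  [/\ 0 < r < a, curve p a th1, curve p a th2 &
      forall t, 0 < t < a -> 0 < th2 t - th1 t < 2 * pi].

Definition type_region (P : R -> Prop) p r D := exists a th1 th2,
  [/\ curve_pair p r a th1 th2, P (angle th1 th2) & D = region p r th1 th2].

Definition type_C1 p r D := 0 < r /\ D = disc p r `\ p.

Definition type_C2 := type_region (fun al => al <> 0 /\ al <> 2 * pi).

Definition type_C3 := type_region (fun al => al = 0).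

Variable k : nat.

Definition Fhat_C4 p r D : set functional := [set f |
  distribution D f /\ exists a th1 th2 th3 th4,
  [/\ [/\ curve_pair p r a th1 th2, angle th1 th2 = 2 * pi &
          D = region p r th1 th2],
      [/\ curve p a th3, curve p a th4 & forall t, 0 < t < a ->
          th1 t < th3 t /\ th3 t < th4 t /\ th4 t < th2 t],
      [/\ angle th1 th3 <> 0 /\ angle th1 th3 <> 2 * pi,
          angle th4 th2 <> 0 /\ angle th4 th2 <> 2 * pi &
          angle th3 th4 <> 0] &
      Sobolev k (region p r th1 th4) (res (region p r th1 th4) f) /\
      Sobolev k (region p r th3 th2) (res (region p r th3 th2) f)]].

Definition Fhat_C5 p r D : set functional := [set f |
  distribution D f /\ exists a th th1 th2,
  let th' t := th t + 2 * pi in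
  [/\ [/\ 0 < r < a, curve p a th &
          D = disc p r `\` [set polar p t (th t) | t in `[0, a[]],
      [/\ curve p a th1, curve p a th2 & forall t, 0 < t < a ->
          th t < th1 t /\ th1 t < th2 t /\ th2 t < th' t],
      [/\ angle th1 th2 <> 2 * pi, angle th1 th' <> 0 & angle th th2 <> 0] &
      Sobolev k (region p r th th2) (res (region p r th th2) f) /\
      Sobolev k (region p r th1 th') (res (region p r th1 th') f)]].

Definition Fhat_C234 p r D : set functional :=
  [set f | (type_C2 p r D \/ type_C3 p r D) /\ Sobolev k D f] `|`
  Fhat_C4 p r D.

Definition Fhat_C6 p r D : set functional := [set f |
  distribution D f /\ exists (n : nat) (V : 'I_n -> set (plane R)),
  [/\ (1 < n)%N, trivIset setT V, D = \bigcup_i V i &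
      forall i, Fhat_C234 p r (V i) (res (V i) f)]].

(* [Fhat p r D f]: D is of one of the types C1 to C6 at p with radius r,
   and f belongs to the space attached to that type. *)
Definition Fhat p r D : set functional :=
  [set f | type_C1 p r D /\ Sobolev k D f] `|` Fhat_C234 p r D `|`
  Fhat_C5 p r D `|` Fhat_C6 p r D.

Definition sheafF U : set functional := [set f |
  Sobolev_loc k U f /\ forall x, boundary U x -> exists r,
    0 < r /\ Fhat x r (disc x r `&` U) (res (disc x r `&` U) f)].

Definition only_cuspidal U := forall x, boundary U x -> exists r,
  0 < r /\ (type_C2 x r (disc x r `&` U) \/ type_C3 x r (disc x r `&` U)).

End LocalTypes.

(** * Exact sequences *)

(* Exactness of 0 -> X -> Y -> Z -> 0 for subgroups X, Y, Z of E1, E2, E3 and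
   the maps induced by the additive maps f and g. *)
Definition short_exact (E1 E2 E3 : zmodType)
    (X : set E1) (Y : set E2) (Z : set E3) (f : E1 -> E2) (g : E2 -> E3) :=
  [/\ forall x, X x -> f x = 0 -> x = 0,
      f @` X = Y `&` [set y | g y = 0] &
      g @` Y = Z].

(* Main.v *)
Require Import Defs.
From HB Require Import structures.
From mathcomp Require Import all_boot all_order all_algebra.
From mathcomp Require Import complex.
From mathcomp Require Import all_classical all_reals all_analysis.
From mathcomp Require Import measurable_realfun.
From mathcomp Require Import ring lra.
(* mathcomp-analysis shadows [distribution]. *)
Import Defs.

(** A function lies in W^{k,2}(U), for U bounded, as soon as it does so near every
    point of the closure of U: glue local representatives by a finite partition of
    unity. Near a boundary point where U is of type C2 or C3 the small circles meet U
    in a single arc whose opening does not tend to 2 pi, which excludes the types C1,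
    C4, C5 and C6; hence the local condition of the sheaf is membership in W^{k,2}.

    For the exact sequence only the middle term needs work. Let F and G represent the
    two functions and coincide on the intersection, and let p be a common boundary
    point. By o-minimality, either one of the two sets contains the other near p, or
    neither does on any small circle. In the latter case the two arcs overlap, and
    their union leaves out a sector with apex p since it is at most a cusp or a
    Lipschitz sector. Cut F - G to zero on one side of a curve running in the
    intersection: on the complement of that sector the result is still in W^{k,2},
    as F - G vanishes near the cut. A linear change of coordinates turns
    this complement into the complement of a quadrant, from which one extends
    by two higher-order reflections across lines (Hestenes), and F minus this extension
    represents both functions near p. *)

Set Implicit Arguments.
Unset Strict Implicit.
Unset Printing Implicit Defensive.

Import Order.TTheory GRing.Theory Num.Theory.
Import numFieldNormedType.Exports.

Local Open Scope classical_set_scope.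
Local Open Scope ring_scope.

(** * Smooth functions *)

Section SmoothFunctions.
Context {R : realType}.
Implicit Types (f g : plane R -> R) (x v : plane R).

(** Two notions of Sobolev function coexist. [Sobolev k P] consists of restrictions from the plane,
    whereas [Wk k P] only asks for weak derivatives in L^2 tested on [P]; at a cusp the second can
    be strictly larger, and extension from a cusp may fail. This is the obstacle: the glued function
    has to be a restriction from the plane although U, V and their union may all be cusps at p.
    Hence nothing is extended from these sets. Only the cut difference is extended, and from a fixed
    cone, the complement of a sector, which admits an extension; the limit opening of the union,
    less than 2 pi, leaves room for that sector. On U ∩ V the difference F - G vanishes only against
    test functions, so multiplying it by an indicator is justified by approximating the indicator by
    test functions. Functionals are represented by pairs of real L^2 functions on the whole plane,
    real and imaginary part, and restricting means testing against fewer functions. The outer terms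
    of the sequence come from the locality of distributions and from the definition of W^{k,2}(U ∩
    V) by restriction. *)

Definition dir (b : bool) : plane R := if b then (1, 0) else (0, 1).

Lemma derive_line f x v (t : R) :
  (fun h : R => h^-1 *: ((f \o shift (t *: v + x)) (h *: v) - f (t *: v + x))) =
  (fun h : R => h^-1 *: (((fun s : R => f (s *: v + x)) \o shift t) (h *: (1 : R)) -
     f (t *: v + x))).
Proof.
apply/funext => h /=; congr (_ *: (f _ - _)).
by rewrite addrA -scalerDl [h%:A]mulr1.
Qed.

(** Directional derivatives are moved to functions of one variable, where the mean value theorem and
    the chain rule apply. *)
Lemma is_derive_line f x v (t : R) df : is_derive (t *: v + x) v f df <->
  is_derive t 1 (fun s : R => f (s *: v + x)) df.
Proof.
split=> -[H1 H2]; apply: DeriveDef.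
- by move: H1; rewrite /derivable derive_line.
- by move: H2; rewrite /derive derive_line.
- by move: H1; rewrite /derivable derive_line.
- by move: H2; rewrite /derive derive_line.
Qed.

Definition gradable f := forall x b, derivable f x (dir b).

Lemma gradableP f x b : gradable f -> is_derive x (dir b) f (pderive b f x).
Proof. by move=> df; apply: DeriveDef; [exact: df|]. Qed.

Lemma MVT_center (g dg : R -> R) (s h : R) : (forall t : R, is_derive t 1 g (dg t)) ->
  exists2 c, `|c - s| <= `|h| & g (s + h) - g s = h * dg c.
Proof.
move=> dgP.
have cg a b : {within `[a, b], continuous g}.
  apply: continuous_subspaceT => t; apply: differentiable_continuous.
  by apply/derivable1_diffP; case: (dgP t).
have [h0|h0|->] := ltgtP h 0; last first.
- by exists s; rewrite ?addr0 ?subrr ?normr0// mul0r.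
- have [|c] := @MVT R g dg s (s + h) _ (fun t _ => dgP t) (cg _ _); first by rewrite ltrDl.
  rewrite in_itv/= => /andP[sc ch] ->; exists c; last by ring.
  by rewrite !gtr0_norm ?subr_gt0//; lra.
- have [|c] := @MVT R g dg (s + h) s _ (fun t _ => dgP t) (cg _ _); first by rewrite gtrDl.
  rewrite in_itv/= => /andP[sc ch] E; exists c; last by rewrite -opprB E; ring.
  by rewrite !ltr0_norm ?subr_lt0//; lra.
Qed.

Lemma MVT_dir f x b (h : R) : gradable f ->
  exists2 c : R, `|c| <= `|h| & f (h *: dir b + x) - f x = h * pderive b f (c *: dir b + x).
Proof.
move=> df.
have [|c] := @MVT_center (fun s : R => f (s *: dir b + x))
   (fun s => pderive b f (s *: dir b + x)) 0 h.
  by move=> t; apply/is_derive_line; exact: gradableP.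
by rewrite subr0 add0r scale0r add0r => ? ?; exists c.
Qed.

Lemma norm_pair (a b : R) : `|(a, b) : plane R| = Num.max `|a| `|b|.
Proof. by []. Qed.

Lemma norm_dir (c : R) b : `|c *: dir b| = `|c|.
Proof.
by rewrite normrZ; case: b; rewrite norm_pair normr1 normr0 ?maxEle ?ler01 ?ler10 ?mulr1.
Qed.

Lemma smoothP_cont (f : plane R -> R) x (e : R) : continuous f -> 0 < e ->
  exists2 d : R, 0 < d & forall y, `|y| <= d -> `|f (y + x) - f x| < e.
Proof.
move=> cf e0.
have /cvgrPdist_lt/(_ _ e0) := cf x.
move=> /nbhs_normP[d /= d0 H]; exists (d / 2); first by rewrite divr_gt0.
move=> y yd; rewrite distrC; apply: H => /=.
by rewrite opprD addrCA subrr addr0 normrN (le_lt_trans yd)// ltr_pdivrMr// ltr_pMr// ltr1n.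
Qed.

(** The increment is broken into a horizontal and a vertical one; the mean value theorem treats
    each, and continuity of the partial derivatives controls the intermediate points. The chain rule
    for affine maps rests on this. *)
Lemma is_derive_C1 f x (a b : R) : gradable f -> continuous (pderive true f) ->
  continuous (pderive false f) ->
  is_derive x (a, b) f (a * pderive true f x + b * pderive false f x).
Proof.
move=> df c1 c2.
suff H : (h^-1 *: ((f \o shift x) (h *: ((a, b) : plane R)) - f x) @[h --> (0:R)^'] -->
   a * pderive true f x + b * pderive false f x).
  apply: DeriveDef; first by apply/cvg_ex; eexists; exact: H.
  exact: (cvg_lim (@Rhausdorff R) H).
apply/cvgrPdist_lt => e e0.
(* The summand 1 makes [M] positive and the final estimate strict. *)
pose M := `|a| + `|b| + 1.
have M0 : 0 < M by rewrite ltr_wpDl// addr_ge0.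
have e0' : 0 < e / M by rewrite divr_gt0.
have [d1 d10 H1] := smoothP_cont x c1 e0'.
have [d2 d20 H2] := smoothP_cont x c2 e0'.
pose d := Num.min d1 d2.
have d0 : 0 < d by rewrite lt_min d10.
near=> h.
have hne : h != 0 by near: h; exact: nbhs_dnbhs_neq.
have hd : `|h| * M <= d.
  rewrite -ler_pdivlMr//; near: h; apply: dnbhs0_le; exact: divr_gt0.
have -> : (f \o shift x) (h *: ((a, b) : plane R)) - f x =
   (f ((h * a) *: dir true + ((h * b) *: dir false + x)) - f ((h * b) *: dir false + x)) +
   (f ((h * b) *: dir false + x) - f x).
  rewrite addrA subrK; congr (f _ - _); rewrite /= addrA; congr (_ + _).
  by apply/pair_equal_spec; rewrite /= /GRing.scale/=; split; ring.
have [c Hc ->] := MVT_dir ((h * b) *: dir false + x) true (h * a) df.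
have [c' Hc' ->] := MVT_dir x false (h * b) df.
have E1 := H1 (c *: dir true + (h * b) *: dir false).
have E2 := H2 (c' *: dir false).
have ha : `|h * a| <= d.
  by rewrite (le_trans _ hd)// normrM ler_wpM2l// /M -addrA lerDl addr_ge0.
have hb : `|h * b| <= d.
  by rewrite (le_trans _ hd)// normrM ler_wpM2l// /M addrAC lerDr addr_ge0.
have {E1} E1 : `|pderive true f (c *: dir true + ((h * b) *: dir false + x)) - pderive true f x| < e / M.
  rewrite addrA; apply: E1.
  have -> : c *: dir true + (h * b) *: dir false = (c, h * b).
    by apply/pair_equal_spec; rewrite /= /GRing.scale/=; split; ring.
  rewrite norm_pair ge_max; apply/andP; split.
    by rewrite (le_trans Hc)// (le_trans ha)// /d ge_min lexx.
  by rewrite (le_trans hb)// /d ge_min lexx.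
have {E2} E2 : `|pderive false f (c' *: dir false + x) - pderive false f x| < e / M.
  apply: E2; rewrite norm_dir (le_trans Hc')// (le_trans hb)// /d ge_min lexx orbT//.
rewrite distrC; move: E1 E2.
move: (pderive true f _) (pderive false f _) => A B.
move: (pderive true f _) (pderive false f _) => A' B' E1 E2.
have -> : h^-1 *: (h * a * A + h * b * B) - (a * A' + b * B') = a * (A - A') + b * (B - B').
  by rewrite /GRing.scale/=; clear -hne; field.
rewrite (le_lt_trans (ler_normD _ _))// !normrM.
have H : `|a| * (e / M) + `|b| * (e / M) < M * (e / M).
  by rewrite -mulrDl ltr_pM2r// /M ltrDl.
move: H; rewrite [M * _]mulrC divfK ?lt0r_neq0//; apply: le_lt_trans.
by apply: lerD; rewrite ler_wpM2l// ltW.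
Unshelve. all: by end_near.
Qed.

Lemma dist_split (A B C e : R) : `|C - A| < e / 2 -> `|C - B| < e / 2 -> `|A - B| <= e.
Proof.
rewrite distrC => H1 H2.
by rewrite (le_trans (ler_distD C _ _))// [leRHS]splitr lerD// ltW.
Qed.

(* Both iterated differences equal f (x+h,y+h) - f (x+h,y) - f (x,y+h) + f (x,y). *)
Lemma pderive_comm f : gradable f -> gradable (pderive true f) -> gradable (pderive false f) ->
  continuous (pderive true (pderive false f)) -> continuous (pderive false (pderive true f)) ->
  pderive true (pderive false f) = pderive false (pderive true f).
Proof.
move=> df d1 d2 c12 c21; apply/funext => x.
have key b (h : R) : gradable (pderive b f) -> h != 0 ->
    exists2 y : plane R, `|y| <= `|h| &
    f (h *: dir b + (h *: dir (~~ b) + x)) - f (h *: dir (~~ b) + x)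
     - (f (h *: dir b + x) - f x) = h * h * pderive (~~ b) (pderive b f) (y + x).
  move=> db h0.
  pose g (s : R) := f (s *: dir b + (h *: dir (~~ b) + x)) - f (s *: dir b + x).
  have [|c Hc E] := @MVT_center g (fun s => pderive b f (s *: dir b + (h *: dir (~~ b) + x))
       - pderive b f (s *: dir b + x)) 0 h.
    by move=> t; apply: is_deriveB; apply/is_derive_line; exact: gradableP.
  move: E; rewrite /g add0r !scale0r !add0r => E.
  have [c' Hc' E'] := MVT_dir (c *: dir b + x) (~~ b) h db.
  exists (c' *: dir (~~ b) + c *: dir b).
    move: Hc; rewrite subr0 => Hc.
    have -> : c' *: dir (~~ b) + c *: dir b = (if b then (c, c') else (c', c)).
      by rewrite /dir; case: (b); apply/pair_equal_spec; rewrite /= /GRing.scale/=; split; ring.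
    by case: (b); rewrite norm_pair ge_max Hc Hc'.
  have -> : c' *: dir (~~ b) + c *: dir b + x = c' *: dir (~~ b) + (c *: dir b + x).
    by rewrite addrA.
  move: E E'; rewrite [h *: dir (~~ b) + (c *: _ + _)]addrCA.
  move: (f (h *: dir b + (h *: dir (~~ b) + x))) (f (h *: dir b + x)).
  move: (f (h *: dir (~~ b) + x)) (f x) (pderive (~~ b) _ _) => F3 F4 P F1 F2 + E'.
  by rewrite E' -mulrA => <-; ring.
apply/eqP; rewrite -subr_eq0 -normr_le0; apply/ler_addgt0Pr => e e0; rewrite add0r.
have e2 : 0 < e / 2 by rewrite divr_gt0.
have [a1 a10 H1] := smoothP_cont x c12 e2.
have [a2 a20 H2] := smoothP_cont x c21 e2.
have [h h0 [ha1 ha2]] : exists2 h, 0 < h & h <= a1 /\ h <= a2.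
  by exists (Num.min a1 a2); rewrite ?lt_min ?a10 ?ge_min ?lexx ?orbT.
have [y1 Y1 E1] := key true h d1 (lt0r_neq0 h0).
have [y2 Y2 E2] := key false h d2 (lt0r_neq0 h0).
have E : pderive false (pderive true f) (y1 + x) = pderive true (pderive false f) (y2 + x).
  have hh := lt0r_neq0 (mulr_gt0 h0 h0).
  move: E1 E2; rewrite /= [h *: dir false + (h *: _ + _)]addrCA.
  move: (pderive false _ _) (pderive true _ _) => P Q.
  move: (f (h *: dir true + (h *: dir false + x))) (f (h *: dir false + x)).
  move: (f (h *: dir true + x)) (f x) => F1 F2 F3 F4 E1 E2.
  by apply: (mulfI hh); rewrite -E1 -E2; ring.
have {}H1 := H1 y2; have {}H2 := H2 y1.
rewrite (gtr0_norm h0) in Y1 Y2.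
have {}H1 : `|pderive true (pderive false f) (y2 + x) - pderive true (pderive false f) x| < e / 2.
  apply: H1; exact: le_trans Y2 _.
have {}H2 : `|pderive false (pderive true f) (y1 + x) - pderive false (pderive true f) x| < e / 2.
  apply: H2; exact: le_trans Y1 _.
rewrite E in H2; exact: dist_split H1 H2.
Qed.

(** [smooth] speaks of all words in the two partial derivatives at once; this recursive form allows
    closure properties to be proved by induction on the order. *)
Fixpoint Cn n f : Prop := continuous f /\
  if n is m.+1 then gradable f /\ forall b, Cn m (pderive b f) else True.

Lemma CnW n f : Cn n.+1 f -> Cn n f.
Proof.
elim: n f => [|n IH] f; first by case.
by move=> [cf [df H]]; split => //; split => // b; apply: IH; exact: H.
Qed.

Lemma smoothP f : smooth f <-> forall n, Cn n f.
Proof.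
split=> [sf n|H].
  have {}sf s : continuous (foldr pderive f s) /\ gradable (foldr pderive f s).
    have [cs H] := sf s; split; first exact: cs.
    by move=> x [|]; have [H1 H2] := H x; [exact: H1|exact: H2].
  suff H s : Cn n (foldr pderive f s) by exact: H [::].
  elim: n s => [|n IH] s; have [cs ds] := sf s; split => //; split => // b.
  exact: IH (b :: s).
have {}H s n : Cn n (foldr pderive f s).
  elim: s n => //= b s IH n.
  by have [_ [_]] := IH n.+1; apply.
move=> s psi; have [cs [ds _]] := H s 1%N.
by split => // x; split; [exact: (ds x true)|exact: (ds x false)].
Qed.

Lemma smooth_continuous f : smooth f -> continuous f.
Proof. by move=> /smoothP/(_ 0%N)[]. Qed.

Lemma smooth_gradable f : smooth f -> gradable f.
Proof. by move=> /smoothP/(_ 1%N)[_ []]. Qed.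

Lemma smooth_pderive b f : smooth f -> smooth (pderive b f).
Proof. by move=> /smoothP sf; apply/smoothP => n; have [_ [_]] := sf n.+1; apply. Qed.

Lemma pderiveD f g b : gradable f -> gradable g ->
  pderive b (f + g) = pderive b f + pderive b g.
Proof. by move=> df dg; apply/funext => x; rewrite /pderive deriveD//; [exact: df|exact: dg]. Qed.

Lemma pderiveM f g b : gradable f -> gradable g ->
  pderive b (f * g) = f * pderive b g + g * pderive b f.
Proof. by move=> df dg; apply/funext => x; rewrite /pderive deriveM//; [exact: df|exact: dg]. Qed.

Lemma pderive_cst (c : R) b : pderive b (cst c : plane R -> R) = cst 0.
Proof. by apply/funext => x; rewrite /pderive derive_cst. Qed.

Lemma gradableD f g : gradable f -> gradable g -> gradable (f + g).
Proof. by move=> df dg x b; apply: derivableD; [exact: df|exact: dg]. Qed.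

Lemma gradableM f g : gradable f -> gradable g -> gradable (f * g).
Proof. by move=> df dg x b; apply: derivableM; [exact: df|exact: dg]. Qed.

Lemma Cn_cst n (c : R) : Cn n (cst c).
Proof.
elim: n c => [|n IH] c; split => //; try exact: cst_continuous.
by split => [x b|b]; [exact: derivable_cst|rewrite pderive_cst].
Qed.

Lemma CnD n f g : Cn n f -> Cn n g -> Cn n (f + g).
Proof.
elim: n f g => [|n IH] f g [cf df] [cg dg]; split=> //; try by move=> x; apply: cvgD; [exact: cf|exact: cg].
case: df dg => [df Hf] [dg Hg]; split; first exact: gradableD.
by move=> b; rewrite pderiveD//; apply: IH; [exact: Hf|exact: Hg].
Qed.

Lemma CnM n f g : Cn n f -> Cn n g -> Cn n (f * g).
Proof.
elim: n f g => [|n IH] f g Hf0 Hg0; have [cf df] := Hf0; have [cg dg] := Hg0;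
  split=> //; try by move=> x; apply: cvgM; [exact: cf|exact: cg].
case: df dg => [df Hf] [dg Hg]; split; first exact: gradableM.
move=> b; rewrite (pderiveM b df dg).
exact: (CnD (IH _ _ (CnW Hf0) (Hg b)) (IH _ _ (CnW Hg0) (Hf b))).
Qed.

Lemma smooth_cst (c : R) : smooth (cst c : plane R -> R).
Proof. by apply/smoothP => n; exact: Cn_cst. Qed.

Lemma smoothD f g : smooth f -> smooth g -> smooth (f + g).
Proof. by move=> /smoothP sf /smoothP sg; apply/smoothP => n; exact: CnD. Qed.

Lemma smoothM f g : smooth f -> smooth g -> smooth (f * g).
Proof. by move=> /smoothP sf /smoothP sg; apply/smoothP => n; exact: CnM. Qed.

Lemma cstM_funE (c : R) f : c *: f = cst c * f.
Proof. by apply/funext. Qed.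

Lemma smoothZ (c : R) f : smooth f -> smooth (c *: f).
Proof. by rewrite cstM_funE; apply: smoothM; exact: smooth_cst. Qed.

Lemma smoothN f : smooth f -> smooth (- f).
Proof. by rewrite -scaleN1r; exact: smoothZ. Qed.

Lemma smoothB f g : smooth f -> smooth g -> smooth (f - g).
Proof. by move=> sf /smoothN sg; exact: (smoothD sf sg). Qed.

Lemma pderiveZ (c : R) f b : gradable f -> pderive b (c *: f) = c *: pderive b f.
Proof. by move=> df; apply/funext => x; rewrite /pderive deriveZ//; exact: df. Qed.

Lemma pderiveN f b : gradable f -> pderive b (- f) = - pderive b f.
Proof. by move=> df; apply/funext => x; rewrite /pderive deriveN//; exact: df. Qed.

Lemma pderive_smooth_comm f : smooth f ->
  pderive true (pderive false f) = pderive false (pderive true f).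
Proof.
move=> sf; have s1 b := smooth_pderive b sf; have s2 b b' := smooth_pderive b (s1 b').
exact: (pderive_comm (smooth_gradable sf) (smooth_gradable (s1 _)) (smooth_gradable (s1 _))
  (smooth_continuous (s2 _ _)) (smooth_continuous (s2 _ _))).
Qed.

Lemma is_derive_coord x v (c : R) b :
  is_derive x v (fun y : plane R => c * (if b then y.1 else y.2)) (c * (if b then v.1 else v.2)).
Proof.
set l := fun y : plane R => _.
suff H : (h^-1 *: ((l \o shift x) (h *: v) - l x) @[h --> (0:R)^'] --> c * (if b then v.1 else v.2)).
  apply: DeriveDef; first by apply/cvg_ex; eexists; exact: H.
  exact: (cvg_lim (@Rhausdorff R) H).
apply: cvg_near_cst; near=> h => /=.
have h0 : h != 0 by near: h; exact: nbhs_dnbhs_neq.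
by rewrite /l; case: (b); rewrite /= /GRing.scale/=; field.
Unshelve. all: by end_near.
Qed.

Definition affine f := exists a b c : R, f = fun x => a * x.1 + b * x.2 + c.

Lemma is_derive_affine x v (a b c : R) :
  is_derive x v (fun y : plane R => a * y.1 + b * y.2 + c) (a * v.1 + b * v.2).
Proof.
have := @is_deriveD _ _ _ _ _ x v _ _ (is_deriveD (is_derive_coord x v a true)
  (is_derive_coord x v b false)) (is_derive_cst c x v).
by rewrite addr0.
Qed.

Lemma continuous_affine (a b c : R) : continuous (fun x : plane R => a * x.1 + b * x.2 + c).
Proof.
move=> x; apply: cvgD; last exact: cvg_cst.
by apply: cvgD; apply: cvgM; (try exact: cvg_cst); [exact: cvg_fst|exact: cvg_snd].
Qed.

Lemma affine_smooth f : affine f -> smooth f.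
Proof.
move=> [a [b [c ->]]].
have d x d' := is_derive_affine x (dir d') a b c.
apply/smoothP => -[|n]; split=> //.
- exact: continuous_affine.
- exact: continuous_affine.
- split=> [x b'|b']; first by case: (d x b').
  rewrite (_ : pderive _ _ = cst (a * (dir b').1 + b * (dir b').2)); first exact: Cn_cst.
  by apply/funext => x; case: (d x b').
Qed.

End SmoothFunctions.

(** * Smooth transition functions and bumps *)

Section Bumps.
Context {R : realType}.
Implicit Types (f g : plane R -> R) (x v p : plane R) (s t : R).

Lemma is_derive_comp1 (h : R -> R) g x v (dh dg : R) :
  is_derive (g x) 1 h dh -> is_derive x v g dg -> is_derive x v (h \o g) (dh * dg).
Proof.
move=> H1 H2.
have E : x = (0 : R) *: v + x by rewrite scale0r add0r.
rewrite E; apply/is_derive_line; apply: (@is_derive1_comp R h (fun s => g (s *: v + x))).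
  by rewrite -E.
by apply/is_derive_line; rewrite -E.
Qed.

Lemma is_derive_pderive f b (df : plane R -> R) : (forall x, is_derive x (dir b) f (df x)) ->
  pderive b f = df.
Proof. by move=> H; apply/funext => x; case: (H x). Qed.

(** The case [m = 0] is the classical flat function exp(-1/s); the powers of 1/s close the family
    under differentiation. *)
Definition flat m s : R := if 0 < s then s^-1 ^+ m * expR (- s^-1) else 0.

Lemma flat_ge0 m s : 0 <= flat m s.
Proof.
by rewrite /flat; case: ifP => // s0; rewrite mulr_ge0 ?expR_ge0 ?exprn_ge0 ?invr_ge0 ?ltW.
Qed.

(** Bounding exp(1/s) from below by the term of order [m + 1] of its series leaves one factor s,
    which gives the limit at 0. *)
Lemma flat_le m s : 0 <= s -> flat m s <= m.+1`!%:R * s.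
Proof.
rewrite /flat le_eqVlt => /orP[/eqP<-|s0]; first by rewrite ltxx mulr0.
rewrite s0 expRN ler_pdivrMr ?expR_gt0//.
have := @expR_ge1Dxn R s^-1 m; rewrite invr_ge0 (ltW s0) => /(_ isT) H.
have F : 0 < (m.+1`!%:R : R) by rewrite ltr0n fact_gt0.
rewrite (@le_trans _ _ (m.+1`!%:R * s * (s^-1 ^+ m.+1 / m.+1`!%:R)))//.
  rewrite exprS le_eqVlt; apply/orP; left; apply/eqP; field.
  by rewrite !lt0r_neq0.
by rewrite ler_pM2l ?mulr_gt0// (le_trans _ H)// lerDr.
Qed.

Lemma flat_le0 m s : s <= 0 -> flat m s = 0.
Proof. by rewrite /flat leNgt => /negbTE ->. Qed.

Lemma is_derive_flat m s : is_derive s 1 (flat m) (- m%:R * flat m.+1 s + flat m.+2 s).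
Proof.
have [s0|s0|->] := ltgtP s 0.
- rewrite !flat_le0 ?(ltW s0)// mulr0 addr0.
  apply: (@near_eq_is_derive _ _ _ (cst (0 : R))).
  by near=> t; rewrite /cst flat_le0// ltW//; near: t; exact: lt_nbhsl.
- pose phi (y : R) := y ^+ m * expR (- y).
  have D1 : is_derive (s^-1) 1 phi (m%:R * s^-1 ^+ m.-1 * expR (- s^-1) - s^-1 ^+ m * expR (- s^-1)).
    have E : is_derive (s^-1) 1 (fun y : R => expR (- y)) (expR (- s^-1) * (- 1)).
      by apply: is_derive1_comp.
    have X : is_derive (s^-1) 1 (fun y : R => y ^+ m) (m%:R * s^-1 ^+ m.-1).
      have := @is_deriveX R R id m s^-1 1 1 (is_derive_id _ _); rewrite /GRing.scale/= mulr1.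
      rewrite (_ : id ^+ m = (fun y : R => y ^+ m))//; apply/funext => y.
      by elim: (m) => [|k IH]; rewrite ?expr0// !exprS -IH.
    have := is_deriveM X E; rewrite /GRing.scale/=.
    by rewrite mulrN1 mulrN addrC [expR _ * (m%:R * _)]mulrC.
  have D2 : is_derive s 1 (fun y : R => y^-1) (- s ^- 2).
    have := @is_deriveV R id s 1 1 (lt0r_neq0 s0) (is_derive_id _ _).
    by rewrite /GRing.scale/= mulr1.
  have := is_derive1_comp D1 D2.
  rewrite (_ : _ * - s ^- 2 = - m%:R * flat m.+1 s + flat m.+2 s); last first.
    rewrite /flat s0 -exprVn; case: m {phi D1} => [|m] /=; rewrite !exprS ?expr0; ring.
  move=> D'.
  apply: (near_eq_is_derive _ D').
  by near=> t; rewrite /flat ifT//; near: t; exact: lt_nbhsr.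
- rewrite !flat_le0 ?lexx// mulr0 addr0.
  suff H : (h^-1 *: ((flat m \o shift 0) (h *: (1 : R)) - flat m 0) @[h --> (0:R)^'] --> (0 : R)).
    apply: DeriveDef; first by apply/cvg_ex; eexists; exact: H.
    exact: (cvg_lim (@Rhausdorff R) H).
  rewrite flat_le0//; apply/cvgrPdist_le => e e0; near=> h.
  rewrite /= sub0r normrN subr0 addr0 {2}/GRing.scale/= mulr1 /GRing.scale/=.
  have [h0|h0] := leP h 0; first by rewrite flat_le0// mulr0 normr0 ltW.
  rewrite ger0_norm ?mulr_ge0 ?flat_ge0 ?invr_ge0 ?(ltW h0)//.
  (* The difference quotient at 0 is again a member of the family, so [flat_le] bounds it. *)
  rewrite (_ : _ * _ = flat m.+1 h); last by rewrite /flat h0 exprS mulrA.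
  rewrite (le_trans (flat_le _ (ltW h0)))// -(gtr0_norm h0) mulrC -ler_pdivlMr ?ltr0n ?fact_gt0//.
  by near: h; apply: dnbhs0_le; rewrite divr_gt0// ltr0n fact_gt0.
Unshelve. all: by end_near.
Qed.

Lemma continuous_is_derive (h dh : R -> R) : (forall s : R, is_derive s 1 h (dh s)) -> continuous h.
Proof.
move=> H s; apply: differentiable_continuous; apply/derivable1_diffP.
by case: (H s).
Qed.

Lemma smooth_flat m g : smooth g -> smooth (flat m \o g).
Proof.
move=> sg; apply/smoothP => n; elim: n m => [|n IH] m; split=> //.
- move=> x; apply: continuous_comp; first exact: smooth_continuous.
  exact: (continuous_is_derive (is_derive_flat m)).
- move=> x; apply: continuous_comp; first exact: smooth_continuous.
  exact: (continuous_is_derive (is_derive_flat m)).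
- have D x b := is_derive_comp1 (is_derive_flat m (g x)) (gradableP x b (smooth_gradable sg)).
  split; first by move=> x b; case: (D x b).
  move=> b; rewrite (is_derive_pderive (fun x => D x b)).
  have /smoothP/(_ n) Hg := smooth_pderive b sg.
  exact: (CnM (CnD (CnM (Cn_cst n (- m%:R)) (IH m.+1)) (IH m.+2)) Hg).
Qed.

Lemma smooth_inv g : (forall x, g x != 0) -> smooth g -> smooth (fun x => (g x)^-1).
Proof.
move=> g0 sg.
have D x b := is_derive_comp1 (@is_deriveV R id (g x) 1 1 (g0 x) (is_derive_id _ _))
   (gradableP x b (smooth_gradable sg)).
have cg x : {for x, continuous (fun x => (g x)^-1)}.
  by apply: cvgV; [exact: g0|exact: smooth_continuous].
apply/smoothP; elim=> [|n IH]; split=> //; split.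
  by move=> x b; case: (D x b).
move=> b; rewrite (is_derive_pderive (fun x => D x b)).
have /smoothP/(_ n) Hg := smooth_pderive b sg.
rewrite (_ : (fun _ => _) = cst (-1) * ((fun x => (g x)^-1) * (fun x => (g x)^-1)) * pderive b g).
  exact: (CnM (CnM (Cn_cst n _) (CnM IH IH)) Hg).
apply/funext => x; rewrite /GRing.scale/= mulr1 !mulrfctE /cst/= expr2 invfM mulN1r.
by [].
Qed.

(** The usual smooth transition, 0 up to 0 and 1 from 1 on; the denominator is positive because s
    and 1 - s are never both nonpositive. *)
Definition step s : R := flat 0 s / (flat 0 s + flat 0 (1 - s)).

Lemma flat0_gt0 s : 0 < s -> 0 < flat 0 s.
Proof. by move=> s0; rewrite /flat s0 expr0 mul1r expR_gt0. Qed.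

Lemma step_den s : 0 < flat 0 s + flat 0 (1 - s).
Proof.
have [s0|s0] := ltP 0 s; first by rewrite ltr_wpDr ?flat_ge0 ?flat0_gt0.
by rewrite ltr_wpDl ?flat_ge0 ?flat0_gt0// subr_gt0 (le_lt_trans s0).
Qed.

Lemma step_ge0 s : 0 <= step s.
Proof. by rewrite divr_ge0 ?flat_ge0// ltW ?step_den. Qed.

Lemma step_le1 s : step s <= 1.
Proof. by rewrite ler_pdivrMr ?step_den// mul1r lerDl flat_ge0. Qed.

Lemma step0 s : s <= 0 -> step s = 0.
Proof. by move=> s0; rewrite /step flat_le0// mul0r. Qed.

Lemma step1 s : 1 <= s -> step s = 1.
Proof.
move=> s1; rewrite /step [flat 0 (1 - s)]flat_le0 ?subr_le0// addr0 divff//.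
by rewrite lt0r_neq0// flat0_gt0// (lt_le_trans _ s1).
Qed.

Lemma smooth_step g : smooth g -> smooth (step \o g).
Proof.
move=> sg.
have s1 := smooth_flat 0 sg.
have s2 := smooth_flat 0 (smoothB (smooth_cst 1) sg).
have s3 := smooth_inv (fun x => lt0r_neq0 (step_den (g x))) (smoothD s1 s2).
exact: (smoothM s1 s3).
Qed.

Definition sqd p x : R := (x.1 - p.1) ^+ 2 + (x.2 - p.2) ^+ 2.

Lemma smooth_sqd p : smooth (sqd p).
Proof.
have s1 : smooth (fun x => x.1 - p.1).
  by apply: affine_smooth; exists 1, 0, (- p.1); apply/funext => x; ring.
have s2 : smooth (fun x => x.2 - p.2).
  by apply: affine_smooth; exists 0, 1, (- p.2); apply/funext => x; ring.
rewrite (_ : sqd p = (fun x => x.1 - p.1) * (fun x => x.1 - p.1) +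
   (fun x => x.2 - p.2) * (fun x => x.2 - p.2)).
  exact: (smoothD (smoothM s1 s1) (smoothM s2 s2)).
by apply/funext.
Qed.

Lemma sqd_ge0 p x : 0 <= sqd p x.
Proof. by rewrite addr_ge0 ?sqr_ge0. Qed.

Lemma discE p r x : disc p r x = (sqd p x < r ^+ 2).
Proof. by []. Qed.

(** The argument of [step] is at least 1 when the squared distance is at most r^2 / 4, and at most 0
    from r^2 / 2 on. Hence the value 1 on the half disc and a support inside the open disc. *)
Definition bump p r x : R := step (2 - 4 * (r ^+ 2)^-1 * sqd p x).

Lemma smooth_bump p r : smooth (bump p r).
Proof.
apply: (@smooth_step (fun x => 2 - 4 * (r ^+ 2)^-1 * sqd p x)).
rewrite (_ : (fun _ => _) = cst 2 - (4 * (r ^+ 2)^-1) *: sqd p); last by apply/funext.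
exact: (smoothB (smooth_cst _) (smoothZ _ (smooth_sqd _))).
Qed.

Lemma bump_ge0 p r x : 0 <= bump p r x. Proof. exact: step_ge0. Qed.
Lemma bump_le1 p r x : bump p r x <= 1. Proof. exact: step_le1. Qed.

Lemma bump1 p r x : 0 < r -> disc p (r / 2) x -> bump p r x = 1.
Proof.
move=> r0; rewrite discE => H; apply: step1.
have r20 : 0 < r ^+ 2 by rewrite exprn_gt0.
suff : 4 * (r ^+ 2)^-1 * sqd p x <= 1 by move=> ?; lra.
rewrite mulrAC ler_pdivrMr// mul1r.
by move: H; rewrite expr_div_n; move: (sqd p x) (r ^+ 2) => a b; lra.
Qed.

Lemma bump0 p r x : 0 < r -> r ^+ 2 / 2 <= sqd p x -> bump p r x = 0.
Proof.
move=> r0 H; apply: step0.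
have r20 : 0 < r ^+ 2 by rewrite exprn_gt0.
suff : 2 <= 4 * (r ^+ 2)^-1 * sqd p x by move=> ?; lra.
rewrite mulrAC ler_pdivlMr//.
by move: H; move: (sqd p x) (r ^+ 2) => a b; lra.
Qed.

End Bumps.

(** * Test functions *)

Section TestFunctions.
Context {R : realType}.
Implicit Types (f g phi psi : plane R -> R) (x y p : plane R) (r : R) (U V K : set (plane R)).

Lemma continuous_sqd p : continuous (sqd p).
Proof. exact: smooth_continuous (smooth_sqd p). Qed.

Lemma open_disc p r : open (disc p r).
Proof.
have /continuousP/(_ [set s : R | s < r ^+ 2]) := @continuous_sqd p.
by apply; exact: open_lt.
Qed.

Lemma disc_center p r : 0 < r -> disc p r p.
Proof. by move=> r0; rewrite discE /sqd !subrr expr0n addr0 exprn_gt0. Qed.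

Lemma disc_coord p r x : 0 < r -> disc p r x -> `|x.1 - p.1| < r /\ `|x.2 - p.2| < r.
Proof.
move=> r0; rewrite /disc/= => H; split; rewrite -(ltr_pXn2r (n := 2)) ?nnegrE ?(ltW r0)//;
  rewrite real_normK ?num_real// (le_lt_trans _ H)// ?lerDl ?lerDr sqr_ge0//.
Qed.

Lemma disc_nbhs x U : nbhs x U -> exists2 r, 0 < r & disc x r `<=` U.
Proof.
move=> /nbhs_ballP[e /= e0 H]; exists e => // y /(disc_coord e0)[H1 H2].
by apply: H; split; rewrite /= /ball/= distrC.
Qed.

Lemma nbhs_disc x r : 0 < r -> nbhs x (disc x r).
Proof. by move=> r0; apply: open_nbhs_nbhs; split; [exact: open_disc|exact: disc_center]. Qed.

Lemma open_disc_sub U x : open U -> U x -> exists2 r, 0 < r & disc x r `<=` U.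
Proof. by move=> oU Ux; apply: disc_nbhs; apply: open_nbhs_nbhs. Qed.

Lemma subset_disc x r s : 0 <= r <= s -> disc x r `<=` disc x s.
Proof.
move=> /andP[r0 rs] y; rewrite !discE => H; apply: (lt_le_trans H).
by rewrite ler_pXn2r// nnegrE (le_trans r0).
Qed.

Lemma compact_cdisc p r : compact [set x | sqd p x <= r ^+ 2].
Proof.
pose K := `[p.1 - `|r|, p.1 + `|r|] `*` `[p.2 - `|r|, p.2 + `|r|].
apply: (@subclosed_compact _ _ K).
- have /continuous_closedP/(_ [set s : R | s <= r ^+ 2]) := @continuous_sqd p.
  by apply; exact: closed_le.
- by apply: compact_setX; exact: segment_compact.
- move=> x /= H; rewrite /sqd in H.
  have : `|x.1 - p.1| <= `|r| /\ `|x.2 - p.2| <= `|r|.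
    split; rewrite -(ler_pXn2r (n := 2)) ?nnegrE//;
    rewrite !real_normK ?num_real// (le_trans _ H)// ?lerDl ?lerDr sqr_ge0//.
  by rewrite !ler_norml => -[/andP[? ?] /andP[? ?]]; split; rewrite /= in_itv/=; apply/andP; split; lra.
Qed.

Lemma compact_sub_closed K U : compact K -> closed U -> U `<=` K -> compact U.
Proof. by move=> cK cU UK; exact: subclosed_compact cU cK UK. Qed.

Lemma closed_supp phi : closed (supp phi).
Proof. exact: closed_closure. Qed.

Lemma supp_sub phi K : closed K -> (forall x, phi x != 0 -> K x) -> supp phi `<=` K.
Proof.
by move=> cK H; rewrite /supp [K](closure_id _).1//; exact: closure_subset.
Qed.

Lemma supp_out phi x : ~ supp phi x -> phi x = 0.
Proof.
move=> H; apply/eqP/negPn/negP => n0; apply: H.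
by apply: subset_closure.
Qed.

Lemma supp_mono phi psi : (forall x, phi x = 0 -> psi x = 0) -> supp psi `<=` supp phi.
Proof.
move=> H; apply: closure_subset => x /= /eqP n0; apply/eqP => E; apply: n0; exact: H.
Qed.

Lemma suppD phi psi : supp (phi + psi) `<=` supp phi `|` supp psi.
Proof.
apply: supp_sub; first by apply: closedU; exact: closed_supp.
move=> x n0; apply: contrapT => /not_orP[/supp_out H1 /supp_out H2].
by move: n0; have -> : (phi + psi) x = phi x + psi x by []; rewrite H1 H2 addr0 eqxx.
Qed.

Lemma test_smooth U phi : test U phi -> smooth phi. Proof. by case. Qed.

Lemma test_sub U V phi : U `<=` V -> test U phi -> test V phi.
Proof. by move=> UV [? ? ?]; split => //; exact: subset_trans UV. Qed.

Lemma test_supp U K phi psi : test U phi -> smooth psi -> supp psi `<=` supp phi `&` K -> test (U `&` K) psi.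
Proof.
move=> [sp cp UP] spsi H; split=> //.
- by apply: compact_sub_closed cp (@closed_supp _) _ => x /H[].
- by move=> x /H[/UP].
Qed.

Lemma test_supp' U phi psi : test U phi -> smooth psi -> (forall x, phi x = 0 -> psi x = 0) -> test U psi.
Proof.
move=> tp sp H; have := @test_supp U setT phi psi tp sp; rewrite !setIT; apply.
exact: supp_mono.
Qed.

Lemma testD U phi psi : test U phi -> test U psi -> test U (phi + psi).
Proof.
move=> [s1 c1 u1] [s2 c2 u2]; split; first exact: smoothD.
- exact: compact_sub_closed (compactU c1 c2) (@closed_supp _) (@suppD _ _).
- by move=> x /suppD[/u1|/u2].
Qed.

Lemma testMl U phi g : smooth g -> test U phi -> test U (g * phi).
Proof.
move=> sg tp; apply: test_supp' tp (smoothM sg (test_smooth tp)) _ => x E.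
by have -> : (g * phi) x = g x * phi x by []; rewrite E mulr0.
Qed.

Lemma testZ U phi (a : R) : test U phi -> test U (a *: phi).
Proof. by rewrite cstM_funE; apply: testMl; exact: smooth_cst. Qed.

Lemma test0 U : test U (0 : plane R -> R).
Proof.
have E : supp (0 : plane R -> R) = set0.
  by rewrite /supp [X in closure X](_ : _ = set0) ?closure0//; apply/seteqP; split=> x //=; rewrite eqxx.
by split; rewrite ?E//; [exact: (smooth_cst 0)|exact: compact0].
Qed.

Lemma test_set0 phi : test set0 phi -> phi = 0.
Proof.
by move=> [_ _ H]; apply/funext => x; apply: supp_out => /H.
Qed.

Lemma supp_pderive b phi : supp (pderive b phi) `<=` supp phi.
Proof.
apply: supp_sub; first exact: closed_supp.
move=> x; apply: contraPP => nx; apply/negP/negPn/eqP.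
have /= N : nbhs x (~` supp phi) by apply: open_nbhs_nbhs; split=> //; exact: closed_openC (@closed_supp _).
have : is_derive x (dir b) phi 0.
  apply: (@near_eq_is_derive _ _ _ (cst (0 : R))).
  by apply: filterS N => y /supp_out ->.
by case.
Qed.

Lemma test_pderive U phi b : test U phi -> test U (pderive b phi).
Proof.
move=> [sp cp up]; have H := @supp_pderive b phi.
split; first exact: smooth_pderive.
- exact: compact_sub_closed cp (@closed_supp _) H.
- exact: subset_trans up.
Qed.

Lemma supp_bump p r : 0 < r -> supp (bump p r) `<=` [set x | sqd p x <= r ^+ 2 / 2].
Proof.
move=> r0; apply: supp_sub.
  have /continuous_closedP/(_ [set s : R | s <= r ^+ 2 / 2]) := @continuous_sqd p.
  by apply; exact: closed_le.
move=> x /=; apply: contraNT; rewrite -ltNge => H; apply/eqP.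
by apply: bump0 => //; exact: ltW.
Qed.

Lemma supp_bump_disc p r : 0 < r -> supp (bump p r) `<=` disc p r.
Proof.
move=> r0 x /(supp_bump r0) /= H; rewrite discE (le_lt_trans H)//.
by rewrite ltr_pdivrMr ?ltr_pMr ?exprn_gt0 ?ltr1n.
Qed.

Lemma compact_discs K (r : plane R -> R) : compact K -> (forall x, K x -> 0 < r x) ->
  exists s : seq (plane R), (forall x, x \in s -> K x) /\
    forall y, K y -> exists2 x, x \in s & disc x (r x) y.
Proof.
move=> cK0 r0.
pose T : ptopologicalType :=
  HB.pack (plane R) (Pointed.on (plane R)) (Topological.on (plane R)).
have cK : @cover_compact T K by rewrite -(@compact_cover T).
have [||D DK KD] := cK _ K (fun x => disc x (r x)).
- by move=> x _; exact: open_disc.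
- by move=> x Kx; exists x => //; exact: disc_center (r0 _ Kx).
- exists (finmap.enum_fset D); split; first by move=> x xD; apply/set_mem; exact: DK.
  by move=> y /KD[x /= xD H]; exists x.
Qed.

(* Induction on a finite cover of the support: [phi = b phi + (1 - b) phi], with [b] a bump
   equal to 1 on one disc of the cover. *)
Lemma test_local_ind U (P : (plane R -> R) -> Prop) :
  P 0 -> (forall phi psi, test U phi -> test U psi -> P phi -> P psi -> P (phi + psi)) ->
  (forall x, U x -> exists2 r, 0 < r & forall phi, test U phi -> supp phi `<=` disc x r -> P phi) ->
  forall phi, test U phi -> P phi.
Proof.
move=> P0 PD Ploc phi tp.
have /(_ _)/cid H x : exists r, U x -> 0 < r /\ forall phi, test U phi -> supp phi `<=` disc x r -> P phi.
  have [Ux|nUx] := pselect (U x); last by exists 0.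
  by have [r r0 Hr] := Ploc x Ux; exists r.
pose r x := projT1 (H x).
have Hr x : U x -> 0 < r x /\ forall phi, test U phi -> supp phi `<=` disc x (r x) -> P phi.
  exact: projT2 (H x).
have [sp cp up] := tp.
(* Half radii, because a bump is 1 on the half disc: multiplying by [1 - b] removes that disc from
   the support, and one disc fewer is needed to cover it. *)
have [s [sK cov]] := @compact_discs (supp phi) (fun x => r x / 2) cp
  (fun x Kx => divr_gt0 (Hr x (up x Kx)).1 (ltr0Sn R 1)).
have {}sK x : x \in s -> U x by move=> /sK /up.
elim: s phi tp {sp cp up} sK cov => [|x s IH] phi tp sK cov.
  rewrite (_ : phi = 0)//; apply/funext => y; apply: supp_out => /cov[x]; by rewrite in_nil.
have [r0 Px] := Hr x (sK x (mem_head _ _)).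
set b := bump x (r x).
have sb : smooth b := smooth_bump _ _.
have s1b : smooth (cst 1 - b) := smoothB (smooth_cst 1) sb.
have -> : phi = b * phi + (cst 1 - b) * phi.
  by apply/funext => y; rewrite !(addrfctE, mulrfctE, opprfctE) /cst/=; ring.
apply: PD; [exact: testMl|exact: testMl| |].
  apply: Px; first exact: testMl.
  apply: subset_trans (supp_bump_disc r0); apply: supp_mono => y E.
  by rewrite mulrfctE /= /b E mul0r.
apply: IH; first exact: testMl.
  by move=> y ys; apply: sK; rewrite inE ys orbT.
move=> y Hy.
have : (supp phi `&` ~` disc x (r x / 2)) y.
  apply: (_ : supp ((cst 1 - b) * phi) `<=` _) y Hy; apply: supp_sub.
    by apply: closedI; [exact: closed_supp|exact: open_closedC (@open_disc _ _)].
  move=> y; rewrite !(addrfctE, mulrfctE, opprfctE) /cst /= => N; split.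
    by apply: contrapT => /supp_out E; rewrite E mulr0 eqxx in N.
  by move=> D; rewrite /b (bump1 r0 D) subrr mul0r eqxx in N.
by case=> /cov[z]; rewrite inE => /orP[/eqP->//|zs D _]; exists z.
Qed.

End TestFunctions.

(** * Rational discs, exhaustion of open sets by test functions, measurability *)

Section Exhaustion.
Context {R : realType}.
Implicit Types (f g phi psi : plane R -> R) (x y p : plane R) (r : R) (U V K O : set (plane R)).

Lemma test_bump U p r : 0 < r -> disc p r `<=` U -> test U (bump p r).
Proof.
move=> r0 H; split; first exact: smooth_bump.
- apply: compact_sub_closed (@compact_cdisc R p r) (@closed_supp _ _) _.
  by move=> x /(supp_bump_disc r0); rewrite discE => /ltW.
- exact: subset_trans (supp_bump_disc r0) H.
Qed.

(** Enumerates a countable base of discs with rational data. A code that decodes to nothing gives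
    radius 0, and negative radii occur too. *)
Definition qdisc (n : nat) : plane R * R :=
  let: (a, b, c) := odflt (0, 0, 0) (unpickle n : option (rat * rat * rat)) in
  ((ratr a, ratr b), ratr c).

Lemma le_sqr (a b : R) : 0 <= a -> a <= b -> a ^+ 2 <= b ^+ 2.
Proof. by move=> a0 ab; rewrite ler_pXn2r// nnegrE (le_trans a0). Qed.

(** A triangle inequality for squared distances: in each coordinate the two sides differ by a
    perfect square. *)
Lemma sqd_triangle p x y : sqd x y <= 2 * sqd p y + 2 * sqd p x.
Proof.
have H (a b c : R) : (a - b) ^+ 2 <= 2 * (a - c) ^+ 2 + 2 * (b - c) ^+ 2.
  rewrite -subr_ge0 (_ : _ - _ = (a + b - c *+ 2) ^+ 2) ?sqr_ge0//; ring.
rewrite /sqd !mulrDr addrACA; apply: lerD; exact: H.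
Qed.

Lemma qdisc_sub O x : open O -> O x ->
  exists n, [/\ 0 < (qdisc n).2, disc (qdisc n).1 (qdisc n).2 `<=` O &
               disc (qdisc n).1 ((qdisc n).2 / 2) x].
Proof.
move=> oO Ox; have [r r0 H] := open_disc_sub oO Ox.
(* The radius q lies between r/4 and r/2 and the centre is within r/16 of [x] in each coordinate.
   The squared distance to [x] is then at most r^2/128, below (q/2)^2, and 2 q^2 + 2 r^2/128 stays
   below r^2. *)
have [q] : exists q : rat, ratr q \in `]r / 4, r / 2[ by apply: rat_in_itvoo; lra.
rewrite in_itv/= => /andP[Q1 Q2].
have [a] : exists q : rat, ratr q \in `]x.1, x.1 + r / 16[ by apply: rat_in_itvoo; lra.
rewrite in_itv/= => /andP[A1 A2].
have [b] : exists q : rat, ratr q \in `]x.2, x.2 + r / 16[ by apply: rat_in_itvoo; lra.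
rewrite in_itv/= => /andP[B1 B2].
exists (pickle (a, b, q)); rewrite /qdisc pickleK/=.
have S (c d : R) : c < d -> d < c + r / 16 -> (c - d) ^+ 2 <= r ^+ 2 / 256.
  move=> cd dc; rewrite -sqrrN opprB (_ : _ / 256 = (r / 16) ^+ 2); last by field.
  by apply: le_sqr; lra.
have Hx : sqd (ratr a, ratr b) x <= r ^+ 2 / 128.
  rewrite /sqd/=; have := S _ _ A1 A2; have := S _ _ B1 B2; clear.
  by move: (r ^+ 2) ((x.1 - _) ^+ 2) ((x.2 - _) ^+ 2) => A B C; lra.
have rr : 0 < r ^+ 2 by rewrite exprn_gt0.
split; first lra.
- move=> y Hy; apply: H; rewrite discE (le_lt_trans (sqd_triangle (ratr a, ratr b) _ _))//.
  rewrite discE in Hy; have : ratr q ^+ 2 <= (r / 2) ^+ 2 by apply: le_sqr; lra.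
  rewrite [(r / 2) ^+ 2]expr_div_n; move: Hy Hx rr; clear.
  by move: (sqd _ y) (sqd _ x) (ratr q ^+ 2) (r ^+ 2) => A B C D; lra.
- rewrite discE (le_lt_trans Hx)//.
  have : (r / 4) ^+ 2 <= ratr q ^+ 2 by apply: le_sqr; lra.
  rewrite [(r / 4) ^+ 2]expr_div_n [(ratr q / 2) ^+ 2]expr_div_n; move: rr; clear; move: (ratr q ^+ 2) (r ^+ 2) => C D; lra.
Qed.

Definition qbump O n : plane R -> R :=
  if `[< 0 < (qdisc n).2 /\ disc (qdisc n).1 (qdisc n).2 `<=` O >]
  then bump (qdisc n).1 (qdisc n).2 else 0.

Lemma test_qbump O n : test O (qbump O n).
Proof.
by rewrite /qbump; case: asboolP => [[H1 H2]|_]; [exact: test_bump|exact: test0].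
Qed.

Lemma qbump_bound O n x : 0 <= qbump O n x <= 1.
Proof.
by rewrite /qbump; case: asboolP => _; rewrite ?bump_ge0 ?bump_le1//= lexx ler01.
Qed.

(** Here [1 - exhaust O n] is the product of the [1 - qbump O m] for m < n, so the values stay in
    [0, 1] and remain at 1 once a bump has reached 1. These test functions on [O] tend pointwise to
    the indicator of [O]. *)
Fixpoint exhaust O n : plane R -> R :=
  if n is m.+1 then exhaust O m + (cst 1 - exhaust O m) * qbump O m else 0.

Lemma exhaustS O n x : exhaust O n.+1 x = exhaust O n x + (1 - exhaust O n x) * qbump O n x.
Proof. by []. Qed.

Lemma test_exhaust O n : test O (exhaust O n).
Proof.
elim: n => [|n IH]; first exact: test0.
apply: (testD IH); apply: testMl (test_qbump O n).
exact: (smoothB (smooth_cst 1) (test_smooth IH)).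
Qed.

Lemma exhaust_bound O n x : 0 <= exhaust O n x <= 1.
Proof.
elim: n => [|n]; first by rewrite lexx ler01.
rewrite exhaustS; have := qbump_bound O n x.
move: (exhaust O n x) (qbump O n x) => a b /andP[b0 b1] /andP[a0 a1]; apply/andP; split; nra.
Qed.

Lemma exhaust_ev1 O x : open O -> O x -> exists N, forall n, (N <= n)%N -> exhaust O n x = 1.
Proof.
move=> oO Ox; have [N [r0 H D]] := qdisc_sub oO Ox.
exists N.+1; elim=> // n IH; rewrite leq_eqVlt => /orP[/eqP[<-]|/IH {}IH]; last first.
  by rewrite exhaustS IH subrr mul0r addr0.
rewrite exhaustS /qbump; case: asboolP => [_|]; last by case.
by rewrite bump1// mulr1 addrC subrK.
Qed.

Lemma exhaust_cvg O x : open O -> exhaust O n x @[n --> \oo] --> (\1_O x : R).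
Proof.
move=> oO; apply: cvg_near_cst; rewrite indicE.
have [Ox|nOx] := pselect (O x).
  rewrite mem_set//; have [N HN] := exhaust_ev1 oO Ox.
  by near=> n; apply: HN; near: n; exact: nbhs_infty_ge.
rewrite memNset//; near=> n; apply: supp_out => Hx; apply: nOx.
by have [_ _] := test_exhaust O n; apply.
Unshelve. all: by end_near.
Qed.

Lemma measurable_sqd p : measurable_fun setT (sqd p).
Proof.
apply: measurable_funD; apply: measurable_funX; apply: measurable_funB => //.
Qed.

Lemma measurable_disc p r : measurable (disc p r).
Proof.
rewrite [X in measurable X](_ : _ = setT `&` sqd p @^-1` `]-oo, r ^+ 2[).
  exact: measurable_sqd.
by rewrite setTI; apply/seteqP; split => x; rewrite /= in_itv.
Qed.

Lemma open_measurable_plane O : open O -> measurable O.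
Proof.
move=> oO.
(* Intersecting with the full disc makes the inclusion in [O] immediate whatever the sign of the
   radius. *)
rewrite [X in measurable X](_ : _ = \bigcup_n
  (if `[< disc (qdisc n).1 (qdisc n).2 `<=` O >] then disc (qdisc n).1 ((qdisc n).2 / 2) `&` disc (qdisc n).1 (qdisc n).2 else set0)).
  apply: bigcupT_measurable => n; case: asboolP => // _.
  by apply: measurableI; exact: measurable_disc.
apply/seteqP; split=> [x Ox|x [n _]].
  have [n [r0 H D]] := qdisc_sub oO Ox; exists n => //.
  case: asboolP => // _; split=> //; apply: subset_disc D; lra.
by case: asboolP => // H [_ /H].
Qed.

Lemma continuous_measurable_plane f : continuous f -> measurable_fun setT f.
Proof.
move=> cf mT; apply: (measurability _ (RGenOpens.measurableE R)) => //.
move=> _ [_ [a [b ->] <-]]; rewrite setTI; apply: open_measurable_plane.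
by have /continuousP := cf; apply; exact: interval_open.
Qed.

End Exhaustion.

(** * The pairing with test functions *)

Section Integration.
Context {R : realType}.
Implicit Types (f g u w phi psi : plane R -> R) (x y p : plane R) (r : R) (U V K O : set (plane R)).
Local Notation mu := (@lebesgue2 R).

Lemma L2P u : L2 u <-> measurable_fun setT u /\ mu.-integrable setT (EFin \o (fun x => u x ^+ 2)).
Proof.
split=> [[mu' fu]|[mu' iu]].
  split=> //; apply: Lfun2_integrable_sqr.
  by rewrite inE; apply/andP; split; rewrite inE.
split=> //; rewrite /finite_norm unlock /Lnorm poweR_lty//.
have /integrableP[_] := iu; apply: le_lt_trans.
rewrite le_eqVlt; apply/orP; left; apply/eqP; apply: eq_integral => x _ /=.
by rewrite [X in _ = X%:E]ger0_norm ?sqr_ge0// powR_mulrn// real_normK ?num_real.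
Qed.

Lemma L2_measurable u : L2 u -> measurable_fun setT u. Proof. by case. Qed.

Lemma integrable_bound f g : measurable_fun setT f -> (forall x, `|f x| <= g x) ->
  mu.-integrable setT (EFin \o g) -> mu.-integrable setT (EFin \o f).
Proof.
move=> mf fg ig; apply: (le_integrable _ _ _ ig) => //; first exact/measurable_EFinP.
by move=> x _; rewrite lee_fin (le_trans (fg x))// ler_norm.
Qed.

Lemma L2_dom u w (c : R) : L2 w -> measurable_fun setT u -> (forall x, `|u x| <= c * `|w x|) -> L2 u.
Proof.
move=> /L2P[mw iw] mu' uw; apply/L2P; split=> //.
apply: (@integrable_bound _ (fun x => c ^+ 2 * w x ^+ 2)).
- exact: measurable_funX.
- move=> x; rewrite ger0_norm ?sqr_ge0// -(real_normK (num_real (u x))) -(real_normK (num_real (w x))).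
  by rewrite -exprMn; apply: le_sqr.
- exact: (integrableZl _ (c ^+ 2) iw).
Qed.

Lemma L2D u w : L2 u -> L2 w -> L2 (u + w).
Proof.
move=> /L2P[mu' iu] /L2P[mw iw]; apply/L2P; split; first exact: measurable_funD.
apply: (@integrable_bound _ (fun x => 2 * u x ^+ 2 + 2 * w x ^+ 2)).
- by apply: measurable_funX; exact: measurable_funD.
- move=> x; rewrite ger0_norm ?sqr_ge0// -subr_ge0.
  have -> : (u + w) x = u x + w x by [].
  by rewrite (_ : _ - _ = (u x - w x) ^+ 2) ?sqr_ge0//; ring.
- exact: (integrableD _ (integrableZl _ 2 iu) (integrableZl _ 2 iw)).
Qed.

Lemma L2M u g (c : R) : measurable_fun setT g -> (forall x, `|g x| <= c) -> L2 u -> L2 (g * u).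
Proof.
move=> mg gc L2u; apply: (L2_dom (c := c) L2u).
  by apply: measurable_funM => //; exact: L2_measurable.
by move=> x; rewrite normrM ler_wpM2r.
Qed.

Lemma L2Z u (c : R) : L2 u -> L2 (c *: u).
Proof.
move=> H; rewrite cstM_funE; apply: (@L2M _ _ `|c|) H; last by [].
exact: measurable_cst.
Qed.

Lemma L20 : L2 (0 : plane R -> R).
Proof.
apply/L2P; split; first exact: measurable_cst.
rewrite (_ : _ \o _ = cst 0%E); first exact: integrable0.
by apply/funext => x /=; rewrite expr0n.
Qed.

(** A class larger than the test functions: it also contains their products with indicators of open
    sets, which arise as pointwise limits. The constants are explicit because dominated convergence
    needs them uniform along a sequence. *)
Definition bmc (M r : R) phi :=
  [/\ measurable_fun setT phi, forall x, `|phi x| <= M & forall x, ~ disc 0 r x -> phi x = 0].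

Lemma disc_finite r : (mu (disc 0%R r) < +oo)%E.
Proof.
pose B := `[- `|r|, `|r|]%classic : set R.
apply: (@le_lt_trans _ _ (mu (B `*` B))).
  apply: le_measure; rewrite ?inE; [exact: measurable_disc|by apply: measurableX; exact: measurable_itv|].
  move=> x; rewrite discE /sqd/= !subr0 => H.
  have S (a : R) : a ^+ 2 <= r ^+ 2 -> B a.
    move=> ar; rewrite /B/= in_itv/= -ler_norml -(ler_pXn2r (n := 2)) ?nnegrE//.
    by rewrite !real_normK ?num_real.
  by split; apply: S; rewrite (le_trans _ (ltW H))// ?lerDl ?lerDr sqr_ge0.
have mB : measurable B by exact: measurable_itv.
have -> : mu (B `*` B) = (lebesgue_measure B * lebesgue_measure B)%E.
  exact: product_measure1E.
rewrite lte_mul_pinfty//.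
- by rewrite ge0_fin_numE// lebesgue_measure_itv/=; case: ifP => //; rewrite ltry.
- by rewrite lebesgue_measure_itv/=; case: ifP => //; rewrite ltry.
Qed.

Lemma integrable_disc r (c : R) : mu.-integrable setT (EFin \o (fun x => c * \1_(disc 0 r) x)).
Proof.
suff H : mu.-integrable setT (EFin \o (\1_(disc 0 r) : plane R -> R)).
  exact: (integrableZl measurableT c H).
apply/integrableP; split; first by apply/measurable_EFinP; exact: measurable_indic (measurable_disc _ _).
rewrite (_ : \int[mu]_x _ = mu (disc 0%R r))%E ?disc_finite//.
have := @integral_indic _ _ _ mu setT measurableT (disc 0 r) (measurable_disc _ _).
rewrite setIT => E; apply: etrans E; apply: eq_integral => x _ /=; rewrite ger0_norm; [by []|by rewrite indicE ler0n].
Qed.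

Lemma mulr_dom (a b M : R) : `|b| <= M -> `|a * b| <= a ^+ 2 + M ^+ 2.
Proof.
move=> bM; rewrite normrM -(real_normK (num_real a)).
have : b ^+ 2 <= M ^+ 2 by rewrite -(real_normK (num_real b)); exact: le_sqr.
rewrite -(real_normK (num_real b)); have := normr_ge0 a; have := normr_ge0 b.
by move: (`|a|) (`|b|) (M ^+ 2) => A B C; have := sqr_ge0 (A - B); nra.
Qed.

(** Takes the place of Cauchy-Schwarz. The bound depends on [phi] only through [M] and [r], as
    dominated convergence requires. *)
Lemma bmc_dom u M r phi : bmc M r phi -> forall x, `|u x * phi x| <= u x ^+ 2 + M ^+ 2 * \1_(disc 0 r) x.
Proof.
move=> [_ bM b0] x; rewrite indicE.
have [H|H] := pselect (disc 0 r x); first by rewrite mem_set// mulr1; exact: mulr_dom.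
by rewrite memNset// b0// mulr0 normr0 mulr0 addr0 sqr_ge0.
Qed.

Lemma bmc_dom_integrable u M r : L2 u ->
  mu.-integrable setT (EFin \o (fun x => u x ^+ 2 + M ^+ 2 * \1_(disc 0 r) x)).
Proof.
move=> /L2P[_ iu]; exact: (integrableD _ iu (integrable_disc r (M ^+ 2))).
Qed.

Lemma integrable_pair u M r phi : L2 u -> bmc M r phi -> mu.-integrable setT (EFin \o (fun x => u x * phi x)).
Proof.
move=> L2u bp; apply: (integrable_bound _ (bmc_dom u bp)); last exact: bmc_dom_integrable.
by apply: measurable_funM; [exact: L2_measurable|case: bp].
Qed.

Definition pr u phi : R := Rintegral mu setT (fun x => u x * phi x).

Lemma eq_pr u w phi psi : (forall x, u x * phi x = w x * psi x) -> pr u phi = pr w psi.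
Proof. by move=> H; apply: eq_Rintegral => x _; exact: H. Qed.

Lemma prDr u phi psi M r M' r' : L2 u -> bmc M r phi -> bmc M' r' psi -> pr u (phi + psi) = pr u phi + pr u psi.
Proof.
move=> L2u b1 b2; rewrite /pr -RintegralD//; [|exact: integrable_pair b1|exact: integrable_pair b2].
by apply: eq_Rintegral => x _; rewrite -mulrDr.
Qed.

Lemma prDl u w phi M r : L2 u -> L2 w -> bmc M r phi -> pr (u + w) phi = pr u phi + pr w phi.
Proof.
move=> L2u L2w b1; rewrite /pr -RintegralD//; [|exact: integrable_pair b1|exact: integrable_pair b1].
by apply: eq_Rintegral => x _; rewrite -mulrDl.
Qed.

Lemma prZr u phi M r (c : R) : L2 u -> bmc M r phi -> pr u (c *: phi) = c * pr u phi.
Proof.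
move=> L2u b1; rewrite /pr -RintegralZl//; last exact: integrable_pair b1.
by apply: eq_Rintegral => x _; rewrite mulrCA.
Qed.

Lemma prZl u phi M r (c : R) : L2 u -> bmc M r phi -> pr (c *: u) phi = c * pr u phi.
Proof.
move=> L2u b1; rewrite -(prZr c L2u b1); apply: eq_pr => x.
have -> : (c *: u) x = c * u x by []; have -> : (c *: phi) x = c * phi x by []; ring.
Qed.

Lemma pr_dct u M r (phi_ : nat -> plane R -> R) phi : L2 u -> (forall n, bmc M r (phi_ n)) ->
  (forall x, phi_ n x @[n --> \oo] --> phi x) -> measurable_fun setT phi ->
  pr u (phi_ n) @[n --> \oo] --> pr u phi.
Proof.
move=> L2u bp cvp mp.
have mu' := L2_measurable L2u.
have C x : (u x * phi_ n x)%:E @[n --> \oo] --> (u x * phi x)%:E.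
  by apply: cvg_EFin; [exact: nearW|apply: cvgM; [exact: cvg_cst|exact: cvp]].
have := @dominated_convergence _ _ _ mu setT measurableT
  (fun n => EFin \o (fun x => u x * phi_ n x)) (EFin \o (fun x => u x * phi x))
  (EFin \o (fun x => u x ^+ 2 + M ^+ 2 * \1_(disc 0 r) x))
  (fun n => (measurable_int _ (integrable_pair L2u (bp n)))) (proj2 (measurable_EFinP _ _) (measurable_funM mu' mp)).
case.
- by apply: aeW => x _; exact: C.
- exact: bmc_dom_integrable.
- by apply: aeW => x n _; rewrite /= lee_fin; exact: bmc_dom.
move=> i1 _ H.
apply: fine_cvg; rewrite fineK; last exact: (integrable_fin_num _ i1).
exact: H.
Qed.

End Integration.

(** * Affine changes of variables in integrals *)

Section ChangeOfVariables.
Context {R : realType}.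
Implicit Types (f g u w phi psi : plane R -> R) (x y p : plane R) (r : R) (U V K O : set (plane R)).
Local Notation mu := (@lebesgue2 R).
Local Notation T := (measurableTypeR R * measurableTypeR R)%type.

Lemma test_bmc U phi : test U phi -> exists M r, bmc M r phi.
Proof.
move=> [sp cp up].
have cphi := smooth_continuous sp.
have /compact_bounded [M [_ HM]] : compact (phi @` supp phi).
  by apply: continuous_compact => //; exact: continuous_subspaceT.
have /compact_bounded [r [_ Hr]] := cp.
have M0 : M < `|M| + 1 by rewrite (le_lt_trans (ler_norm _))// ltrDl.
have r0 : r < `|r| + 1 by rewrite (le_lt_trans (ler_norm _))// ltrDl.
(* The norm of the plane is the larger coordinate; the factor 2 passes to a Euclidean disc. *)
exists (`|M| + 1), (2 * (`|r| + 1)); split.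
- exact: continuous_measurable_plane.
- move=> x; have [Kx|nKx] := pselect (supp phi x).
    by apply: (HM _ M0); exists x.
  by rewrite supp_out// normr0 addr_ge0.
- move=> x nx; apply: supp_out => Kx; apply: nx.
  have := Hr _ r0 x Kx; rewrite /= [in X in X -> _]/Num.norm/= ge_max => /andP[H1 H2].
  rewrite discE /sqd !subr0 exprMn.
  have rr : 0 < (`|r| + 1) ^+ 2 by rewrite exprn_gt0// ltr_wpDl.
  have := le_sqr (normr_ge0 _) H1; have := le_sqr (normr_ge0 _) H2.
  rewrite !real_normK ?num_real//; move: rr; clear.
  by move: (x.1 ^+ 2) (x.2 ^+ 2) ((`|r| + 1) ^+ 2) => a b c; rewrite expr2; lra.
Qed.

Lemma prD_test U V u phi psi : L2 u -> test U phi -> test V psi ->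
  pr u (phi + psi) = pr u phi + pr u psi.
Proof. by move=> L /test_bmc[? [? b1]] /test_bmc[? [? b2]]; exact: prDr L b1 b2. Qed.

Lemma prDl_test U u w phi : L2 u -> L2 w -> test U phi -> pr (u + w) phi = pr u phi + pr w phi.
Proof. by move=> L L' /test_bmc[? [? b1]]; exact: prDl L L' b1. Qed.

Lemma prZ_test U u phi (c : R) : L2 u -> test U phi -> pr u (c *: phi) = c * pr u phi.
Proof. by move=> L /test_bmc[? [? b1]]; exact: prZr L b1. Qed.

Lemma prZl_test U u phi (c : R) : L2 u -> test U phi -> pr (c *: u) phi = c * pr u phi.
Proof. by move=> L /test_bmc[? [? b1]]; exact: prZl L b1. Qed.

Lemma prBl_test U u w phi : L2 u -> L2 w -> test U phi -> pr (u - w) phi = pr u phi - pr w phi.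
Proof.
move=> Lu Lw tp; rewrite -scaleN1r (prDl_test Lu (L2Z _ Lw) tp) (prZl_test _ Lw tp).
by rewrite mulN1r.
Qed.

Lemma pr0 u : pr u 0 = 0.
Proof.
rewrite /pr /Rintegral integral0_eq// => x _.
by have -> : (0 : plane R -> R) x = 0 by []; rewrite mulr0.
Qed.

Lemma pr0l phi : pr 0 phi = 0.
Proof. by rewrite -(pr0 phi); apply: eq_pr => x; rewrite mul0r mulr0. Qed.

(** The Jacobian read on measures of preimages, so that [c] is the inverse of the absolute
    determinant of an affine [A]. This form composes, which reduces affine maps to shears and the
    swap of coordinates. *)
Definition scales (c : R) (A : plane R -> plane R) :=
  [/\ 0 < c, measurable_fun setT A & forall B, measurable B -> mu (A @^-1` B) = (c%:E * mu B)%E].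

Lemma scales_comp c c' A B : scales c A -> scales c' B -> scales (c' * c) (A \o B).
Proof.
move=> [c0 mA HA] [c'0 mB HB]; split; first exact: mulr_gt0.
  exact: measurableT_comp.
move=> C mC; rewrite comp_preimage HB ?HA ?muleA//.
by rewrite -[X in measurable X]setTI; exact: mA.
Qed.

(** Uniqueness of Lebesgue measure: the pushforward scaled by |a| has the right value on half-open
    intervals. For negative [a] the preimage is closed on the other side, which does not change its
    length. *)
Lemma lebesgue_affine (a b : R) (B : set R) : a != 0 -> measurable B ->
  lebesgue_measure ((fun s : R => a * s + b) @^-1` B) = ((`|a|^-1)%:E * lebesgue_measure B)%E.
Proof.
move=> a0 mB.
pose f := (fun s : R => a * s + b) : measurableTypeR R -> measurableTypeR R.
have mf : measurable_fun setT f.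
  by apply: measurable_funD => //; apply: measurable_funM.
pose nn := NngNum (normr_ge0 a).
have E : lebesgue_measure B = mscale nn (pushforward lebesgue_measure f) B.
  move=> m; apply: lebesgue_measure_unique => // _ [[c d]] _ <-.
  rewrite [RHS](_ : _ = (`|a|%:E * lebesgue_measure (f @^-1` `]c, d]))%E)//.
  have [a1|a1|a1] := ltgtP a 0; last by rewrite a1 eqxx in a0.
  - rewrite (_ : f @^-1` _ = `[(d - b) / a, (c - b) / a[%classic); last first.
      apply/seteqP; split => s; rewrite /= !in_itv/= /f => /andP[H1 H2]; apply/andP; split.
      + by rewrite ler_ndivrMr//; lra.
      + by rewrite ltr_ndivlMr//; lra.
      + by move: H2; rewrite ltr_ndivlMr//; lra.
      + by move: H1; rewrite ler_ndivrMr//; lra.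
    rewrite !lebesgue_measure_itv/= !lte_fin ltr_nM2r ?invr_lt0// ltrBDr subrK.
    case: ifP => // _; rewrite ?mule0//.
    by rewrite -!EFinB -EFinM ltr0_norm//; congr (_%:E); field.
  - rewrite (_ : f @^-1` _ = `](c - b) / a, (d - b) / a]%classic); last first.
      apply/seteqP; split => s; rewrite /= !in_itv/= /f => /andP[H1 H2]; apply/andP; split.
      + by rewrite ltr_pdivrMr//; lra.
      + by rewrite ler_pdivlMr//; lra.
      + by move: H1; rewrite ltr_pdivrMr//; lra.
      + by move: H2; rewrite ler_pdivlMr//; lra.
    rewrite !lebesgue_measure_itv/= !lte_fin ltr_pM2r ?invr_gt0// ltrBDr subrK.
    case: ifP => // _; rewrite ?mule0//.
    by rewrite -!EFinB -EFinM gtr0_norm//; congr (_%:E); field.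
rewrite (E mf) [X in (_ * X)%E](_ : _ = (`|a|%:E * lebesgue_measure (f @^-1` B))%E)// muleA -EFinM mulVf ?mul1e//.
by rewrite normr_eq0.
Qed.

Definition affmap (a b c a' b' c' : R) : plane R -> plane R :=
  fun x => (a * x.1 + b * x.2 + c, a' * x.1 + b' * x.2 + c').

Lemma continuous_affmap a b c a' b' c' : continuous (affmap a b c a' b' c').
Proof.
move=> x; exact: (cvg_pair (@continuous_affine R a b c x) (@continuous_affine R a' b' c' x)).
Qed.

Lemma measurable_affmap a b c a' b' c' : measurable_fun setT (affmap a b c a' b' c').
Proof.
by apply/measurable_fun_pairP; split; apply: continuous_measurable_plane; exact: continuous_affine.
Qed.

(** Each vertical section of a preimage is the preimage of a section under an affine map of the line
    with slope [a]; integrate over the first coordinate. *)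
Lemma scales_shear (a m b : R) : a != 0 -> scales `|a|^-1 (affmap 1 0 0 m a b).
Proof.
move=> a0; split; first by rewrite invr_gt0 normr_gt0.
  exact: measurable_affmap.
move=> B mB; rewrite /lebesgue2 /product_measure1.
rewrite -ge0_integralZl//; last first.
  exact: measurable_fun_xsection.
apply: eq_integral => x _ /=.
have mx : measurable (xsection B x) by exact: measurable_xsection.
rewrite -(lebesgue_affine (m * x + b) a0 mx); congr (lebesgue_measure _).
apply/seteqP; split=> y; rewrite /xsection/= !inE/= /affmap/= mul1r mul0r !addr0;
  by rewrite [m * x + a * y]addrC -addrA.
Qed.

Lemma scales_swap : scales 1 (affmap 0 1 0 1 0 0).
Proof.
have ms : measurable_fun setT (affmap 0 1 0 1 0 0) := @measurable_affmap _ _ _ _ _ _.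
split=> // B mB; rewrite mul1e; symmetry.
have ms' : measurable_fun [set: T] (affmap 0 1 0 1 0 0 : T -> T) by exact: ms.
pose nu := measure_function_pushforward__canonical__measure_function_Measure mu ms'.
have E : (lebesgue_measure \x lebesgue_measure)%E B = nu B.
  apply: (product_measure_unique (m' := nu)) => // C D mC mD.
  rewrite [LHS](_ : _ = mu (D `*` C)).
    by rewrite /lebesgue2 product_measure1E// muleC.
  rewrite /= /pushforward; congr (mu _).
  by apply/seteqP; split => x; rewrite /= /affmap/= !mul0r !mul1r !addr0 add0r => -[].
exact: E.
Qed.

(** If [b] is nonzero the map is a shear, then the swap, then a shear. If [b = 0], a shear
    conjugated by the swap first rescales the first coordinate. *)
Lemma scales_aff (a b c a' b' c' : R) : a * b' - a' * b != 0 ->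
  exists k, scales k (affmap a b c a' b' c').
Proof.
move=> D; have [b0|b0] := eqVneq b 0.
  have a0 : a != 0 by apply: contraNneq D => ->; rewrite b0 mul0r mulr0 subrr.
  have b'0 : b' != 0 by apply: contraNneq D => ->; rewrite b0 !mulr0 subrr.
  have := scales_comp (scales_shear (a' / a) (c' - a' * c / a) b'0) (scales_comp scales_swap
    (scales_comp (scales_shear 0 c a0) scales_swap)).
  set k := (X in scales X _); move=> H; exists k; move: H.
  rewrite (_ : _ \o _ = affmap a b c a' b' c')//.
  apply/funext => x; rewrite /affmap/= b0; apply/pair_equal_spec; split; first ring.
  by field.
have D' : - (a * b' - a' * b) / b != 0 by rewrite mulf_neq0 ?invr_eq0 ?oppr_eq0.
have := scales_comp (scales_shear (b' / b) (c' - b' * c / b) D')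
  (scales_comp scales_swap (scales_shear a c b0)).
set k := (X in scales X _); move=> H; exists k; move: H.
rewrite (_ : _ \o _ = affmap a b c a' b' c')//.
apply/funext => x; rewrite /affmap/=; apply/pair_equal_spec; split; first ring.
by field.
Qed.

Lemma scales_integrable c A f : scales c A -> measurable_fun setT f ->
  mu.-integrable setT (EFin \o f) -> mu.-integrable setT (EFin \o (f \o A)).
Proof.
move=> [c0 mA HA] mf /integrableP[_ If]; apply/integrableP; split.
  by apply/measurable_EFinP; exact: measurableT_comp.
pose nn := NngNum (ltW c0).
have mA' : measurable_fun [set: T] (A : T -> T) by exact: mA.
pose nu := measure_function_pushforward__canonical__measure_function_Measure mu mA'.
pose F (x : T) := `|(f x)%:E|%E.
have mF : measurable_fun [set: T] F.
  by apply: measurableT_comp => //; exact/measurable_EFinP.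
have E : (\int[nu]_x F x = \int[mu]_x `|(f (A x))%:E|)%E.
  by rewrite (ge0_integral_pushforward mA' mu measurableT mF (fun x _ => abse_ge0 _)) preimage_setT.
have E2 : (\int[nu]_x F x = \int[mscale nn mu]_x F x)%E.
  by apply: eq_measure_integral => B mB _; exact: HA.
have H := @ge0_integral_mscale _ T R mu setT measurableT nn F mF (fun x _ => abse_ge0 _).
by rewrite -[X in (X < _)%E]E E2 H lte_mul_pinfty.
Qed.

Lemma scales_integral c A f : scales c A -> measurable_fun setT f ->
  mu.-integrable setT (EFin \o f) -> Rintegral mu setT (f \o A) = c * Rintegral mu setT f.
Proof.
move=> sA mf If; have If' := scales_integrable sA mf If; case: sA => [c0 mA HA].
pose nn := NngNum (ltW c0).
have mA' : measurable_fun [set: T] (A : T -> T) by exact: mA.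
pose nu := measure_function_pushforward__canonical__measure_function_Measure mu mA'.
pose F (x : T) := (f x)%:E.
have mF : measurable_fun [set: T] F by exact/measurable_EFinP.
have E : (\int[nu]_x F x = \int[mu]_x (f (A x))%:E)%E.
  by rewrite (integral_pushforward mA' mF If' measurableT) preimage_setT.
have E2 : (\int[nu]_x F x = \int[mscale nn mu]_x F x)%E.
  by apply: eq_measure_integral => B mB _; exact: HA.
(* Scaling of the measure is treated on positive and negative parts; finiteness of the negative one
   allows the factor to be distributed over the difference. *)
have Hp : (\int[mscale nn mu]_x F^\+ x = c%:E * \int[mu]_x F^\+ x)%E :=
  @ge0_integral_mscale _ T R mu setT measurableT nn F^\+%E
  (measurable_funepos mF) (fun x _ => funepos_ge0 _ _).
have Hn : (\int[mscale nn mu]_x F^\- x = c%:E * \int[mu]_x F^\- x)%E :=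
  @ge0_integral_mscale _ T R mu setT measurableT nn F^\-%E
  (measurable_funeneg mF) (fun x _ => funeneg_ge0 _ _).
have fn : (\int[mu]_x F^\- x)%E \is a fin_num.
  exact: (integrable_fin_num measurableT (integrable_funeneg measurableT If)).
have E3 : (\int[mscale nn mu]_x F x = c%:E * \int[mu]_x F x)%E.
  rewrite (integralE (mscale nn mu) setT F) (integralE mu setT F) Hp Hn.
  move: fn; move: (integral mu _ F^\+%E) (integral mu _ F^\-%E) => a b fb.
  have cf : c%:E \is a fin_num by [].
  have ab : (a +? - b)%E by apply: fin_num_adde_defl; rewrite fin_numN.
  by rewrite (muleBr cf ab).
have fF := integrable_fin_num measurableT If.
rewrite /Rintegral -E E2 E3; move: fF; rewrite -/F; move: (integral _ _ F) => a fa.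
by rewrite fineM.
Qed.

End ChangeOfVariables.

(** * Test functions and L^2 functions under affine maps *)

Section Pullback.
Context {R : realType}.
Implicit Types (f g u w phi psi : plane R -> R) (x y p : plane R) (r : R) (U V K O P : set (plane R)).
Local Notation mu := (@lebesgue2 R).

Section Aff.
Variables a b c a' b' c' : R.
Let A := affmap a b c a' b' c'.

Lemma affmap_line x v (t : R) :
  A (t *: v + x) = t *: ((a * v.1 + b * v.2, a' * v.1 + b' * v.2) : plane R) + A x.
Proof.
by apply/pair_equal_spec; rewrite /A /affmap/= /GRing.scale/=; split; ring.
Qed.

Lemma is_derive_aff f x v : smooth f -> is_derive x v (f \o A)
  ((a * v.1 + b * v.2) * pderive true f (A x) + (a' * v.1 + b' * v.2) * pderive false f (A x)).
Proof.
move=> sf; set v' : plane R := (a * v.1 + b * v.2, a' * v.1 + b' * v.2).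
have E : x = (0 : R) *: v + x by rewrite scale0r add0r.
have E' : A x = (0 : R) *: v' + A x by rewrite scale0r add0r.
rewrite {1}E; apply/is_derive_line.
rewrite (_ : (fun s => _) = (fun s : R => f (s *: v' + A x))); last first.
  by apply/funext => s; rewrite /= affmap_line.
apply/is_derive_line; rewrite -E'; apply: is_derive_C1.
- exact: smooth_gradable.
- exact: smooth_continuous (smooth_pderive _ sf).
- exact: smooth_continuous (smooth_pderive _ sf).
Qed.

Definition affco (e : bool) : R * R := if e then (a, a') else (b, b').

Lemma pderive_aff e f : smooth f -> pderive e (f \o A) =
  (affco e).1 *: (pderive true f \o A) + (affco e).2 *: (pderive false f \o A).
Proof.
move=> sf; apply/funext => x; case: (is_derive_aff x (dir e) sf) => _.
rewrite /pderive -/(dir e) => ->.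
by rewrite /affco; case: e; rewrite /= !mulr0 !mulr1 ?addr0 ?add0r.
Qed.

Lemma smooth_aff f : smooth f -> smooth (f \o A).
Proof.
move=> sf; apply/smoothP => n; elim: n f sf => [|n IH] f sf; split=> //.
- by move=> x; apply: continuous_comp; [exact: continuous_affmap|exact: smooth_continuous].
- by move=> x; apply: continuous_comp; [exact: continuous_affmap|exact: smooth_continuous].
- split; first by move=> x e; case: (is_derive_aff x (dir e) sf).
  move=> e; rewrite pderive_aff// !cstM_funE; apply: CnD; apply: CnM; try exact: Cn_cst.
  + exact: IH (smooth_pderive _ sf).
  + exact: IH (smooth_pderive _ sf).
Qed.

End Aff.

Lemma affmap_inv (a b c a' b' c' : R) : a * b' - a' * b != 0 ->
  exists i j k i' j' k' : R, let B := affmap i j k i' j' k' in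
    cancel (affmap a b c a' b' c') B /\ cancel B (affmap a b c a' b' c').
Proof.
move=> D; set d := a * b' - a' * b in D.
exists (b' / d), (- b / d), ((b * c' - b' * c) / d), (- a' / d), (a / d), ((a' * c - a * c') / d).
by split => -[x1 x2]; rewrite /affmap/=; apply/pair_equal_spec; split; rewrite /d; field.
Qed.

Lemma supp_comp f (A B : plane R -> plane R) : continuous A -> supp (f \o A) `<=` A @^-1` supp f.
Proof.
move=> cA; apply: supp_sub; first by move/continuous_closedP : cA; apply; exact: closed_supp.
by move=> x /= n0; apply: subset_closure.
Qed.

Lemma test_comp P f (A B : plane R -> plane R) : continuous A -> continuous B -> cancel A B ->
  (smooth f -> smooth (f \o A)) -> test P f -> test (A @^-1` P) (f \o A).
Proof.
move=> cA cB AB sA [sf cf uf]; have H := @supp_comp f A B cA.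
split; first exact: sA.
- apply: (compact_sub_closed (K := B @` supp f)); last 1 first.
  + by move=> x /H Hx; exists (A x) => //; rewrite AB.
  + by apply: continuous_compact => //; exact: continuous_subspaceT.
  + exact: closed_supp.
- by move=> x /H /uf.
Qed.

Lemma L2_scales c A u : scales c A -> L2 u -> L2 (u \o A).
Proof.
move=> sA /L2P[mu' iu]; apply/L2P; split.
  by apply: measurableT_comp => //; case: sA.
by apply: (scales_integrable sA) iu; exact: measurable_funX.
Qed.

Lemma pr_scales c A u phi M r : scales c A -> L2 u -> bmc M r phi ->
  pr (u \o A) (phi \o A) = c * pr u phi.
Proof.
move=> sA Lu bp; apply: (scales_integral sA (f := fun x => u x * phi x)).
  by apply: measurable_funM; [exact: L2_measurable|case: bp].
exact: integrable_pair Lu bp.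
Qed.

End Pullback.

(** * Weak derivatives *)

Section WeakDerivatives.
Context {R : realType}.
Implicit Types (f g u w phi psi chi : plane R -> R) (x y p : plane R) (r : R) (U V K O P S : set (plane R)).
Local Notation mu := (@lebesgue2 R).

Definition weak P (e : bool) u u' := forall phi, test P phi -> pr u (pderive e phi) = - pr u' phi.

(** Function and derivatives are L^2 on the whole plane, but they are related only through test
    functions on [P]: this is the intrinsic Sobolev space of [P], insensitive to values off [P]. For
    [P = setT] it is the space of the plane; for other sets, passing to [setT] is an extension
    problem. *)
Fixpoint Wk k P u : Prop := L2 u /\
  if k is m.+1 then exists d : bool -> plane R -> R, forall e, weak P e u (d e) /\ Wk m P (d e)
  else True.

Lemma Wk_L2 k P u : Wk k P u -> L2 u. Proof. by case: k => [|k] []. Qed.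

Lemma Wk_sub k P Q u : Q `<=` P -> Wk k P u -> Wk k Q u.
Proof.
move=> QP; elim: k u => [//|k IH] u [Lu [d dP]]; split => //; exists d => e.
have [H1 H2] := dP e; split; last exact: IH.
by move=> phi tp; apply: H1; exact: test_sub tp.
Qed.

Lemma WkW k P u : Wk k.+1 P u -> Wk k P u.
Proof.
elim: k u => [|k IH] u; first by case.
move=> [Lu [d dP]]; split=> //; exists d => e.
by have [H1 /IH H2] := dP e.
Qed.

Lemma weakD P e u u' w w' : L2 u -> L2 u' -> L2 w -> L2 w' -> weak P e u u' -> weak P e w w' ->
  weak P e (u + w) (u' + w').
Proof.
move=> Lu Lu' Lw Lw' H1 H2 phi tp; have tp' := test_pderive e tp.
by rewrite (prDl_test Lu Lw tp') (prDl_test Lu' Lw' tp) (H1 _ tp) (H2 _ tp) opprD.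
Qed.

Lemma weakZ P e u u' (c : R) : L2 u -> L2 u' -> weak P e u u' -> weak P e (c *: u) (c *: u').
Proof.
move=> Lu Lu' H1 phi tp; have tp' := test_pderive e tp.
by rewrite (prZl_test c Lu tp') (prZl_test c Lu' tp) (H1 _ tp) mulrN.
Qed.

Lemma WkD k P u w : Wk k P u -> Wk k P w -> Wk k P (u + w).
Proof.
elim: k u w => [|k IH] u w [Lu Hu] [Lw Hw]; split=> //; try exact: L2D.
move: Hu Hw => [d dP] [d' dP']; exists (fun e => d e + d' e) => e.
have [H1 H2] := dP e; have [H1' H2'] := dP' e; split; last exact: IH.
by apply: weakD => //; [exact: Wk_L2 H2|exact: Wk_L2 H2'].
Qed.

Lemma WkZ k P u (c : R) : Wk k P u -> Wk k P (c *: u).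
Proof.
elim: k u => [|k IH] u [Lu Hu]; split=> //; try exact: L2Z.
move: Hu => [d dP]; exists (fun e => c *: d e) => e.
have [H1 H2] := dP e; split; last exact: IH.
by apply: weakZ => //; exact: Wk_L2 H2.
Qed.

Lemma WkB k P u w : Wk k P u -> Wk k P w -> Wk k P (u - w).
Proof. by move=> Wu Ww; rewrite -scaleN1r; exact: (WkD Wu (WkZ (-1) Ww)). Qed.

Lemma Wk0 k P : Wk k P 0.
Proof.
elim: k => [|k IH]; split=> //; try exact: L20.
by exists (fun=> 0) => e; split=> // phi _; rewrite !pr0l oppr0.
Qed.

Lemma test_bound U chi : test U chi -> exists M, measurable_fun setT chi /\ forall x, `|chi x| <= M.
Proof. by move=> /test_bmc[M [r [? ? _]]]; exists M. Qed.

Lemma L2_test U chi u : test U chi -> L2 u -> L2 (chi * u).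
Proof. by move=> /test_bound[M [mc cM]]; exact: L2M. Qed.

Lemma pr_mulC chi u phi : pr (chi * u) phi = pr u (chi * phi).
Proof.
apply: eq_pr => x; have -> : (chi * u) x = chi x * u x by [].
have -> : (chi * phi) x = chi x * phi x by []; ring.
Qed.

(** Leibniz rule, obtained by testing the identity for [u] against [chi * phi]. *)
Lemma weakM P U e chi u u' : L2 u -> L2 u' -> test U chi -> weak P e u u' ->
  weak P e (chi * u) (pderive e chi * u + chi * u').
Proof.
move=> Lu Lu' tc H phi tp.
have sc := test_smooth tc; have sp := test_smooth tp.
have tc' := test_pderive e tc.
have t1 : test P (pderive e chi * phi) := testMl (smooth_pderive e sc) tp.
have t2 : test P (chi * phi) := testMl sc tp.
have t3 : test P (chi * pderive e phi) := testMl sc (test_pderive e tp).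
rewrite (prDl_test (L2_test tc' Lu) (L2_test tc Lu') tp) !pr_mulC.
have E : pderive e (chi * phi) = chi * pderive e phi + phi * pderive e chi.
  exact: pderiveM (smooth_gradable sc) (smooth_gradable sp).
have := H _ t2; rewrite E (mulrC phi) (prD_test Lu t3 t1).
by move=> E2; rewrite opprD addrC -E2 addrK.
Qed.

Lemma WkM k P U chi u : test U chi -> Wk k P u -> Wk k P (chi * u).
Proof.
elim: k chi u => [|k IH] chi u tc Wu; have Lu := Wk_L2 Wu; split; try exact: L2_test tc Lu; first by [].
have [_ [d dP]] := Wu; exists (fun e => pderive e chi * u + chi * d e) => e.
have [H1 H2] := dP e; split.
  exact: weakM Lu (Wk_L2 H2) tc H1.
by apply: WkD; apply: IH => //; [exact: test_pderive tc|exact: WkW].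
Qed.

(** A test function on the preimage is carried to [P] by the inverse map, tested there, and carried
    back. The factor [K] multiplies both sides, so it never has to be computed. *)
Lemma Wk_aff k P u (a b c a' b' c' : R) : a * b' - a' * b != 0 -> Wk k P u ->
  Wk k (affmap a b c a' b' c' @^-1` P) (u \o affmap a b c a' b' c').
Proof.
move=> D; have [i [j [l [i' [j' [l' [AB BA]]]]]]] := affmap_inv c c' D.
have [K sA] := scales_aff c c' D.
set A := affmap a b c a' b' c' in AB BA sA *; set B := affmap i j l i' j' l' in AB BA.
have cA : continuous A := @continuous_affmap _ _ _ _ _ _ _.
have cB : continuous B := @continuous_affmap _ _ _ _ _ _ _.
elim: k u => [|k IH] u Wu; have Lu := Wk_L2 Wu; split; try exact: (L2_scales sA Lu); first by [].
have [_ [d dP]] := Wu.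
pose cf e := affco a b a' b' e.
exists (fun e => (cf e).1 *: (d true \o A) + (cf e).2 *: (d false \o A)) => e.
have [Ht /IH Wt] := dP true; have [Hf /IH Wf] := dP false.
have Lt : L2 (d true) by have [_ /Wk_L2] := dP true.
have Lf : L2 (d false) by have [_ /Wk_L2] := dP false.
split; last by apply: WkD; exact: WkZ.
move=> phi tp; pose psi := phi \o B.
have tpsi : test P psi.
  have := test_comp cB cA BA (@smooth_aff _ _ _ _ _ _ _ phi) tp.
  by apply: test_sub => x /=; rewrite BA.
have spsi := test_smooth tpsi.
have E : phi = psi \o A by apply/funext => x; rewrite /psi/= AB.
have tt := test_pderive true tpsi; have tf := test_pderive false tpsi.
have [Mt [rt bt]] := test_bmc tt; have [Mf [rf bf]] := test_bmc tf.
have [M [r bp]] := test_bmc tpsi.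
have tcomp U f : test U f -> test (A @^-1` U) (f \o A).
  by apply: test_comp cA cB AB _; exact: smooth_aff.
rewrite {1}E (pderive_aff _ _ _ _ _ _ e spsi) -/A -/(cf e).
rewrite (prD_test (L2_scales sA Lu) (testZ _ (tcomp _ _ tt)) (testZ _ (tcomp _ _ tf))).
rewrite (prZ_test _ (L2_scales sA Lu) (tcomp _ _ tt)) (prZ_test _ (L2_scales sA Lu) (tcomp _ _ tf)).
rewrite (pr_scales sA Lu bt) (pr_scales sA Lu bf) (Ht _ tpsi) (Hf _ tpsi).
have tp' := tcomp _ _ tpsi; rewrite -E in tp'.
rewrite (prDl_test (L2Z _ (L2_scales sA Lt)) (L2Z _ (L2_scales sA Lf)) tp').
rewrite (prZl_test _ (L2_scales sA Lt) tp') (prZl_test _ (L2_scales sA Lf) tp').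
rewrite [in RHS]E (pr_scales sA Lt bp) (pr_scales sA Lf bp).
by move: (pr _ _) (pr _ _) (cf e).1 (cf e).2 => s1 s2 c1 c2; ring.
Qed.

(** Vanishing is meant against test functions. It then passes to weak derivatives, because
    differentiation keeps supports inside [S]. *)
Definition van S u := forall phi, test S phi -> pr u phi = 0.

Lemma van_sub S S' u : S' `<=` S -> van S u -> van S' u.
Proof. by move=> H Hu phi tp; apply: Hu; exact: test_sub tp. Qed.

Lemma van_weak S P e u u' : S `<=` P -> weak P e u u' -> van S u -> van S u'.
Proof.
move=> SP H Hu phi tp; apply/eqP; rewrite -oppr_eq0 -(H _ (test_sub SP tp)); apply/eqP.
by apply: Hu; exact: test_pderive.
Qed.

Lemma measurable_indic_open O : open O -> measurable_fun setT (\1_O : plane R -> R).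
Proof. by move=> oO; apply: measurable_indic; exact: open_measurable_plane. Qed.

Lemma indic_bound O x : `|\1_O x : R| <= 1.
Proof. by rewrite indicE; case: (_ \in _); rewrite ?normr1 ?normr0. Qed.

Lemma L2_indic O u : open O -> L2 u -> L2 (\1_O * u).
Proof. by move=> oO; apply: L2M; [exact: measurable_indic_open|exact: indic_bound]. Qed.

Lemma bmcM g M r phi : measurable_fun setT g -> (forall x, `|g x| <= 1) -> bmc M r phi -> bmc M r (g * phi).
Proof.
move=> mg g1 [mp bM b0]; split.
- exact: measurable_funM.
- move=> x; have -> : (g * phi) x = g x * phi x by [].
  by rewrite normrM (le_trans _ (bM x))// ler_piMl.
- by move=> x /b0 E; have -> : (g * phi) x = g x * phi x by []; rewrite E mulr0.
Qed.

(** The indicator is a pointwise limit of the smooth functions [exhaust O n]; each product with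
    [phi] is still a test function on [S], and dominated convergence concludes. *)
Lemma pr_indic O S u phi : open O -> L2 u -> van S u -> test S phi -> pr (\1_O * u) phi = 0.
Proof.
move=> oO Lu Hu tp; rewrite pr_mulC.
have [M [r bp]] := test_bmc tp.
have se n := test_smooth (test_exhaust O n).
have H : pr u (exhaust O n * phi) @[n --> \oo] --> pr u (\1_O * phi).
  apply: (pr_dct (M := M) (r := r)) => //.
  - move=> n; apply: bmcM bp.
      by apply: continuous_measurable_plane; exact: smooth_continuous.
    by move=> x; have /andP[? ?] := exhaust_bound O n x; rewrite ger0_norm.
  - move=> x; apply: cvgM; [exact: exhaust_cvg|exact: cvg_cst].
  - by apply: measurable_funM; [exact: measurable_indic_open|case: bp].
rewrite -(cvg_lim (@Rhausdorff R) H).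
rewrite (_ : (fun n => _) = fun=> 0); first by rewrite lim_cst.
by apply/funext => n; apply: Hu; exact: testMl.
Qed.

Lemma pr_local P u w : L2 u -> L2 w ->
  (forall x, P x -> exists2 r, 0 < r & forall phi, test P phi -> supp phi `<=` disc x r -> pr u phi = pr w phi) ->
  forall phi, test P phi -> pr u phi = pr w phi.
Proof.
move=> Lu Lw; apply: test_local_ind; first by rewrite !pr0.
by move=> phi psi t1 t2 E1 E2; rewrite (prD_test Lu t1 t2) (prD_test Lw t1 t2) E1 E2.
Qed.

Lemma weak_local P e u u' : L2 u -> L2 u' ->
  (forall x, P x -> exists2 r, 0 < r & forall phi, test P phi -> supp phi `<=` disc x r ->
     pr u (pderive e phi) = - pr u' phi) ->
  weak P e u u'.
Proof.
move=> Lu Lu' H; rewrite /weak; apply: test_local_ind H.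
  have -> : pderive e 0 = 0 :> (plane R -> R) := pderive_cst 0 e.
  by rewrite !pr0 oppr0.
move=> phi psi t1 t2 E1 E2.
have [g1 g2] := (smooth_gradable (test_smooth t1), smooth_gradable (test_smooth t2)).
rewrite (pderiveD e g1 g2) (prD_test Lu (test_pderive e t1) (test_pderive e t2)).
by rewrite (prD_test Lu' t1 t2) E1 E2 opprD.
Qed.

Lemma indic_in O u phi : supp phi `<=` O -> pr (\1_O * u) phi = pr u phi.
Proof.
move=> H; apply: eq_pr => x; have -> : (\1_O * u) x = \1_O x * u x by [].
have [Kx|/supp_out ->] := pselect (supp phi x); last by rewrite !mulr0.
by rewrite indicE mem_set ?mul1r//; exact: H.
Qed.

Lemma indic_out O u phi : (forall x, supp phi x -> ~ O x) -> pr (\1_O * u) phi = 0.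
Proof.
move=> H; rewrite -(pr0 u); apply: eq_pr => x; have -> : (\1_O * u) x = \1_O x * u x by [].
have [Kx|/supp_out ->] := pselect (supp phi x); last by rewrite !mulr0.
by rewrite indicE memNset ?mul0r ?mulr0//; exact: H.
Qed.

(** The jump of the indicator creates no singular term when [u] vanishes around it, so the weak
    derivatives are simply cut as well. They satisfy the same local alternative, whence the
    induction. *)
Lemma Wk_cut k P O u : open O -> Wk k setT u ->
  (forall x, P x -> exists2 r, 0 < r &
     [\/ disc x r `<=` O, (forall y, disc x r y -> ~ O y) | van (disc x r) u]) ->
  Wk k P (\1_O * u).
Proof.
move=> oO; elim: k u => [|k IH] u Wu Hu; have Lu := Wk_L2 Wu; split; try exact: L2_indic; first by [].
have [_ [d dP]] := Wu; exists (fun e => \1_O * d e) => e.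
have [H1 H2] := dP e; have Ld := Wk_L2 H2; split; last first.
  apply: IH => // x /Hu[r r0 H]; exists r => //.
  by case: H => [?|?|?]; [exact: Or31|exact: Or32|apply: Or33; apply: van_weak H1 _].
apply: weak_local; [exact: L2_indic|exact: L2_indic|].
move=> x /Hu[r r0 H]; exists r => // phi tp sp.
have sp' : supp (pderive e phi) `<=` disc x r.
  by apply: subset_trans sp; exact: supp_pderive.
case: H => [DO|DnO|vu].
- rewrite !indic_in; [|exact: subset_trans DO|exact: subset_trans DO].
  by apply: H1; exact: test_sub tp.
- by rewrite !indic_out ?oppr0// => y => [/sp|/sp']; exact: DnO.
- have td : test (disc x r) phi by case: tp => ? ? ?; split.
  rewrite (pr_indic oO Lu vu (test_pderive e td)).
  by rewrite (pr_indic oO Ld (van_weak (@subsetT _ _) H1 vu) td) oppr0.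
Qed.

End WeakDerivatives.

(** * Extension by reflection *)

Section HalfPlane.
Context {R : realType}.
Implicit Types (f g u v w phi psi zeta : plane R -> R) (x y p : plane R) (r : R) (d : nat -> R).

Definition upper : set (plane R) := [set x | 0 < x.2].

Lemma open_upper : open upper.
Proof.
have /continuousP/(_ [set s : R | 0 < s]) := @continuous_affine R 0 1 0.
rewrite (_ : _ @^-1` _ = upper); first by apply; exact: open_gt.
by apply/seteqP; split=> x; rewrite /upper/= mul0r mul1r add0r addr0.
Qed.

Definition ramp : plane R -> R := fun x => step (x.2 - 1).

Lemma smooth_ramp : smooth ramp.
Proof.
by apply: (@smooth_step _ (fun x => x.2 - 1)); apply: affine_smooth; exists 0, 1, (-1);
  apply/funext => x; ring.
Qed.

Lemma pderive_ramp x : pderive false ramp x = pderive false ramp (0, x.2).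
Proof.
by rewrite /pderive /derive; congr (lim (_ @ _)); apply/funext => h.

Qed.

Lemma pderive_ramp0 x : x.2 < 1 -> pderive false ramp x = 0.
Proof.
move=> x1; apply: supp_out => /supp_pderive; apply: contraPnot x1 => H.
suff : [set y : plane R | 1 <= y.2] x by move=> /= ?; apply/negP; rewrite -leNgt.
apply: (_ : supp ramp `<=` _) x H; apply: supp_sub.
  have /continuous_closedP/(_ [set s : R | 1 <= s]) := @continuous_affine R 0 1 0.
  rewrite (_ : _ @^-1` _ = [set y : plane R | 1 <= y.2]); first by apply; exact: closed_ge.
  by apply/seteqP; split=> y; rewrite /= mul0r mul1r add0r addr0.
by move=> y /=; apply: contraNT; rewrite -ltNge => y1; rewrite /ramp step0//; lra.
Qed.

Lemma pderive_ramp1 x : 2 < x.2 -> pderive false ramp x = 0.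
Proof.
move=> x1.
have s1 : smooth (cst 1 - ramp) := smoothB (smooth_cst 1) smooth_ramp.
have -> : pderive false ramp x = - pderive false (cst 1 - ramp) x.
  rewrite (pderiveD false (smooth_gradable (smooth_cst 1)) (smooth_gradable (smoothN smooth_ramp))).
  rewrite pderive_cst (pderiveN _ (smooth_gradable smooth_ramp)).
  move: (pderive _ _) => g; have -> : (cst 0 + - g) x = 0 - g x by [].
  by rewrite sub0r opprK.
apply/eqP; rewrite oppr_eq0; apply/eqP.
apply: supp_out => /supp_pderive; apply: contraPnot x1 => H.
suff : [set y : plane R | y.2 <= 2] x by move=> /= ?; apply/negP; rewrite -leNgt.
apply: (_ : supp (cst 1 - ramp) `<=` _) x H; apply: supp_sub.
  have /continuous_closedP/(_ [set s : R | s <= 2]) := @continuous_affine R 0 1 0.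
  rewrite (_ : _ @^-1` _ = [set y : plane R | y.2 <= 2]); first by apply; exact: closed_le.
  by apply/seteqP; split=> y; rewrite /= mul0r mul1r add0r addr0.
move=> y /=; apply: contraNT; rewrite -ltNge => y1; have -> : (cst 1 - ramp) y = 1 - ramp y by [].
by rewrite /ramp step1 ?subrr//; lra.
Qed.

Lemma pderive_ramp_bound : exists C, forall x, `|pderive false ramp x| <= C.
Proof.
have cg := smooth_continuous (smooth_pderive false smooth_ramp).
(* The derivative depends only on the second coordinate and vanishes unless this lies in [1, 2], so
   a bound on a disc of radius 3 is enough. *)
have /compact_bounded [M [_ HM]] : compact (pderive false ramp @` [set x | sqd 0 x <= 3 ^+ 2]).
  by apply: continuous_compact; [exact: continuous_subspaceT|exact: compact_cdisc].
have M1 : M < `|M| + 1 by rewrite (le_lt_trans (ler_norm _))// ltrDl.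
exists (`|M| + 1) => x.
have [x1|x1] := ltP x.2 1; first by rewrite pderive_ramp0// normr0 addr_ge0.
have [x2|x2] := ltP 2 x.2; first by rewrite pderive_ramp1// normr0 addr_ge0.
rewrite pderive_ramp; apply: (HM _ M1); exists (0, x.2) => //=.
by rewrite /sqd/= !subr0 expr0n add0r; apply: le_sqr; lra.
Qed.

(** For n > 0, zero up to height 1/n and 1 from height 2/n on. As the ramp starts at 1 rather than
    0, the support stays in the open half-plane and the product with any test function is a test
    function there. *)
Definition scut (n : nat) : plane R -> R := ramp \o affmap 1 0 0 0 n%:R 0.

Lemma smooth_scut n : smooth (scut n). Proof. exact: smooth_aff smooth_ramp. Qed.

Lemma scutE n x : scut n x = step (n%:R * x.2 - 1).
Proof. by rewrite /scut /ramp /affmap/= mul0r add0r addr0. Qed.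

Lemma scut_bound n x : `|scut n x| <= 1.
Proof. by rewrite ger0_norm scutE ?step_ge0 ?step_le1. Qed.

Lemma scut_cvg x : scut n x @[n --> \oo] --> (\1_upper x : R).
Proof.
apply: cvg_near_cst; rewrite indicE.
have [Ux|nUx] := pselect (upper x).
  rewrite mem_set//; near=> n; rewrite scutE step1//.
  have : (2 / x.2) <= n%:R by near: n; exact: nbhs_infty_ger.
  by rewrite ler_pdivrMr// => ?; lra.
rewrite memNset//; near=> n; rewrite scutE step0//.
have : x.2 <= 0 by move/negP : nUx; rewrite -leNgt.
move=> x0; rewrite subr_le0 (le_trans _ ler01)// mulr_ge0_le0//.
Unshelve. all: by end_near.
Qed.

Lemma supp_scut n : supp (scut n) `<=` upper.
Proof.
have H : supp (scut n) `<=` [set x | 1 <= n%:R * x.2].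
  apply: supp_sub.
    have /continuous_closedP/(_ [set s : R | 1 <= s]) := @continuous_affine R 0 n%:R 0.
    rewrite (_ : _ @^-1` _ = [set y : plane R | 1 <= n%:R * y.2]); first by apply; exact: closed_ge.
    by apply/seteqP; split=> y; rewrite /= mul0r add0r addr0.
  by move=> x /=; apply: contraNT; rewrite -ltNge => x1; rewrite scutE step0//; lra.
move=> x /H /=; rewrite /upper/= => x1; rewrite ltNge; apply/negP => x0.
have : n%:R * x.2 <= 0 by rewrite mulr_ge0_le0.
lra.
Qed.

Lemma test_scut U n zeta : test U zeta -> test (U `&` upper) (scut n * zeta).
Proof.
move=> tz; apply: test_supp tz (smoothM (smooth_scut n) (test_smooth tz)) _.
move=> x Hx; split.
  apply: (supp_mono _ Hx) => y E.
  by have -> : (scut n * zeta) y = scut n y * zeta y by []; rewrite E mulr0.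
apply: (@supp_scut n); apply: (supp_mono _ Hx) => y E.
by have -> : (scut n * zeta) y = scut n y * zeta y by []; rewrite E mul0r.
Qed.

Lemma pr_scut_cvg U u zeta : L2 u -> test U zeta ->
  pr u (scut n * zeta) @[n --> \oo] --> pr (\1_upper * u) zeta.
Proof.
move=> Lu tz; rewrite pr_mulC; have [M [r bz]] := test_bmc tz.
apply: (pr_dct (M := M) (r := r)) => //.
- move=> n; apply: bmcM bz; last exact: scut_bound.
  by apply: continuous_measurable_plane; exact: smooth_continuous (smooth_scut n).
- by move=> x; apply: cvgM; [exact: scut_cvg|exact: cvg_cst].
- by apply: measurable_funM; [exact: measurable_indic_open open_upper|case: bz].
Qed.

Lemma pderive_true_ramp : pderive true ramp = 0.
Proof.
apply: is_derive_pderive => x.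
rewrite -[X in is_derive X](add0r x) -(scale0r (dir true)); apply/is_derive_line.
rewrite (_ : (fun s => _) = cst (ramp x)); first exact: is_derive_cst.
by apply/funext => s; rewrite /ramp/= scaler0 add0r.
Qed.

Lemma pderive_scut e n : pderive e (scut n) =
  if e then 0 else n%:R *: (pderive false ramp \o affmap 1 0 0 0 n%:R 0).
Proof.
rewrite (pderive_aff _ _ _ _ _ _ _ smooth_ramp); case: e => /=; last first.
  by rewrite scale0r add0r.
by rewrite scale0r addr0 scale1r pderive_true_ramp.
Qed.

(** The derivative of the cutoff is of size n, but lives at heights between 1/n and 2/n, where
    [zeta], zero on the axis, is of size 1/n by the mean value theorem. The product is bounded and
    tends to 0 pointwise. *)
Lemma cvg_pr_scut_d u zeta : L2 u -> test setT zeta -> (forall s : R, zeta (s, 0) = 0) ->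
  pr u (pderive false (scut n) * zeta) @[n --> \oo] --> (0 : R).
Proof.
move=> Lu tz z0; rewrite -(pr0 u).
have [C HC] := pderive_ramp_bound.
have [M [r bz]] := test_bmc tz.
have [M' [r' bz']] := test_bmc (test_pderive false tz).
have M'0 : 0 <= M' by case: bz' => _ /(_ 0) + _; apply: le_trans.
have C0 : 0 <= C by have := HC 0; apply: le_trans.
have zy x : `|zeta x| <= `|x.2| * M'.
  have [c _ E] := MVT_dir (x.1, 0) false x.2 (smooth_gradable (test_smooth tz)).
  have -> : zeta x = zeta x - zeta (x.1, 0) by rewrite z0 subr0.
  rewrite (_ : zeta x = zeta (x.2 *: dir false + (x.1, 0))); last first.
    by congr (zeta _); case: (x) => x1 x2; apply/pair_equal_spec; rewrite /= /GRing.scale/=; split; ring.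
  by rewrite E normrM ler_wpM2l//; case: bz'.
have ds n x : (pderive false (scut n) * zeta) x =
    n%:R * pderive false ramp (x.1, n%:R * x.2) * zeta x.
  rewrite (pderive_scut false n).
  have -> : affmap 1 0 0 0 n%:R 0 = fun x => (x.1, n%:R * x.2).
    by apply/funext => y; rewrite /affmap mul0r mul0r mul1r !addr0 add0r.
  by [].
apply: (pr_dct (M := 2 * C * M') (r := r)) => //.
- move=> n; split.
  + apply: measurable_funM; last by case: bz.
    by apply: continuous_measurable_plane; exact: smooth_continuous (smooth_pderive _ (smooth_scut n)).
  + move=> x; rewrite ds.
    have [x1|x1] := ltP (n%:R * x.2) 1.
      by rewrite pderive_ramp0// mulr0 mul0r normr0 !mulr_ge0.
    have [x2|x2] := ltP 2 (n%:R * x.2).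
      by rewrite pderive_ramp1// mulr0 mul0r normr0 !mulr_ge0.
    rewrite !normrM (ger0_norm (ler0n _ n)).
    have xp : 0 <= x.2.
      rewrite leNgt; apply/negP => x0; have := mulr_ge0_le0 (ler0n R n) (ltW x0).
      by rewrite leNgt (lt_le_trans ltr01 x1).
    rewrite (@le_trans _ _ (n%:R * C * (x.2 * M')))//.
      by apply: ler_pM => //; rewrite ?mulr_ge0// ?ler_wpM2l// (le_trans (zy x))// ger0_norm.
    have -> : n%:R * C * (x.2 * M') = (n%:R * x.2) * (C * M') by ring.
    by rewrite -[2 * C * M']mulrA ler_wpM2r// mulr_ge0.
  + by move=> x nx; rewrite ds; case: bz => _ _ ->//; rewrite mulr0.
- move=> x; apply: cvg_near_cst; near=> n; rewrite ds.
  have [x0|x0] := ltP 0 x.2; last first.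
    rewrite pderive_ramp0 ?mulr0 ?mul0r//= (le_lt_trans _ ltr01)// mulr_ge0_le0//.
  rewrite pderive_ramp1 ?mulr0 ?mul0r//=.
  have : (2 / x.2) < n%:R by near: n; exact: nbhs_infty_gtr.
  by rewrite ltr_pdivrMr.
- exact: measurable_cst.
Unshelve. all: by end_near.
Qed.

(** Integration by parts on the half-plane against functions whose support may cross the axis, by
    inserting the cutoff and letting n grow. The cutoff has no horizontal derivative, so vanishing
    on the axis matters only for the vertical one. *)
Lemma weak_upper e u u' zeta : L2 u -> L2 u' -> weak upper e u u' -> test setT zeta ->
  (e = false -> forall s : R, zeta (s, 0) = 0) ->
  pr (\1_upper * u) (pderive e zeta) = - pr (\1_upper * u') zeta.
Proof.
move=> Lu Lu' H tz z0.
have sz := test_smooth tz.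
have H1 := pr_scut_cvg Lu (test_pderive e tz).
have H2 := pr_scut_cvg Lu' tz.
have ts n : test upper (scut n * zeta) by have := test_scut n tz; rewrite setTI.
have H3 : pr u (pderive e (scut n) * zeta) @[n --> \oo] --> (0 : R).
  case: e z0 {H H1} => [_|/(_ erefl) z0]; last exact: cvg_pr_scut_d.
  apply: cvg_near_cst; near=> n.
  rewrite (pderive_scut true n) (_ : 0 * zeta = 0) ?pr0//.
  by apply/funext => x; have -> : (0 * zeta) x = 0 * zeta x by []; rewrite mul0r.
have E n : pr u (scut n * pderive e zeta) + pr u (pderive e (scut n) * zeta) = - pr u' (scut n * zeta).
  rewrite -(H _ (ts n)) (pderiveM e (smooth_gradable (smooth_scut n)) (smooth_gradable sz)).
  rewrite [zeta * _]mulrC; symmetry; apply: (prD_test Lu (U := setT) (V := setT)).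
    exact: testMl (smooth_scut n) (test_pderive e tz).
  exact: testMl (smooth_pderive e (smooth_scut n)) tz.
have H4 : - pr u' (scut n * zeta) @[n --> \oo] --> pr (\1_upper * u) (pderive e zeta).
  rewrite -[X in _ --> X]addr0 (_ : (fun n => - _) = (fun n => pr u (scut n * pderive e zeta) +
    pr u (pderive e (scut n) * zeta))); last by apply/funext => n; rewrite E.
  exact: (cvgD H1 H3).
exact: (cvg_unique (@Rhausdorff R) H4 (cvgN H2)).
Unshelve. all: by end_near.
Qed.

End HalfPlane.

(** * Higher-order reflections and extension from the complement of a quadrant *)

Section Reflections.
Context {R : realType}.
Implicit Types (f g u v w phi psi zeta : plane R -> R) (x y p : plane R) (r : R) (d : nat -> R) (P Q : set (plane R)).

(** Negative, so that scaling the second coordinate crosses the axis, and pairwise distinct, so that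
    the Vandermonde matrix is invertible. *)
Definition node (l : nat) : R := - l.+1%:R.

Lemma node_neq0 l : node l != 0. Proof. by rewrite oppr_eq0 pnatr_eq0. Qed.

Lemma node_lt0 l : node l < 0. Proof. by rewrite oppr_lt0 ltr0n. Qed.

Definition refl l : plane R -> plane R := affmap 1 0 0 0 (node l) 0.
Definition refl' l : plane R -> plane R := affmap 1 0 0 0 (node l)^-1 0.

Lemma reflE l x : refl l x = (x.1, node l * x.2).
Proof. by rewrite /refl /affmap !mul0r mul1r !addr0 add0r. Qed.

Lemma refl'E l x : refl' l x = (x.1, (node l)^-1 * x.2).
Proof. by rewrite /refl' /affmap !mul0r mul1r !addr0 add0r. Qed.

Lemma reflK l : cancel (refl l) (refl' l).
Proof. by move=> [x1 x2]; rewrite refl'E reflE /= mulKf// node_neq0. Qed.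

Lemma refl'K l : cancel (refl' l) (refl l).
Proof. by move=> [x1 x2]; rewrite reflE refl'E /= mulVKf// node_neq0. Qed.

Lemma scales_refl l : scales `|node l|^-1 (refl l).
Proof. exact: scales_shear (node_neq0 l). Qed.

Lemma test_refl' U l f : test U f -> test (refl' l @^-1` U) (f \o refl' l).
Proof.
apply: (test_comp (B := refl l)); try exact: continuous_affmap; first exact: refl'K.
exact: smooth_aff.
Qed.

Lemma testT_refl' U l f : test U f -> test setT (f \o refl' l).
Proof. by move=> /test_refl'-/(_ l); exact: test_sub. Qed.

Fixpoint ext (n : nat) d v : plane R -> R :=
  if n is m.+1 then ext m d v + d m *: (v \o refl m) else v.

(* The transpose of [ext]. *)
Fixpoint fold (n : nat) d phi : plane R -> R :=
  if n is m.+1 then fold m d phi + (d m / `|node m|) *: (phi \o refl' m) else phi.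

Lemma test_fold n d U phi : test U phi -> test setT (fold n d phi).
Proof.
move=> tp; elim: n => [|n IH] /=; first exact: test_sub tp.
by apply: (testD IH); apply: testZ; exact: testT_refl' tp.
Qed.

Lemma test_fold_right n d U phi : (forall x l, U (refl l x) <-> U x) -> test U phi -> test U (fold n d phi).
Proof.
move=> UU tp; elim: n => [|n IH] //=; apply: (testD IH); apply: testZ.
by apply: test_sub (test_refl' n tp) => x /= Ux; rewrite -(refl'K n x); apply/UU.
Qed.

Lemma L2_ext n d v : L2 v -> L2 (ext n d v).
Proof.
move=> Lv; elim: n => [|n IH] //=; apply: (L2D IH); apply: L2Z.
exact: L2_scales (scales_refl n) Lv.
Qed.

Lemma pr_ext n d v U phi : L2 v -> test U phi -> pr (ext n d v) phi = pr v (fold n d phi).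
Proof.
move=> Lv tp; elim: n => [|n IH] //=.
have Lr := L2_scales (scales_refl n) Lv.
have tr := testT_refl' n tp.
rewrite (prDl_test (L2_ext n d Lv) (L2Z _ Lr) tp) IH (prZl_test _ Lr tp).
rewrite (prD_test Lv (test_fold n d tp) (testZ _ tr)) (prZ_test _ Lv tr).
have [M [r br]] := test_bmc tr.
have := pr_scales (scales_refl n) Lv br.
rewrite (_ : (phi \o refl' n) \o refl n = phi); last by apply/funext => x /=; rewrite reflK.
by move=> ->; rewrite mulrA.
Qed.

(* The moment of order 0 makes [fold n (dd d) phi] vanish on the boundary line, see
   [fold_axis], so the reflected function has no jump there; the higher ones are
   inherited by the coefficients [dd d] of its derivative. *)
Definition moments (m n : nat) d := forall i, (i < m)%N -> \sum_(l < n) d l * node l ^+ i = 1.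

Definition dd d : nat -> R := fun l => node l * d l.

Lemma moments_dd m n d : moments m.+1 n d -> moments m n (dd d).
Proof.
move=> H i im; rewrite -(H i.+1 im); apply: eq_bigr => l _.
by rewrite /dd exprS; ring.
Qed.

Lemma momentsW m n d : moments m.+1 n d -> moments m n d.
Proof. by move=> H i im; apply: H; rewrite ltnW. Qed.

(** A Vandermonde system, solvable because the nodes are distinct. *)
Lemma moments_exist m : exists d, moments m m d.
Proof.
pose a : 'rV[R]_m := \row_l node l.
have Vu : Vandermonde m a \in unitmx.
  rewrite unitmxE det_Vandermonde unitfE; apply/prodf_neq0 => i _; apply/prodf_neq0 => j ij.
  rewrite !mxE subr_eq0 eqr_opp eqr_nat eqSS; apply: contraTneq ij => ->.
  by rewrite ltnn.
pose c : 'cV[R]_m := invmx (Vandermonde m a) *m const_mx 1.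
exists (fun l => if insub l is Some i then c i 0 else 0) => i im.
have : (Vandermonde m a *m c) (Ordinal im) 0 = 1 by rewrite mulmxA mulmxV// mul1mx mxE.
rewrite mxE => <-; apply: eq_bigr => l _; rewrite !mxE mulrC.
by rewrite valK /c mxE.
Qed.

Lemma fold_smooth_pderive_true n d U phi : test U phi ->
  fold n d (pderive true phi) = pderive true (fold n d phi).
Proof.
move=> tp; elim: n => [|n IH] //=.
have tf := test_fold n d tp; have tr := testT_refl' n tp.
have s (f : plane R -> R) V : test V f -> gradable f by move=> /test_smooth/smooth_gradable.
rewrite (pderiveD _ (s _ _ tf) (s _ _ (testZ _ tr))) (pderiveZ _ _ (s _ _ tr)) IH.
by rewrite (pderive_aff _ _ _ _ _ _ _ (test_smooth tp))/= scale1r scale0r addr0.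
Qed.

(** The chain rule divides each reflected term by its node, and the coefficients [dd d] restore the
    factor. *)
Lemma fold_smooth_pderive_false n d U phi : test U phi ->
  fold n d (pderive false phi) = pderive false (fold n (dd d) phi).
Proof.
move=> tp; elim: n => [|n IH] //=.
have tf := test_fold n (dd d) tp; have tr := testT_refl' n tp.
have s (f : plane R -> R) V : test V f -> gradable f by move=> /test_smooth/smooth_gradable.
rewrite (pderiveD _ (s _ _ tf) (s _ _ (testZ _ tr))) (pderiveZ _ _ (s _ _ tr)) IH.
rewrite (pderive_aff _ _ _ _ _ _ _ (test_smooth tp))/= scale0r add0r scalerA.
congr (_ + _ *: _); rewrite /dd; move: (node_neq0 n) (d n); move: (node n) => a a0 b.
by field; rewrite normr_eq0 a0.
Qed.

(** The reflections fix the axis, and a node divided by its absolute value is -1. *)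
Lemma fold_axis n d phi (s : R) : fold n (dd d) phi (s, 0) = (1 - \sum_(l < n) d l * node l ^+ 0) * phi (s, 0).
Proof.
elim: n => [|n IH] /=; first by rewrite big_ord0 subr0 mul1r.
have -> : (fold n (dd d) phi + (dd d n / `|node n|) *: (phi \o refl' n)) (s, 0) =
   fold n (dd d) phi (s, 0) + (dd d n / `|node n|) * phi (refl' n (s, 0)) by [].
rewrite refl'E /= mulr0 IH big_ord_recr /= expr0 mulr1 /dd ltr0_norm ?node_lt0//.
have -> : node n * d n / - node n = - d n.
  by rewrite mulrAC invrN mulrN divff ?node_neq0// mulN1r.
by move: (\sum_(_ < n) _) (d n) (phi _) => a b c; ring.
Qed.

Definition extend n d u := ext n d (\1_upper * u).

(** The derivatives of the extension are extensions of the derivatives, with coefficients [d]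
    horizontally and [dd d] vertically. Each derivative consumes one moment condition, hence as many
    moments as derivatives. *)
Lemma Wk_extend k n d u : moments k n d -> Wk k upper u -> Wk k setT (extend n d u).
Proof.
elim: k d u => [|k IH] d u md Wu; have Lu := Wk_L2 Wu;
  have Lv := L2_indic open_upper Lu; split; try exact: (L2_ext n d Lv); first by [].
have [_ [D DP]] := Wu.
exists (fun e => extend n (if e then d else dd d) (D e)) => e.
have [H1 H2] := DP e; have LD := L2_indic open_upper (Wk_L2 H2).
split; last by apply: IH H2; case: e {H1 LD} => //; [exact: momentsW|exact: moments_dd].
move=> phi tp; rewrite /extend (pr_ext _ _ Lv (test_pderive e tp)) (pr_ext _ _ LD tp).
case: e H1 H2 LD => H1 H2 LD.
  rewrite (fold_smooth_pderive_true n d tp).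
  exact: (weak_upper Lu (Wk_L2 H2) H1 (test_fold n d tp)).
rewrite (fold_smooth_pderive_false n d tp).
apply: (weak_upper Lu (Wk_L2 H2) H1 (test_fold n _ tp)) => _ s.
by rewrite fold_axis (md 0%N)// subrr mul0r.
Qed.

(** A reflected term at a point of the upper half-plane reads the cut function below the axis, where
    it is zero. *)
Lemma extend_upper n d u phi : L2 u -> test upper phi -> pr (extend n d u) phi = pr u phi.
Proof.
move=> Lu tp; have Lv := L2_indic open_upper Lu; rewrite /extend.
elim: n => [|n IH] /=; first by apply: indic_in; case: tp.
have Lr := L2_scales (scales_refl n) Lv.
rewrite (prDl_test (L2_ext n d Lv) (L2Z _ Lr) tp) IH (prZl_test _ Lr tp).
suff -> : pr ((\1_upper * u) \o refl n) phi = 0 by rewrite mulr0 addr0.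
rewrite -(pr0 u); apply: eq_pr => x; have -> : (0 : plane R -> R) x = 0 by [].
have [Ux|nUx] := pselect (upper x); last by rewrite (supp_out (phi := phi)) ?mulr0//; case: tp => _ _ H /H.
have -> : ((\1_upper * u) \o refl n) x = \1_upper (refl n x) * u (refl n x) by [].
rewrite indicE memNset ?mul0r ?mulr0// reflE /upper/= => H.
by have := nmulr_rgt0 x.2 (node_lt0 n); rewrite H => /esym; rewrite ltNge ltW.
Qed.

Definition right : set (plane R) := [set x | 0 < x.1].

(** The reflections leave the first coordinate alone, so the folded test function is still supported
    in [right]; the cutoffs then move it into the quadrant. This keeps the second reflection for a
    quadrant from spoiling the first. *)
Lemma van_extend n d u : L2 u -> van (right `&` upper) u -> van right (extend n d u).
Proof.
move=> Lu Hu phi tp; have Lv := L2_indic open_upper Lu.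
rewrite /extend (pr_ext _ _ Lv tp).
have tf : test right (fold n d phi).
  by apply: test_fold_right tp => x l; rewrite reflE.
rewrite -(cvg_lim (@Rhausdorff R) (pr_scut_cvg Lu tf)).
rewrite (_ : (fun n => _) = fun=> 0); first by rewrite lim_cst.
by apply/funext => m; apply: Hu; exact: test_scut.
Qed.

Lemma extend_upper_exists k u : Wk k upper u -> exists w, [/\ Wk k setT w,
  forall phi, test upper phi -> pr w phi = pr u phi &
  van (right `&` upper) u -> van right w].
Proof.
move=> Wu; have [d md] := moments_exist k; have Lu := Wk_L2 Wu.
exists (extend k d u); split; first exact: Wk_extend.
  by move=> phi; exact: extend_upper.
exact: van_extend.
Qed.

Lemma extend_right_exists k u : Wk k right u -> exists w, Wk k setT w /\
  forall phi, test right phi -> pr w phi = pr u phi.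
Proof.
move=> Wu; pose sw := @affmap R 0 1 0 1 0 0.
have D : (0 * 0 - 1 * 1 : R) != 0 by rewrite mul0r mul1r sub0r oppr_eq0 oner_eq0.
have swE x : sw x = (x.2, x.1).
  by rewrite /sw /affmap !mul0r !mul1r !addr0 add0r.
have swK : cancel sw sw by move=> [x1 x2]; rewrite !swE.
have Wu' := Wk_aff 0 0 D Wu; rewrite -/sw in Wu'.
have E : sw @^-1` right = upper.
  by apply/funext => x; have -> : (sw @^-1` right) x = right (sw x) by []; rewrite swE.
rewrite E in Wu'; have [w' [Ww' Hw' _]] := extend_upper_exists Wu'.
exists (w' \o sw); split; first exact: (Wk_aff 0 0 D Ww').
move=> phi tp.
have cs : continuous sw := @continuous_affmap _ _ _ _ _ _ _.
have tps : test upper (phi \o sw).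
  by rewrite -E; apply: (test_comp cs cs swK _ tp); exact: smooth_aff.
have [M [r b]] := test_bmc tps; have [M' [r' b']] := test_bmc tp.
have := pr_scales (@scales_swap R) (Wk_L2 Ww') b; rewrite -/sw mul1r.
rewrite (_ : (phi \o sw) \o sw = phi); last by apply/funext => x /=; rewrite swK.
by move=> ->; rewrite (Hw' _ tps) (pr_scales (@scales_swap R) (Wk_L2 Wu) b') mul1r.
Qed.

Lemma open_right : open right.
Proof.
have /continuousP/(_ [set s : R | 0 < s]) := @continuous_affine R 1 0 0.
rewrite (_ : _ @^-1` _ = right); first by apply; exact: open_gt.
by apply/seteqP; split=> x; rewrite /right/= mul0r mul1r !addr0.
Qed.

(* Reflect across one side of the quadrant, then correct by reflecting along that
   side across the other one. *)
Lemma extend_quadrant k u : Wk k (right `|` upper) u ->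
  exists w, Wk k setT w /\ forall phi, test (right `|` upper) phi -> pr w phi = pr u phi.
Proof.
move=> Wu; have Lu := Wk_L2 Wu.
have [w1 [Ww1 H1]] := extend_right_exists (Wk_sub (@subsetUl _ _ _) Wu).
have Lw1 := Wk_L2 Ww1.
have Wz : Wk k upper (u - w1).
  by apply: WkB; [exact: Wk_sub Wu|exact: Wk_sub Ww1].
have Lz := Wk_L2 Wz.
have [w2 [Ww2 H2 V2]] := extend_upper_exists Wz.
have Lw2 := Wk_L2 Ww2.
have {}V2 : van right w2.
  apply: V2 => phi tp; rewrite (prBl_test Lu Lw1 tp) H1 ?subrr//.
  exact: test_sub tp.
exists (w1 + w2); split; first exact: WkD.
apply: pr_local; [exact: L2D|exact: Lu|].
move=> x [rx|ux].
- have [r r0 Hr] := open_disc_sub open_right rx; exists r => // phi tp sp.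
  have tr : test right phi by case: tp => ? ? ?; split=> //; exact: subset_trans Hr.
  by rewrite (prDl_test Lw1 Lw2 tr) (H1 _ tr) (V2 _ tr) addr0.
- have [r r0 Hr] := open_disc_sub open_upper ux; exists r => // phi tp sp.
  have tr : test upper phi by case: tp => ? ? ?; split=> //; exact: subset_trans Hr.
  by rewrite (prDl_test Lw1 Lw2 tr) (H2 _ tr) (prBl_test Lu Lw1 tr) addrC subrK.
Qed.

End Reflections.

(** * Sobolev functionals *)

Section SobolevFunctionals.
Local Open Scope complex_scope.
Context {R : realType}.
Implicit Types (u v w phi psi : plane R -> R) (x y p : plane R) (r : R) (U V : set (plane R)) (F T f g : @functional R).

Lemma dpartS i j phi : dpart i.+1 j phi = pderive true (dpart i j phi). Proof. by []. Qed.

Lemma dpart0S j phi : dpart 0 j.+1 phi = pderive false (dpart 0 j phi). Proof. by []. Qed.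

Lemma test_dpart U i j phi : test U phi -> test U (dpart i j phi).
Proof.
move=> tp; elim: i => [|i IH]; last by rewrite dpartS; exact: test_pderive.
by elim: j => [//|j IH]; rewrite dpart0S; exact: test_pderive.
Qed.

(** [dpart] takes the vertical derivatives first, so a further one has to be commuted past the
    horizontal ones. *)
Lemma dpartSr U i j phi : test U phi -> pderive false (dpart i j phi) = dpart i j.+1 phi.
Proof.
move=> tp; elim: i => [//|i IH]; rewrite !dpartS -IH.
by rewrite -pderive_smooth_comm//; exact: test_smooth (test_dpart i j tp).
Qed.

(** All derivatives given at once, as in [Sobolev_plane], instead of one at a time as in [Wk].
    Shifting one index yields the family of a first derivative. *)
Definition L2_derivatives k (h0 : plane R -> R) (h : nat -> nat -> plane R -> R) := h 0%N 0%N = h0 /\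
  forall i j, (i + j <= k)%N -> L2 (h i j) /\
    forall phi, test setT phi -> (-1) ^+ (i + j) * pr h0 (dpart i j phi) = pr (h i j) phi.

Lemma L2_derivatives_Wk k h0 (h : nat -> nat -> plane R -> R) : L2_derivatives k h0 h -> Wk k setT h0.
Proof.
elim: k h0 h => [|k IH] h0 h [<- H].
  by split=> //; have [] := H 0%N 0%N (leqnn _).
split; first by have [] := H 0%N 0%N (leq0n _).
have [L1 H1] := H 1%N 0%N isT; have [L2' H2] := H 0%N 1%N isT.
exists (fun e => if e then h 1%N 0%N else h 0%N 1%N) => -[]; split.
- by move=> phi tp; rewrite -(H1 _ tp) mulN1r opprK.
- apply: (IH _ (fun i j => h i.+1 j)); split=> // i j ij; have [L Hij] := H i.+1 j ij; split=> // phi tp.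
  by rewrite -(H1 _ (test_dpart i j tp)) -(Hij _ tp) addSn mulrA -exprD addn1.
- by move=> phi tp; rewrite -(H2 _ tp) mulN1r opprK.
- apply: (IH _ (fun i j => h i j.+1)); split=> // i j ij.
  have [|L Hij] := H i j.+1; first by rewrite addnS.
  split=> // phi tp.
  rewrite -(H2 _ (test_dpart i j tp)) -(Hij _ tp) addnS mulrA -exprD addn1.
  by rewrite addnS -(dpartSr i j tp).
Qed.

Lemma Wk_L2_derivatives k u : Wk k setT u -> forall i j, (i + j <= k)%N -> exists2 h, L2 h &
  forall phi, test setT phi -> (-1) ^+ (i + j) * pr u (dpart i j phi) = pr h phi.
Proof.
elim: k u => [|k IH] u Wu i j; have Lu := Wk_L2 Wu.
  rewrite leqn0 addn_eq0 => /andP[/eqP -> /eqP ->].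
  by exists u => // phi _; rewrite mul1r.
have [_ [d dP]] := Wu.
case: i => [|i] ij.
  case: j ij => [|j] ij; first by exists u => // phi _; rewrite mul1r.
  have [H1 H2] := dP false; have [h Lh Hh] := IH _ H2 0%N j ij.
  exists h => // phi tp; rewrite dpart0S (H1 _ (test_dpart _ _ tp)) -(Hh _ tp) add0n exprS.
  by rewrite mulrN -mulrA mulN1r opprK.
have [H1 H2] := dP true; have [h Lh Hh] := IH _ H2 i j ij.
exists h => // phi tp; rewrite dpartS (H1 _ (test_dpart _ _ tp)) -(Hh _ tp) addSn exprS.
by rewrite mulrN -mulrA mulN1r opprK.
Qed.

(** The value 0 off the test functions is the normalization that [distribution] imposes. *)
Definition Fun u1 u2 : functional :=
  fun phi => if `[< test setT phi >] then pr u1 phi +i* pr u2 phi else 0.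

Lemma FunE u1 u2 U phi : test U phi -> Fun u1 u2 phi = pr u1 phi +i* pr u2 phi.
Proof. by move=> tp; rewrite /Fun asboolT//; exact: test_sub tp. Qed.

Lemma resE V T phi : test V phi -> res V T phi = T phi.
Proof. by move=> tp; rewrite /res asboolT. Qed.

Lemma res_out V T phi : ~ test V phi -> res V T phi = 0.
Proof. by move=> tp; rewrite /res asboolF. Qed.

Lemma distribution_eq U f g : distribution U f -> distribution U g ->
  (forall phi, test U phi -> f phi = g phi) -> f = g.
Proof.
move=> [_ _ f0] [_ _ g0] H; apply/funext => phi.
by have [tp|ntp] := pselect (test U phi); [exact: H|rewrite f0// g0].
Qed.

Lemma distribution_res U V T : V `<=` U -> distribution U T -> distribution V (res V T).
Proof.
move=> VU [lT cT T0]; split.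
- move=> a phi psi tp tq; rewrite !resE//; last by apply: (testD (testZ a tp) tq).
  by apply: lT; exact: test_sub VU _.
- move=> K cK KV; have [c [m H]] := cT K cK (subset_trans KV VU); exists c, m => phi M tp sK dM.
  by rewrite resE//; apply: H => //; exact: test_sub tp.
- by move=> phi; exact: res_out.
Qed.

(** The constant is the integral of |u| over a disc containing [K]; no derivative of [phi] enters,
    so [Fun] is a distribution of order 0. *)
Lemma pr_bound u (K : set (plane R)) : L2 u -> compact K -> exists c, 0 <= c /\
  forall phi M, test setT phi -> supp phi `<=` K -> (forall x, `|phi x| <= M) -> `|pr u phi| <= c * M.
Proof.
move=> Lu cK.
have /compact_bounded [r [_ Hr]] := cK.
have r0 : r < `|r| + 1 by rewrite (le_lt_trans (ler_norm _))// ltrDl.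
pose rho := 2 * (`|r| + 1).
have KD : K `<=` disc 0 rho.
  move=> x Kx; have := Hr _ r0 x Kx; rewrite /= [in X in X -> _]/Num.norm/= ge_max => /andP[H1 H2].
  rewrite discE /sqd !subr0 exprMn.
  have rr : 0 < (`|r| + 1) ^+ 2 by rewrite exprn_gt0// ltr_wpDl.
  have := le_sqr (normr_ge0 _) H1; have := le_sqr (normr_ge0 _) H2.
  rewrite !real_normK ?num_real//; move: rr; clear.
  by move: (x.1 ^+ 2) (x.2 ^+ 2) ((`|r| + 1) ^+ 2) => a b c; rewrite expr2; lra.
pose one : plane R -> R := \1_(disc 0 rho).
have bone : bmc 1 rho one.
  split; first by apply: measurable_indic; exact: measurable_disc.
    exact: indic_bound.
  by move=> x nx; rewrite /one indicE memNset.
exists (Rintegral lebesgue2 setT (fun x => `|u x * one x|)); split.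
  by apply: Rintegral_ge0.
move=> phi M tp sp pM; have [M' [r' bp]] := test_bmc tp.
have iu := integrable_pair Lu bone.
have M0 : 0 <= M by rewrite (le_trans _ (pM 0)).
apply: (le_trans (le_normr_Rintegral measurableT (integrable_pair Lu bp))).
rewrite -RintegralZr//; last exact: (integrable_norm iu).
apply: le_Rintegral => //.
- exact: (integrable_norm (integrable_pair Lu bp)).
- have := integrableZr measurableT M (integrable_norm iu); exact.
- move=> x _; rewrite !normrM -mulrA ler_wpM2l// /one indicE.
  have [Kx|/supp_out ->] := pselect (supp phi x); last by rewrite normr0 mulr_ge0.
  by rewrite mem_set ?normr1 ?mul1r//; apply: KD; exact: sp.
Qed.

Lemma normc_le (a b : R) : `|(a +i* b)%C| <= (`|a| + `|b|)%:C.
Proof.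
rewrite normc_def/= lecR.
have s0 : 0 <= `|a| + `|b| by rewrite addr_ge0.
rewrite -[leRHS](ger0_norm s0) -sqrtr_sqr ler_sqrt ?sqr_ge0//.
rewrite -(real_normK (num_real a)) -(real_normK (num_real b)).
have := normr_ge0 a; have := normr_ge0 b.
by move: (`|a|) (`|b|) => A B; nra.
Qed.

Lemma Fun_distribution u1 u2 : L2 u1 -> L2 u2 -> distribution setT (Fun u1 u2).
Proof.
move=> L1 L2'; split.
- move=> a phi psi tp tq; have taq := testD (testZ a tp) tq.
  rewrite !(FunE _ _ tp, FunE _ _ tq, FunE _ _ taq).
  rewrite (prD_test L1 (testZ a tp) tq) (prD_test L2' (testZ a tp) tq).
  by rewrite (prZ_test a L1 tp) (prZ_test a L2' tp); simpc.
- move=> K cK _; have [c1 [c10 H1]] := pr_bound L1 cK; have [c2 [c20 H2]] := pr_bound L2' cK.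
  exists (c1 + c2), 0%N => phi M tp sp dM; rewrite (FunE _ _ tp).
  have pM x : `|phi x| <= M by exact: (dM 0%N 0%N).
  rewrite (le_trans (normc_le _ _))// lecR mulrDl; apply: lerD; [exact: H1|exact: H2].
- by move=> phi tp; rewrite /Fun asboolF.
Qed.

Lemma complex_sign n (a b : R) : (-1) ^+ n * (a +i* b)%C = (((-1) ^+ n * a) +i* ((-1) ^+ n * b))%C.
Proof.
have -> : (-1) ^+ n = ((-1) ^+ n : R)%:C by rewrite rmorphXn rmorphN1.
by simpc.
Qed.

Lemma Sobolev_plane_Fun k u1 u2 : Wk k setT u1 -> Wk k setT u2 -> Sobolev_plane k (Fun u1 u2).
Proof.
move=> W1 W2; split; first exact: Fun_distribution (Wk_L2 W1) (Wk_L2 W2).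
move=> i j ij; have [h1 L1 H1] := Wk_L2_derivatives W1 ij; have [h2 L2' H2] := Wk_L2_derivatives W2 ij.
exists (h1, h2); first by [].
move=> phi tp; rewrite (FunE _ _ (test_dpart i j tp)) complex_sign.
by rewrite H1 ?H2.
Qed.

Lemma Sobolev_planeP k F : Sobolev_plane k F -> exists u1 u2, [/\ Wk k setT u1, Wk k setT u2 & F = Fun u1 u2].
Proof.
move=> [dF HF].
have /(_ _ _)/cid G i j : exists g : (plane R -> R) * (plane R -> R), (i + j <= k)%N ->
    (L2 g.1 /\ L2 g.2) /\ forall phi, test setT phi ->
    (-1) ^+ (i + j) * F (dpart i j phi) = pr g.1 phi +i* pr g.2 phi.
  have [ij|nij] := boolP (i + j <= k)%N; last by exists (0, 0).
  by have [g Lg Hg] := HF i j ij; exists g.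
pose h1 i j := (projT1 (G i j)).1; pose h2 i j := (projT1 (G i j)).2.
have HG i j : (i + j <= k)%N -> (L2 (h1 i j) /\ L2 (h2 i j)) /\ forall phi, test setT phi ->
    (-1) ^+ (i + j) * F (dpart i j phi) = pr (h1 i j) phi +i* pr (h2 i j) phi.
  exact: projT2 (G i j).
have [[L1 L2'] F0] := HG 0%N 0%N (leq0n _).
have {}F0 phi : test setT phi -> F phi = pr (h1 0%N 0%N) phi +i* pr (h2 0%N 0%N) phi.
  by move=> tp; rewrite -(F0 _ tp) mul1r.
exists (h1 0%N 0%N), (h2 0%N 0%N); split.
- apply: (@L2_derivatives_Wk _ _ h1); split=> // i j /HG[[? _] Hij]; split=> // phi tp.
  have := Hij _ tp; rewrite (F0 _ (test_dpart i j tp)) complex_sign.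
  by case.
- apply: (@L2_derivatives_Wk _ _ h2); split=> // i j /HG[[_ ?] Hij]; split=> // phi tp.
  have := Hij _ tp; rewrite (F0 _ (test_dpart i j tp)) complex_sign.
  by case.
- apply: (distribution_eq dF (Fun_distribution L1 L2')) => phi tp.
  by rewrite F0// (FunE _ _ tp).
Qed.

Definition rep k U f := exists u1 u2, [/\ Wk k setT u1, Wk k setT u2 &
  forall phi, test U phi -> f phi = pr u1 phi +i* pr u2 phi].

Lemma SobolevP k U f : Sobolev k U f <-> distribution U f /\ rep k U f.
Proof.
split=> [[df [F SF Ef]]|[df [u1 [u2 [W1 W2 H]]]]].
  split=> //; have [u1 [u2 [W1 W2 E]]] := Sobolev_planeP SF.
  by exists u1, u2; split=> // phi tp; rewrite -Ef resE// E (FunE _ _ tp).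
split=> //; exists (Fun u1 u2); first exact: Sobolev_plane_Fun.
have dF := Fun_distribution (Wk_L2 W1) (Wk_L2 W2).
apply: (distribution_eq (distribution_res (@subsetT _ U) dF) df) => phi tp.
by rewrite resE// (FunE _ _ tp) H.
Qed.

Lemma rep_sub k U V f g : V `<=` U -> (forall phi, test V phi -> g phi = f phi) -> rep k U f -> rep k V g.
Proof.
move=> VU fg [u1 [u2 [W1 W2 H]]]; exists u1, u2; split=> // phi tp.
by rewrite fg// H//; exact: test_sub tp.
Qed.

Lemma Sobolev_res k U V f : V `<=` U -> Sobolev k U f -> Sobolev k V (res V f).
Proof.
move=> VU /SobolevP[df rf]; apply/SobolevP; split; first exact: distribution_res df.
by apply: rep_sub rf => // phi tp; rewrite resE.
Qed.

(** All that gluing by a partition of unity uses of a distribution; it holds for real and imaginary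
    parts separately. *)
Definition additive_on U (f : (plane R -> R) -> R) :=
  f 0 = 0 /\ forall phi psi, test U phi -> test U psi -> f (phi + psi) = f phi + f psi.

Lemma bounded_closure_compact U : bounded_set U -> compact (closure U).
Proof.
move=> [r [_ Hr]].
have r0 : r < `|r| + 1 by rewrite (le_lt_trans (ler_norm _))// ltrDl.
have UD : U `<=` [set x | sqd 0 x <= (2 * (`|r| + 1)) ^+ 2].
  move=> x Kx; have := Hr _ r0 x Kx; rewrite /= [in X in X -> _]/Num.norm/= ge_max => /andP[H1 H2].
  rewrite /sqd/= !subr0 exprMn.
  have rr : 0 < (`|r| + 1) ^+ 2 by rewrite exprn_gt0// ltr_wpDl.
  have := le_sqr (normr_ge0 _) H1; have := le_sqr (normr_ge0 _) H2.
  rewrite !real_normK ?num_real//; move: rr; clear.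
  by move: (x.1 ^+ 2) (x.2 ^+ 2) ((`|r| + 1) ^+ 2) => a b c; rewrite expr2; lra.
apply: (compact_sub_closed (@compact_cdisc R 0 (2 * (`|r| + 1)))); first exact: closed_closure.
have cC : closed [set x : plane R | sqd 0 x <= (2 * (`|r| + 1)) ^+ 2].
  have /continuous_closedP/(_ [set s : R | s <= (2 * (`|r| + 1)) ^+ 2]) := @continuous_sqd R 0.
  by apply; exact: closed_le.
by rewrite [X in _ `<=` X](closure_id _).1//; exact: closure_subset.
Qed.

(** A family of sets and forms is glued into a single function, so that the two functions of the
    exact sequence can be treated together. The induction is on a finite cover of [K], which reaches
    the boundary of the [U i]: a representative on the plane is built, not just a local one. *)
Lemma glue_real k (I : Type) (U : I -> set (plane R)) (f : I -> (plane R -> R) -> R) (K : set (plane R)) :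
  compact K -> (forall i, U i `<=` K) -> (forall i, additive_on (U i) (f i)) ->
  (forall x, K x -> exists2 r, 0 < r & exists2 u, Wk k setT u &
     forall i phi, test (disc x r `&` U i) phi -> f i phi = pr u phi) ->
  exists2 u, Wk k setT u & forall i phi, test (U i) phi -> f i phi = pr u phi.
Proof.
move=> cK UK af loc.
have /(_ _)/cid H x : exists ru : R * (plane R -> R), K x -> [/\ 0 < ru.1, Wk k setT ru.2 &
    forall i phi, test (disc x ru.1 `&` U i) phi -> f i phi = pr ru.2 phi].
  have [Kx|nKx] := pselect (K x); last by exists (0, 0).
  by have [r r0 [u Wu Hu]] := loc x Kx; exists (r, u).
pose r x := (projT1 (H x)).1; pose u x := (projT1 (H x)).2.
have Hr x : K x -> [/\ 0 < r x, Wk k setT (u x) &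
    forall i phi, test (disc x (r x) `&` U i) phi -> f i phi = pr (u x) phi].
  exact: projT2 (H x).
have [|s [sK cov]] := @compact_discs R K (fun x => r x / 2) cK.
  by move=> x /Hr[r0 _ _]; rewrite divr_gt0.
suff [w Ww Hw] : exists2 w, Wk k setT w & forall i phi, test (U i) phi ->
    (forall y, supp phi y -> exists2 x, x \in s & disc x (r x / 2) y) -> f i phi = pr w phi.
  exists w => // i phi tp; apply: Hw => // y Hy; apply: cov; apply: (UK i).
  by case: tp => _ _; apply.
elim: s sK {cov} => [|x s IH] sK.
  exists 0; first exact: Wk0.
  move=> i phi tp cov; rewrite pr0l.
  rewrite (_ : phi = 0); first by case: (af i).
  by apply/funext => y; apply: supp_out => /cov[z]; rewrite in_nil.
have [|w Ww Hw] := IH; first by move=> y ys; apply: sK; rewrite inE ys orbT.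
have [r0 Wu Hu] := Hr x (sK x (mem_head _ _)).
set b := bump x (r x).
have tb : test setT b by apply: test_bump.
have sb := test_smooth tb.
have s1b : smooth (cst 1 - b) := smoothB (smooth_cst 1) sb.
have Wbu := WkM tb Wu; have Wbw := WkM tb Ww.
have [Lu Lw Lbu Lbw] := And4 (Wk_L2 Wu) (Wk_L2 Ww) (Wk_L2 Wbu) (Wk_L2 Wbw).
(* The local function where the bump is 1, the function already glued where it is 0. Moving the bump
   to the test side splits [phi] into a part near [x] and a part covered by the remaining discs. *)
exists (b * u x + (w - b * w)); first by apply: WkD => //; exact: WkB.
move=> i phi tp cov.
have t1 : test (U i) (b * phi) := testMl sb tp.
have t2 : test (U i) ((cst 1 - b) * phi) := testMl s1b tp.
have E : phi = b * phi + (cst 1 - b) * phi.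
  by apply/funext => y; rewrite !(addrfctE, mulrfctE, opprfctE) /cst/=; ring.
have E2 : phi = (cst 1 - b) * phi + b * phi by rewrite addrC -E.
rewrite {1}E; have [_ ->] := af i => //.
rewrite (Hu i); last first.
  rewrite setIC; apply: test_supp tp (test_smooth t1) _ => y Hy; split.
    by apply: (supp_mono _ Hy) => z Ez; have -> : (b * phi) z = b z * phi z by []; rewrite Ez mulr0.
  apply: (supp_bump_disc r0); apply: (supp_mono _ Hy) => z Ez.
  by have -> : (b * phi) z = b z * phi z by []; rewrite /b Ez mul0r.
rewrite (Hw i _ t2); last first.
  move=> y Hy.
  have : (supp phi `&` ~` disc x (r x / 2)) y.
    apply: (_ : supp ((cst 1 - b) * phi) `<=` _) y Hy; apply: supp_sub.
      by apply: closedI; [exact: closed_supp|exact: open_closedC (@open_disc _ _ _)].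
    move=> y; rewrite !(addrfctE, mulrfctE, opprfctE) /cst /= => N; split.
      by apply: contrapT => /supp_out Ey; rewrite Ey mulr0 eqxx in N.
    by move=> D; rewrite /b (bump1 r0 D) subrr mul0r eqxx in N.
  by case=> /cov[z]; rewrite inE => /orP[/eqP->//|zs D _]; exists z.
have Lwb : L2 (w - b * w) by exact: Wk_L2 (WkB Ww Wbw).
rewrite (prDl_test Lbu Lwb tp) pr_mulC; congr (_ + _).
rewrite (prBl_test Lw Lbw tp) pr_mulC.
by have := prD_test Lw t2 t1; rewrite -E2 => ->; rewrite addrK.
Qed.

Lemma distribution_additive U f : distribution U f -> additive_on U (fun phi => complex.Re (f phi)) /\
  additive_on U (fun phi => complex.Im (f phi)).
Proof.
move=> [lf _ _].
have f0 : f 0 = 0.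
  have := lf (-1) 0 0 (test0 U) (test0 U).
  by rewrite scaler0 addr0 rmorphN1 mulN1r addNr.
have fD phi psi : test U phi -> test U psi -> f (phi + psi) = f phi + f psi.
  by move=> tp tq; rewrite -[phi in LHS]scale1r lf// mul1r.
by split; split; rewrite ?f0// => phi psi tp tq; rewrite fD// raddfD.
Qed.

Lemma glue k (I : Type) (U : I -> set (plane R)) (f : I -> functional) (K : set (plane R)) :
  compact K -> (forall i, U i `<=` K) -> (forall i, distribution (U i) (f i)) ->
  (forall x, K x -> exists2 r, 0 < r & exists u1 u2, [/\ Wk k setT u1, Wk k setT u2 &
     forall i phi, test (disc x r `&` U i) phi -> f i phi = pr u1 phi +i* pr u2 phi]) ->
  exists u1 u2, [/\ Wk k setT u1, Wk k setT u2 &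
     forall i phi, test (U i) phi -> f i phi = pr u1 phi +i* pr u2 phi].
Proof.
move=> cK UK df loc.
have [u1 W1 H1] := @glue_real k I U (fun i phi => complex.Re (f i phi)) K cK UK
  (fun i => (distribution_additive (df i)).1)
  (fun x Kx => let: ex_intro2 r r0 (ex_intro u1 (ex_intro u2 (And3 W1 W2 H))) := loc x Kx in
     ex_intro2 _ _ r r0 (ex_intro2 _ _ u1 W1 (fun i phi tp => congr1 (@complex.Re R) (H i phi tp)))).
have [u2 W2 H2] := @glue_real k I U (fun i phi => complex.Im (f i phi)) K cK UK
  (fun i => (distribution_additive (df i)).2)
  (fun x Kx => let: ex_intro2 r r0 (ex_intro u1 (ex_intro u2 (And3 W1 W2 H))) := loc x Kx in
     ex_intro2 _ _ r r0 (ex_intro2 _ _ u2 W2 (fun i phi tp => congr1 (@complex.Im R) (H i phi tp)))).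
exists u1, u2; split=> // i phi tp; rewrite -(H1 i _ tp) -(H2 i _ tp).
by case: (f i phi).
Qed.

End SobolevFunctionals.

(** * Cutting and extending near a corner *)

Section Corner.
Context {R : realType}.
Implicit Types (u v w phi psi F G : plane R -> R) (x y p : plane R) (r : R) (U V O P S : set (plane R)).

Lemma van_mul S b u : smooth b -> van S u -> van S (b * u).
Proof. by move=> sb Hu phi tp; rewrite pr_mulC; apply: Hu; exact: testMl. Qed.

Lemma extend_sector k u (a b c a' b' c' : R) : a * b' - a' * b != 0 ->
  let P := affmap a b c a' b' c' @^-1` (right `|` upper) in
  Wk k P u -> exists w, Wk k setT w /\ forall phi, test P phi -> pr w phi = pr u phi.
Proof.
move=> D P Wu; have [i [j [l [i' [j' [l' [AB BA]]]]]]] := affmap_inv c c' D.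
have [K sA] := scales_aff c c' D.
set A := affmap a b c a' b' c' in AB BA sA P Wu *; set B := affmap i j l i' j' l' in AB BA.
have cA : continuous A := @continuous_affmap _ _ _ _ _ _ _.
have cB : continuous B := @continuous_affmap _ _ _ _ _ _ _.
(* Evaluating the identity of the composite at three points gives the matrix relations, so the two
   determinants have product 1. *)
have D' : i * j' - i' * j != 0.
  have BA0 := BA 0; have BA1 := BA (1, 0); have BA2 := BA (0, 1).
  move: BA0 BA1 BA2; rewrite /A /B /affmap /= !mulr0 !mulr1 !add0r !addr0.
  move=> [E1 E2] [E3 E4] [E5 E6].
  have F1 : a * i + b * i' = 1 by rewrite -[RHS]subr0 -E3 -[X in _ - X]E1; ring.
  have F2 : a' * i + b' * i' = 0 by rewrite -[RHS](subrr 0) -[X in X - _]E4 -[X in _ - X]E2; ring.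
  have F3 : a * j + b * j' = 0 by rewrite -[RHS](subrr 0) -[X in X - _]E5 -[X in _ - X]E1; ring.
  have F4 : a' * j + b' * j' = 1 by rewrite -[RHS]subr0 -E6 -[X in _ - X]E2; ring.
  have : (a * b' - a' * b) * (i * j' - i' * j) = 1.
    transitivity ((a * i + b * i') * (a' * j + b' * j') - (a' * i + b' * i') * (a * j + b * j')); first ring.
    by rewrite F1 F2 F3 F4 mulr1 mul0r subr0.
  by apply: contra_eqN => /eqP ->; rewrite mulr0 eq_sym oner_eq0.
have PE : B @^-1` P = right `|` upper.
  apply/funext => x; have -> : (B @^-1` P) x = (right `|` upper) (A (B x)) by [].
  by rewrite BA.
have Wu' := Wk_aff l l' D' Wu; rewrite -/B PE in Wu'.
have [w' [Ww' Hw']] := extend_quadrant Wu'.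
have Ww := Wk_aff c c' D Ww'; rewrite -/A in Ww.
exists (w' \o A); split; first by apply: Wk_sub Ww.
move=> phi tp.
have tpB : test (right `|` upper) (phi \o B).
  by rewrite -PE; apply: (test_comp cB cA BA _ tp); exact: smooth_aff.
have [M [r bp]] := test_bmc tpB.
have E1 := pr_scales sA (Wk_L2 Ww') bp; have E2 := pr_scales sA (Wk_L2 Wu') bp.
have EB (g : plane R -> R) : (g \o B) \o A = g by apply/funext => x /=; rewrite AB.
by rewrite !EB in E1 E2; rewrite E1 E2 (Hw' _ tpB).
Qed.

(** [O] is one side of the cut, and the cut runs inside [U ∩ V]. The cut difference vanishes on [U]
    and equals F - G on [V] near [p]; subtracting its extension from [F] therefore leaves F on [U]
    and turns F into G on [V]. *)
Lemma glue_corner k U V O F G p r0 (a b c a' b' c' : R) :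
  a * b' - a' * b != 0 ->
  let P := affmap a b c a' b' c' @^-1` (right `|` upper) in
  0 < r0 -> open O -> Wk k setT F -> Wk k setT G -> van (U `&` V) (F - G) ->
  (forall y, disc p r0 y -> P y -> exists2 r, 0 < r &
     [\/ disc y r `<=` O, (forall z, disc y r z -> ~ O z) | disc y r `<=` U `&` V]) ->
  (forall y, disc p r0 y -> U y -> P y /\ exists2 r, 0 < r &
     (forall z, disc y r z -> ~ O z) \/ disc y r `<=` U `&` V) ->
  (forall y, disc p r0 y -> V y -> P y /\ exists2 r, 0 < r &
     disc y r `<=` O \/ disc y r `<=` U `&` V) ->
  exists2 r, 0 < r & exists2 w, Wk k setT w &
    (forall phi, test (disc p r `&` U) phi -> pr w phi = pr F phi) /\
    (forall phi, test (disc p r `&` V) phi -> pr w phi = pr G phi).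
Proof.
move=> D P r00 oO WF WG vFG HP HU HV.
(* The geometry is known only in [disc p r0] while [P] is unbounded: the bump makes the difference
   vanish elsewhere. It equals 1 on the disc of radius [r0 / 2], where the conclusion is drawn. *)
set bb := bump p r0.
have tb : test setT bb by apply: test_bump.
have sb := test_smooth tb.
pose E := bb * (F - G).
have WE : Wk k setT E by apply: WkM tb _; exact: WkB.
have LE := Wk_L2 WE; have [LF LG] := (Wk_L2 WF, Wk_L2 WG).
have vE : van (U `&` V) E := van_mul sb vFG.
have Wv : Wk k P (\1_O * E).
  apply: Wk_cut => // x Px.
  have [Dx|nDx] := pselect (disc p r0 x).
    have [r rr H] := HP _ Dx Px; exists r => //.
    by case: H => [?|?|H]; [exact: Or31|exact: Or32|apply: Or33; exact: van_sub H vE].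
  have /= N : nbhs x (~` supp bb).
    apply: open_nbhs_nbhs; split; first exact: closed_openC (@closed_supp _ _).
    by move=> /(supp_bump_disc r00).
  have [r rr Hr] := disc_nbhs N; exists r => //; apply: Or33 => phi tp.
  rewrite -(pr0 E); apply: eq_pr => y; have -> : (0 : plane R -> R) y = 0 by [].
  have [Sy|/supp_out ->] := pselect (supp phi y); last by rewrite !mulr0.
  have -> : E y = bb y * (F - G) y by [].
  rewrite (supp_out (phi := bb) (x := y)) ?mul0r ?mulr0//; apply: Hr.
  by case: tp => _ _; apply.
have [w [Ww Hw]] := extend_sector D Wv.
have Lw := Wk_L2 Ww; have Lv := Wk_L2 Wv.
exists (r0 / 2); first by rewrite divr_gt0.
have D2 : disc p (r0 / 2) `<=` disc p r0 by apply: subset_disc; lra.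
exists (F - w); first exact: WkB.
have tsub (Q Q' : set (plane R)) phi : test Q phi -> supp phi `<=` Q' -> test Q' phi.
  by move=> [? ? _].
split=> phi tp.
- rewrite (prBl_test LF Lw tp) Hw; last first.
    by apply: test_sub tp => y [/D2 Dy Uy]; have [] := HU y Dy Uy.
  suff -> : pr (\1_O * E) phi = 0 by rewrite subr0.
  rewrite -(pr0l phi).
  apply: (pr_local Lv (@L20 R) _ tp) => y [/D2 Dy Uy].
  have [_ [r rr H]] := HU y Dy Uy; exists r => // psi tq sq; rewrite pr0l.
  case: H => H; first by apply: indic_out => z /sq; exact: H.
  exact: (pr_indic oO LE (van_sub H vE) (tsub _ _ _ tq sq)).
- rewrite (prBl_test LF Lw tp) Hw; last first.
    by apply: test_sub tp => y [/D2 Dy Vy]; have [] := HV y Dy Vy.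
  rewrite (_ : pr (\1_O * E) phi = pr (F - G) phi).
    by rewrite (prBl_test LF LG tp) opprB addrC subrK.
  transitivity (pr E phi).
    apply: (pr_local Lv LE _ tp) => y [/D2 Dy Vy].
    have [_ [r rr H]] := HV y Dy Vy; exists r => // psi tq sq.
    case: H => H; first by apply: indic_in; exact: subset_trans H.
    have td := tsub _ _ _ tq sq; have vD := van_sub H vE.
    by rewrite (pr_indic oO LE vD td) vD.
  apply: eq_pr => y; have [Sy|/supp_out ->] := pselect (supp phi y); last by rewrite !mulr0.
  have -> : E y = bb y * (F - G) y by [].
  by rewrite /bb bump1 ?mul1r//; case: tp => _ _ /(_ _ Sy)[].
Qed.

End Corner.

(** * Polar coordinates and arcs *)

Section Polar.
Context {R : realType}.
Implicit Types (x y p : plane R) (r t s th : R) (n : int) (U V O : set (plane R)) (X Y : set R).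

Definition tau : R := 2 * pi.

Lemma tau_gt0 : 0 < tau. Proof. by rewrite mulr_gt0// pi_gt0. Qed.

(** The recurrent means of identifying two lifts of an angle: show that they differ by less than a
    full turn. *)
Lemma tau_small n : - tau < n%:~R * tau < tau -> n = 0.
Proof.
have t0 := tau_gt0; move=> /andP[H1 H2].
have : (-1 : int)%:~R < n%:~R :> R by rewrite -(ltr_pM2r t0) mulN1r.
have : n%:~R < (1 : int)%:~R :> R by rewrite -(ltr_pM2r t0) mul1r.
by rewrite !ltr_int; case: n {H1 H2} => [[|[|k]]|[|k]].
Qed.

Lemma cos_tau n th : cos (th + n%:~R * tau) = cos th.
Proof.
have H (k : nat) u : cos (u + k%:R * tau) = cos u.
  have -> : k%:R * tau = pi *+ 2 *+ k by rewrite mulr_natl /tau mulr_natl.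
  exact: (periodicn (@cosD2pi R)).
case: n => k; first exact: H.
by rewrite -[in RHS](subrK (k.+1%:R * tau) th) H NegzE mulrNz mulNr.
Qed.

Lemma sin_tau n th : sin (th + n%:~R * tau) = sin th.
Proof.
have H (k : nat) u : sin (u + k%:R * tau) = sin u.
  have -> : k%:R * tau = pi *+ 2 *+ k by rewrite mulr_natl /tau mulr_natl.
  exact: (periodicn (@sinD2pi R)).
case: n => k; first exact: H.
by rewrite -[in RHS](subrK (k.+1%:R * tau) th) H NegzE mulrNz mulNr.
Qed.

Lemma tau_shift q th : exists n, q <= th + n%:~R * tau < q + tau.
Proof.
have t0 := tau_gt0.
exists (- Num.floor ((th - q) / tau)); have /andP[H1 H2] := floor_itv ((th - q) / tau).
rewrite mulrNz mulNr; move: H1 H2; move: (Num.floor _) => m.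
rewrite ler_pdivlMr// ltr_pdivrMr// rmorphD/= mulrDl mul1r => H1 H2.
by apply/andP; split; lra.
Qed.

Lemma cos_eq1 th : cos th = 1 -> exists n, th = n%:~R * tau.
Proof.
move=> c1; have [n /andP[H1 H2]] := tau_shift 0 th; exists (- n).
have p0 := pi_gt0 R.
have {}c1 : cos (th + n%:~R * tau) = cos 0 by rewrite cos_tau cos0.
suff E : th + n%:~R * tau = 0 by rewrite mulrNz mulNr; apply/eqP; rewrite -addr_eq0 E.
have [le|lt] := leP (th + n%:~R * tau) pi.
  by apply: cos_inj c1; rewrite in_itv/= ?lexx ?H1 ?le ?ltW.
have E : tau - (th + n%:~R * tau) = 0.
  have tE : tau = 2 * pi by [].
  have I0 : (0 : R) \in `[0, pi] by rewrite in_itv/= lexx ltW.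
  move: c1 H1 H2 lt; move: (th + n%:~R * tau) => u c1 H1 H2 lt.
  have I1 : tau - u \in `[0, pi] by rewrite in_itv/=; apply/andP; split; lra.
  apply: (cos_inj I1 I0); rewrite -c1 -[RHS]cosN -(cos_tau 1 (- u)); congr cos.
  by rewrite mul1r addrC.
by exfalso; move: H2 E; move: (th + n%:~R * tau) => u H2 E; lra.
Qed.

Lemma sqd_polar p t th : sqd p (polar p t th) = t ^+ 2.
Proof.
rewrite /sqd /polar/= -[RHS]mulr1 -(cos2Dsin2 th); ring.
Qed.

Lemma disc_polar p r t th : 0 < t -> 0 < r -> disc p r (polar p t th) <-> t < r.
Proof.
move=> t0 r0; rewrite discE sqd_polar; split=> H.
  by rewrite -(ltr_pXn2r (n := 2))// nnegrE ltW.
by rewrite ltr_pXn2r// nnegrE ltW.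
Qed.

Lemma polar_tau p t th n : polar p t (th + n%:~R * tau) = polar p t th.
Proof. by rewrite /polar cos_tau sin_tau. Qed.

Lemma polar_inj p t s a b : 0 < t -> 0 < s -> polar p t a = polar p s b ->
  t = s /\ exists n, a = b + n%:~R * tau.
Proof.
move=> t0 s0 E.
have ts : t = s.
  have := sqd_polar p t a; rewrite E sqd_polar => /eqP.
  by rewrite eqrXn2 ?ltW// => /eqP.
subst s; split=> //.
move: E => [/addrI/(mulfI (lt0r_neq0 t0)) E1 /addrI/(mulfI (lt0r_neq0 t0)) E2].
have [|n E] := @cos_eq1 (a - b); first by rewrite cosB E1 E2 -!expr2 cos2Dsin2.
by exists n; rewrite -E addrC subrK.
Qed.

Lemma polar_neq p t th : 0 < t -> polar p t th <> p.
Proof.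
move=> t0 E; have := sqd_polar p t th; rewrite E /sqd !subrr expr0n addr0 => /esym/eqP.
by rewrite sqrf_eq0 gt_eqF.
Qed.

Lemma circle_angle (c s : R) : c ^+ 2 + s ^+ 2 = 1 -> exists th, cos th = c /\ sin th = s.
Proof.
move=> E; have c1 : -1 <= c <= 1.
  by rewrite -ler_norml -(ler_pXn2r (n := 2)) ?nnegrE// real_normK ?num_real// expr1n -E lerDl sqr_ge0.
have ca : cos (acos c) = c by apply: acosK; rewrite in_itv.
have sa : sin (acos c) = `|s|.
  by rewrite sin_acos// -E addrAC subrr add0r sqrtr_sqr.
have [s0|s0] := leP 0 s; first by exists (acos c); rewrite sa ger0_norm.
by exists (- acos c); rewrite cosN sinN sa ltr0_norm// opprK.
Qed.

Lemma polar_surj q p y : y <> p -> exists t th, [/\ 0 < t, q <= th < q + tau & y = polar p t th].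
Proof.
move=> yp; have s0 : 0 < sqd p y.
  rewrite lt0r sqd_ge0 andbT; apply/eqP => /eqP; rewrite /sqd paddr_eq0 ?sqr_ge0// !sqrf_eq0 !subr_eq0.
  by move=> /andP[/eqP E1 /eqP E2]; apply: yp; case: y p E1 E2 => ? ? [? ?] /= -> ->.
pose t := Num.sqrt (sqd p y).
have t0 : 0 < t by rewrite sqrtr_gt0.
have t2 : t ^+ 2 = sqd p y by rewrite sqr_sqrtr// ltW.
have [|th [H1 H2]] := @circle_angle ((y.1 - p.1) / t) ((y.2 - p.2) / t).
  by rewrite !expr_div_n -mulrDl -[_ + _]/(sqd p y) -t2 divff// sqrf_eq0 gt_eqF.
have [n Hn] := tau_shift q th; exists t, (th + n%:~R * tau); split=> //.
rewrite polar_tau /polar H1 H2 ![t * _]mulrC !divfK ?gt_eqF// ![p.1 + _]addrC [p.2 + _]addrC !subrK.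
by case: (y).
Qed.

(** In coordinates turned by [th0] the point is (t0, 0) and the angle is the arctangent of Y / X,
    continuous there since X is positive: no branch of the argument has to be chosen. *)
Lemma polar_near p t0 th0 (e : R) : 0 < t0 -> 0 < e -> exists2 r, 0 < r &
  forall y, disc (polar p t0 th0) r y ->
  exists t th, [/\ 0 < t, `|t - t0| < e, `|th - th0| < e & y = polar p t th].
Proof.
move=> t00 e0.
pose X (y : plane R) := cos th0 * y.1 + sin th0 * y.2 + (- (p.1 * cos th0 + p.2 * sin th0)).
pose Y (y : plane R) := (- sin th0) * y.1 + cos th0 * y.2 + (p.1 * sin th0 - p.2 * cos th0).
have cX : continuous X := @continuous_affine R _ _ _.
have cY : continuous Y := @continuous_affine R _ _ _.
set y0 := polar p t0 th0.
have cs := cos2Dsin2 th0.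
have X0 : X y0 = t0.
  rewrite /X /y0 /polar/= -[RHS]mulr1 -cs; ring.
have Y0 : Y y0 = 0 by rewrite /Y /y0 /polar/=; ring.
pose T y := Num.sqrt (X y ^+ 2 + Y y ^+ 2).
pose A y := atan (Y y / X y).
have cT : {for y0, continuous T}.
  apply: (@continuous_comp _ _ _ (fun y => X y ^+ 2 + Y y ^+ 2) Num.sqrt); last exact: sqrt_continuous.
  exact: (cvgD (cvgM (cX _) (cX _)) (cvgM (cY _) (cY _))).
have cA : {for y0, continuous A}.
  apply: (@continuous_comp _ _ _ (fun y => Y y / X y) atan); last exact: continuous_atan.
  apply: cvgM; first exact: cY.
  by apply: cvgV; [rewrite X0 gt_eqF|exact: cX].
have T0 : T y0 = t0 by rewrite /T X0 Y0 expr0n addr0 sqrtr_sqr gtr0_norm.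
have A0 : A y0 = 0 by rewrite /A Y0 mul0r atan0.
have N1 : \forall y \near y0, 0 < X y.
  have /cvgrPdist_lt/(_ _ t00) := cX y0; apply: filterS => y; rewrite X0 ltr_norml => /andP[_].
  by rewrite gtrBl.
have N2 : \forall y \near y0, `|T y0 - T y| < e by move/cvgrPdist_lt : cT; apply.
have N3 : \forall y \near y0, `|A y0 - A y| < e by move/cvgrPdist_lt : cA; apply.
have /disc_nbhs[r r0 Hr] : nbhs y0 [set y | [/\ 0 < X y, `|T y0 - T y| < e & `|A y0 - A y| < e]].
  by near=> y; split; near: y.
exists r => // y /Hr[H1 H2 H3].
exists (T y), (th0 + A y); split.
- by rewrite sqrtr_gt0 ltr_wpDr ?sqr_ge0// exprn_gt0.
- by rewrite distrC -T0.
- by rewrite addrC addKr -normrN -[X in `|X|]add0r -A0.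
- have TX : T y * cos (A y) = X y.
    rewrite /T /A cos_atan expr_div_n.
    rewrite (_ : X y ^+ 2 + Y y ^+ 2 = X y ^+ 2 * (1 + Y y ^+ 2 / X y ^+ 2)); last first.
      by field; rewrite gt_eqF.
    rewrite sqrtrM ?sqr_ge0// sqrtr_sqr gtr0_norm// mulfK//.
    by rewrite gt_eqF// sqrtr_gt0 ltr_wpDr// divr_ge0 ?sqr_ge0.
  have TY : T y * sin (A y) = Y y.
    have ca : cos (A y) != 0.
      by apply/eqP => E; move: TX; rewrite E mulr0 => /esym /eqP; rewrite gt_eqF.
    have := atanK (Y y / X y); rewrite -/(A y) /tan => /(congr1 (fun z => z * cos (A y))).
    rewrite divfK// => ->; rewrite mulrCA TX divfK// gt_eqF//.
  rewrite /polar cosD sinD.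
  have -> : T y * (cos th0 * cos (A y) - sin th0 * sin (A y)) = cos th0 * X y - sin th0 * Y y.
    by rewrite -TX -TY; ring.
  have -> : T y * (sin th0 * cos (A y) + cos th0 * sin (A y)) = sin th0 * X y + cos th0 * Y y.
    by rewrite -TX -TY; ring.
  case: (y) => y1 y2; rewrite /X /Y /=; apply/pair_equal_spec; split.
    transitivity (p.1 + (cos th0 ^+ 2 + sin th0 ^+ 2) * (y1 - p.1)); last ring.
    by rewrite cs mul1r addrC subrK.
  transitivity (p.2 + (cos th0 ^+ 2 + sin th0 ^+ 2) * (y2 - p.2)); last ring.
  by rewrite cs mul1r addrC subrK.
Unshelve. all: by end_near.
Qed.

End Polar.

(** * Arcs cut on small circles and the local types *)

Section Arcs.
Context {R : realType}.
Implicit Types (x y p : plane R) (r t s th a b : R) (n : int) (U V O D : set (plane R)) (X Y : set R).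
Local Notation tau := (@tau R).

(** An arc of the circle as a periodic set of angles. Since its length is less than a full turn, its
    two ends are distinct points of the circle outside it. *)
Definition arc X a b := [/\ a < b, b - a < tau & forall th, X th <-> exists n, a < th + n%:~R * tau < b].

Lemma arc_in Y a b c d th : arc Y a b -> c <= a -> b <= d -> d - c <= tau -> c < th < d ->
  (Y th <-> a < th < b).
Proof.
move=> [ab bt H] ca bd dc /andP[t1 t2]; split; last first.
  by move=> ?; apply/H; exists 0; rewrite mul0r addr0.
move=> /H[n /andP[H1 H2]].
have n0 : n = 0.
  apply: (@tau_small R); move: (n%:~R * tau) H1 H2 => z H1 H2; apply/andP; split; lra.
by move: H1 H2; rewrite n0 mul0r addr0 => -> ->.
Qed.

Lemma arc_endl X a b : arc X a b -> ~ X a.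
Proof.
move=> [ab bt H] /H[n /andP[H1 H2]].
have n0 : n = 0.
  by apply: (@tau_small R); move: (n%:~R * tau) H1 H2 => z H1 H2; apply/andP; split; have := @tau_gt0 R; lra.
by move: H1; rewrite n0 mul0r addr0 ltxx.
Qed.

Lemma arc_endr X a b : arc X a b -> ~ X b.
Proof.
move=> [ab bt H] /H[n /andP[H1 H2]].
have n0 : n = 0.
  by apply: (@tau_small R); move: (n%:~R * tau) H1 H2 => z H1 H2; apply/andP; split; have := @tau_gt0 R; lra.
by move: H2; rewrite n0 mul0r addr0 ltxx.
Qed.

Lemma arc_shift X a b n : arc X a b -> arc X (a + n%:~R * tau) (b + n%:~R * tau).
Proof.
move=> [ab bt H]; split; [by rewrite ltrD2r|by rewrite opprD addrACA subrr addr0|].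
move=> th; split=> [/H[m Hm]|[m Hm]].
  by exists (m + n); rewrite rmorphD/= mulrDl addrA !ltrD2r.
by apply/H; exists (m - n); rewrite rmorphB/= mulrBl addrA -(ltrD2r (n%:~R * tau)) subrK
  -[X in _ && X](ltrD2r (n%:~R * tau)) subrK.
Qed.

Lemma arc_mid X a b th : arc X a b -> a < th < b -> X th.
Proof. by move=> [_ _ H] ?; apply/H; exists 0; rewrite mul0r addr0. Qed.

(** The middle of the smaller arc fixes the lift. If that arc then stuck out, an end of the larger
    one would belong to the smaller, hence to the larger, which is open. *)
Lemma arc_sub X Y a b a' b' : arc X a b -> arc Y a' b' -> (forall th, Y th -> X th) ->
  exists n, a <= a' + n%:~R * tau /\ b' + n%:~R * tau <= b.
Proof.
move=> aX aY YX; have t0 := @tau_gt0 R.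
have [ab bt HX] := aX; have [ab' bt' HY] := aY.
have /YX/HX[n /andP[m1 m2]] : Y ((a' + b') / 2).
  by apply: (arc_mid aY); apply/andP; split; lra.
exists n; split; rewrite leNgt; apply/negP => lt.
- have /YX/HX[m /andP[k1 k2]] : Y (a - n%:~R * tau).
    apply: (arc_mid aY); move: (n%:~R * tau) m1 m2 lt => z m1 m2 lt; apply/andP; split; lra.
  have E : m - n = 0.
    apply: (@tau_small R); rewrite rmorphB/= mulrBl.
    move: (n%:~R * tau) (m%:~R * tau) k1 k2 {m1 m2 lt} => z w k1 k2; apply/andP; split; lra.
  by move/eqP: E k1; rewrite subr_eq0 => /eqP ->; rewrite subrK ltxx.
- have /YX/HX[m /andP[k1 k2]] : Y (b - n%:~R * tau).
    apply: (arc_mid aY); move: (n%:~R * tau) m1 m2 lt => z m1 m2 lt; apply/andP; split; lra.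
  have E : m - n = 0.
    apply: (@tau_small R); rewrite rmorphB/= mulrBl.
    move: (n%:~R * tau) (m%:~R * tau) k1 k2 {m1 m2 lt} => z w k1 k2; apply/andP; split; lra.
  by move/eqP: E k2; rewrite subr_eq0 => /eqP ->; rewrite subrK ltxx.
Qed.

Lemma arc_len X a b a' b' : arc X a b -> arc X a' b' -> b - a = b' - a'.
Proof.
move=> H1 H2.
have [n [h1 h2]] := arc_sub H1 H2 (fun _ => id); have [m [k1 k2]] := arc_sub H2 H1 (fun _ => id).
move: (n%:~R * tau) (m%:~R * tau) h1 h2 k1 k2 => z w h1 h2 k1 k2; lra.
Qed.

(** Both ends lie outside the arc, and they are not congruent modulo a full turn. This excludes type
    C5. *)
Lemma arc_not_puncture X a b c : arc X a b -> ~ (forall th, ~ X th -> exists n, th = c + n%:~R * tau).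
Proof.
move=> aX H; have [ab bt _] := aX; have t0 := @tau_gt0 R.
have [n En] := H _ (arc_endl aX); have [m Em] := H _ (arc_endr aX).
have E : m - n = 0.
  apply: (@tau_small R); rewrite rmorphB/= mulrBl.
  move: (n%:~R * tau) (m%:~R * tau) En Em => z w En Em; apply/andP; split; lra.
by move/eqP: E Em; rewrite subr_eq0 => /eqP -> Em; move: ab; rewrite En Em ltxx.
Qed.

(** Connectedness of an arc, which excludes type C6: two pieces of a disjoint union of arcs
    coincide. *)
Lemma arc_connected (I : Type) X (Y : I -> set R) a b (a_ b_ : I -> R) (i0 i1 : I) : arc X a b ->
  (forall i, arc (Y i) (a_ i) (b_ i)) -> (forall th, X th <-> exists i, Y i th) ->
  (forall i j th, Y i th -> Y j th -> i = j) -> i0 = i1.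
Proof.
move=> aX aY XY dY; have [ab bt _] := aX.
have [n [h1 h2]] := arc_sub aX (aY i0) (fun th H => (XY th).2 (ex_intro _ i0 H)).
have aY0 := arc_shift n (aY i0).
move: (a_ i0 + _) (b_ i0 + _) h1 h2 aY0 => c d h1 h2 aY0; have [cd _ _] := aY0.
(* an endpoint of one piece lies in another, open, piece *)
have cl : a < c -> False.
  move=> ac; have /XY[j Yj] : X c by apply: (arc_mid aX); rewrite ac (lt_le_trans cd).
  have [aj bj Hj] := aY j; have [m /andP[k1 k2]] := (Hj c).1 Yj.
  pose e := Num.min ((d - c) / 2) ((b_ j - (c + m%:~R * tau)) / 2).
  have e0 : 0 < e by rewrite lt_min !divr_gt0 ?subr_gt0.
  have e1 : e <= (d - c) / 2 by rewrite ge_min lexx.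
  have e2 : e <= (b_ j - (c + m%:~R * tau)) / 2 by rewrite ge_min lexx orbT.
  have Y0 : Y i0 (c + e) by apply: (arc_mid aY0); apply/andP; split; lra.
  have Yj' : Y j (c + e).
    by apply/Hj; exists m; move: (m%:~R * tau) k1 k2 e2 => z k1 k2 e2; apply/andP; split; lra.
  have ji := dY _ _ _ Yj' Y0; subst j; exact: (arc_endl aY0).
have cr : d < b -> False.
  move=> db; have /XY[j Yj] : X d by apply: (arc_mid aX); rewrite db (le_lt_trans h1).
  have [aj bj Hj] := aY j; have [m /andP[k1 k2]] := (Hj d).1 Yj.
  pose e := Num.min ((d - c) / 2) ((d + m%:~R * tau - a_ j) / 2).
  have e0 : 0 < e by rewrite lt_min !divr_gt0 ?subr_gt0.
  have e1 : e <= (d - c) / 2 by rewrite ge_min lexx.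
  have e2 : e <= (d + m%:~R * tau - a_ j) / 2 by rewrite ge_min lexx orbT.
  have Y0 : Y i0 (d - e) by apply: (arc_mid aY0); apply/andP; split; lra.
  have Yj' : Y j (d - e).
    by apply/Hj; exists m; move: (m%:~R * tau) k1 k2 e2 => z k1 k2 e2; apply/andP; split; lra.
  have ji := dY _ _ _ Yj' Y0; subst j; exact: (arc_endr aY0).
have ca : c = a by apply/eqP; rewrite eq_le h1 andbT leNgt; apply/negP.
have db : d = b by apply/eqP; rewrite eq_le h2 /= leNgt; apply/negP.
(* Piece [i0] now fills the whole arc, so it contains the middle of piece [i1]. *)
subst c d; have [a1 b1 H1] := aY i1.
have Y1 : Y i1 ((a_ i1 + b_ i1) / 2) by apply: (arc_mid (aY i1)); apply/andP; split; lra.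
apply: (dY _ _ _ _ Y1).
have [_ _ H0] := aY0; apply/H0; have [_ _ HX] := aX; apply/HX; apply/XY; by exists i1.
Qed.

Definition slice D p t : set R := [set th | D (polar p t th)].

Lemma slice_disc U p r t th : 0 < t < r -> slice (disc p r `&` U) p t th <-> slice U p t th.
Proof.
move=> /andP[t0 tr]; rewrite /slice/=; split; first by case.
by move=> H; split=> //; apply/disc_polar => //; exact: lt_trans tr.
Qed.

Variable A : ominimal R.

Lemma region_slice p r t (th1 th2 : R -> R) th : 0 < t < r ->
  slice (region p r th1 th2) p t th <-> exists n, th1 t < th + n%:~R * tau < th2 t.
Proof.
move=> /andP[t0 tr]; rewrite /slice /region/=; split.
  move=> [s [u [/andP[s0 sr] Hu E]]]; have [ts [n En]] := polar_inj t0 s0 E.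
  by exists (- n); rewrite En mulrNz mulNr addrK ts.
move=> [n Hn]; exists t, (th + n%:~R * tau); split=> //; first by rewrite t0.
by rewrite polar_tau.
Qed.

Lemma region_arc p r a (th1 th2 : R -> R) t : curve_pair A p r a th1 th2 -> 0 < t < r ->
  arc (slice (region p r th1 th2) p t) (th1 t) (th2 t).
Proof.
move=> [/andP[r0 ra] _ _ H] /andP[t0 tr].
have /andP[h1 h2] : 0 < th2 t - th1 t < 2 * pi by apply: H; rewrite t0 (lt_trans tr).
split; [by rewrite -subr_gt0|exact: h2|].
by move=> th; apply: region_slice; rewrite t0.
Qed.

Lemma eq_arc X Y a b : (forall th, X th <-> Y th) -> arc X a b -> arc Y a b.
Proof. by move=> XY [h1 h2 H]; split=> // th; rewrite -XY. Qed.

Lemma curve_continuous p a (th : R -> R) : curve A p a th -> th t @[t --> 0^'+] --> th 0 /\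
  forall t, 0 < t < a -> {for t, continuous th}.
Proof.
move=> [a0 cth _ _].
have sub b : 0 < b < a -> {within `[0, b], continuous th}.
  move=> /andP[b0 ba]; apply: continuous_subspaceW cth => t /=; rewrite !in_itv/= => /andP[-> tb].
  exact: le_lt_trans ba.
split.
  have h : 0 < a / 2 < a by apply/andP; split; lra.
  have /andP[h1 _] := h.
  by have /(continuous_within_itvP _ h1)[] := sub _ h.
move=> t /andP[t0 ta].
have h : 0 < (t + a) / 2 < a by apply/andP; split; lra.
have /andP[h1 _] := h.
have /(continuous_within_itvP _ h1)[H _ _] := sub _ h.
by apply: H; rewrite in_itv/=; apply/andP; split; lra.
Qed.

Lemma angle_cvg p r a (th1 th2 : R -> R) : curve_pair A p r a th1 th2 ->
  (th2 t - th1 t) @[t --> 0^'+] --> angle th1 th2 /\ angle th1 th2 = th2 0 - th1 0.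
Proof.
move=> [_ /curve_continuous[c1 _] /curve_continuous[c2 _] _].
have C : (th2 t - th1 t) @[t --> 0^'+] --> th2 0 - th1 0 by exact: cvgB.
have E : angle th1 th2 = th2 0 - th1 0 by exact: (cvg_lim (@Rhausdorff R) C).
by rewrite E; split.
Qed.

(** What types C2 and C3 have in common, stated on circles so that it concerns the germ of [U] at
    [p] and can be compared with a description of another type or radius. *)
Definition corner_arc U p := exists r a (th1 th2 : R -> R), [/\ curve_pair A p r a th1 th2, angle th1 th2 <> 2 * pi &
  forall t, 0 < t < r -> arc (slice U p t) (th1 t) (th2 t)].

Lemma cuspidal_corner U p : only_cuspidal A U -> boundary U p -> corner_arc U p.
Proof.
move=> cU bU; have [r [r0 H]] := cU p bU.
have key a (th1 th2 : R -> R) : curve_pair A p r a th1 th2 -> disc p r `&` U = region p r th1 th2 ->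
    forall t, 0 < t < r -> arc (slice U p t) (th1 t) (th2 t).
  move=> cp E t tr; apply: eq_arc (region_arc cp tr) => th; rewrite -E.
  exact: slice_disc.
case: H => -[a [th1 [th2 [cp al E]]]]; exists r, a, th1, th2; split=> //; try exact: key cp E.
- by case: al.
- by rewrite al => /eqP; rewrite eq_sym mulf_eq0 pnatr_eq0/= gt_eqF// pi_gt0.
Qed.

(** The length of an arc is determined by the set, so any two descriptions by curves have the same
    limit opening. This excludes type C4. *)
Lemma corner_angle U p r a (th1 th2 : R -> R) : corner_arc U p -> curve_pair A p r a th1 th2 ->
  (forall t, 0 < t < r -> arc (slice U p t) (th1 t) (th2 t)) -> angle th1 th2 <> 2 * pi.
Proof.
move=> [r' [a' [u1 [u2 [cp' al aU]]]]] cp aU'.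
suff -> : angle th1 th2 = angle u1 u2 by [].
have [C _] := angle_cvg cp; have [C' _] := angle_cvg cp'.
apply: (cvg_unique (@Rhausdorff R) C); apply: cvg_trans C'; apply: near_eq_cvg.
near=> t; apply: (@arc_len (slice U p t)).
- apply: aU; apply/andP; split; first by near: t; exact: nbhs_right_gt.
  by near: t; apply: nbhs_right_lt; case: cp' => /andP[].
- apply: aU'; apply/andP; split; first by near: t; exact: nbhs_right_gt.
  by near: t; apply: nbhs_right_lt; case: cp => /andP[].
Unshelve. all: by end_near.
Qed.

Lemma Fhat_C234_curves k p r D f : Fhat_C234 A k p r D f ->
  exists a (th1 th2 : R -> R), curve_pair A p r a th1 th2 /\ D = region p r th1 th2.
Proof.
case=> [[[|] [a [th1 [th2 [cp _ E]]]] _]|]; try by exists a, th1, th2.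
by move=> [_ [a [th1 [th2 [th3 [th4 [[cp _ E] _ _ _]]]]]]]; exists a, th1, th2.
Qed.

Lemma Fhat_Sobolev k U p r f : corner_arc U p -> 0 < r ->
  Fhat A k p r (disc p r `&` U) f -> Sobolev k (disc p r `&` U) f.
Proof.
move=> cU r0; have [r' [a' [u1 [u2 [cp' al aU]]]]] := cU.
have r'0 : 0 < r' by case: cp' => /andP[].
(* One circle, small enough for both descriptions, suffices against types C5 and C6; only type C4
   needs the limit at [p]. *)
pose t := Num.min r r' / 2.
have t0 : 0 < t by rewrite divr_gt0// lt_min r0.
have tr : t < r by rewrite /t ltr_pdivrMr// (le_lt_trans (_ : _ <= r))// ?ge_min ?lexx// ltr_pMr// ltr1n.
have tr' : t < r' by rewrite /t ltr_pdivrMr// (le_lt_trans (_ : _ <= r'))// ?ge_min ?lexx ?orbT// ltr_pMr// ltr1n.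
have ttr : 0 < t < r by rewrite t0.
have aD : arc (slice (disc p r `&` U) p t) (u1 t) (u2 t).
  apply: eq_arc (aU t _); last by rewrite t0.
  by move=> th; split=> /slice_disc; apply.
case=> [[[[_ //]|]|]|].
(* Types C2 and C3 carry membership in [Sobolev] by definition, as did C1. Type C4 would force the
   opening 2 pi. *)
- case=> [[_ //]|]; move=> [_ [a [th1 [th2 [th3 [th4 [[cp al2 E] _ _ _]]]]]]]; exfalso.
  apply: (corner_angle cU cp) al2 => s sr; apply: eq_arc (region_arc cp sr) => th; rewrite -E.
  exact: slice_disc.
(* Type C5: the circle meets the complement in a single point, unlike an arc. *)
- move=> [_ [a [th [th1 [th2 [[/andP[_ ra] cth E] _ _ _]]]]]]; exfalso.
  apply: (arc_not_puncture (c := th t) aD) => u; rewrite E /slice/= => H.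
  have : polar p t u \in [set polar p s (th s) | s in `[0, a[].
    rewrite inE; apply: contrapT => nH; apply: H; split=> //.
    by apply/disc_polar.
  rewrite inE => -[s]; rewrite /= in_itv/= => /andP[s0 sa] Es.
  have s1 : 0 < s.
    rewrite lt0r s0 andbT; apply/eqP => sz; apply: (@polar_neq _ p t u t0).
    by rewrite -Es sz /polar !mul0r !addr0; case: (p).
  have [st [n En]] := polar_inj t0 s1 (esym Es).
  by exists n; rewrite En st.
(* Type C6: each piece cuts an arc on the circle; the first two would have to coincide. *)
- move=> [_ [n [V [n1 tV E HV]]]]; exfalso.
  have /all_sig[a Ha] i := cid (Fhat_C234_curves (HV i)).
  have /all_sig[v1 H1] : forall i, {v1 | exists th2 : R -> R, curve_pair A p r (a i) v1 th2 /\ V i = region p r v1 th2}.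
    by move=> i; have [v H] := cid (Ha i); exists v.
  have /all_sig[v2 H2] : forall i, {v2 | curve_pair A p r (a i) (v1 i) v2 /\ V i = region p r (v1 i) v2}.
    by move=> i; have [v H] := cid (H1 i); exists v.
  have aV i : arc (slice (V i) p t) (v1 i t) (v2 i t).
    by have [cp ->] := H2 i; exact: region_arc cp ttr.
  have n0 : (0 < n)%N by exact: ltnW.
  have : Ordinal n0 = Ordinal n1.
    apply: (arc_connected (Y := fun i => slice (V i) p t) _ _ aD aV).
    - by move=> th; rewrite E /slice/=; split=> [[i _ ?]|[i ?]]; exists i.
    - by move=> i j th Vi Vj; apply: tV => //; exists (polar p t th).
  by case.
Qed.

End Arcs.

(** * Germs of definable sets *)

Section Tame.
Context {R : realType} (A : ominimal R).
Implicit Types (p : plane R) (U V : set (plane R)).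

Lemma definable_eq n (S T : set 'rV[R]_n) : A n S -> (forall v, S v <-> T v) -> A n T.
Proof. by move=> dS ST; have <- : S = T by apply/seteqP; split=> v /ST. Qed.

Lemma definableI n (S T : set 'rV[R]_n) : A n S -> A n T -> A n (S `&` T).
Proof.
by move=> dS dT; rewrite -[S]setCK -[T]setCK -setCU; apply/omin_setC/omin_setU; exact: omin_setC.
Qed.

Lemma definable_bigcap (I : eqType) (s : seq I) n (S : I -> set 'rV[R]_n) :
  (forall i, A n (S i)) -> A n [set v | forall i, i \in s -> S i v].
Proof.
move=> dS; elim: s => [|i s IH].
  by rewrite (_ : [set _ | _] = setT); [exact: omin_setT|apply/seteqP; split].
rewrite (_ : [set _ | _] = S i `&` [set v | forall j, j \in s -> S j v]); first exact: definableI.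
apply/seteqP; split=> v /=.
  by move=> H; split=> [|j js]; apply: H; rewrite in_cons ?eqxx// js orbT.
by move=> [Sv H] j; rewrite in_cons => /orP[/eqP ->|/H].
Qed.

(** New coordinates are adjoined, equated to the chosen old ones by diagonals, and projected away.
    This makes the atomic formulas available in any variables, repeated or permuted. *)
Lemma definable_subst m n (s : 'I_m -> 'I_n) (S : set 'rV[R]_m) :
  A m S -> A n [set v | S (\row_j v 0 (s j))].
Proof.
move=> dS; pose B j : set 'rV[R]_(n + m) := [set w | w 0 (rshift n j) = w 0 (lshift m (s j))].
have dT : A (n + m)%N ([set w | setT (lsubmx w) /\ S (rsubmx w)] `&`
    [set w | forall j, j \in enum 'I_m -> B j w]).
  apply: definableI; first exact: omin_prod (omin_setT _ _) dS.
  by apply: definable_bigcap => j; exact: omin_diag.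
apply: (definable_eq (omin_proj dT)) => v; split; last first.
  move=> /= Sv; exists (row_mx v (\row_j v 0 (s j))); last by rewrite row_mxKl.
  split=> /=; first by rewrite row_mxKr.
  by move=> j _; rewrite /B/= row_mxEr row_mxEl mxE.
move=> [w [[_ Sw] Bw] <-] /=; rewrite (_ : \row_j _ = rsubmx w)//.
by apply/rowP => j; rewrite !mxE; have := Bw j; rewrite /B/= => -> //; rewrite mem_enum.
Qed.

Lemma definable_add n (i j k : 'I_n) : A n [set v | v 0 i + v 0 j = v 0 k].
Proof.
have := definable_subst (fun l => nth i [:: i; j; k] l) (omin_add A).
by move=> /definable_eq; apply=> v /=; rewrite !mxE.
Qed.

Lemma definable_mul n (i j k : 'I_n) : A n [set v | v 0 i * v 0 j = v 0 k].
Proof.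
have := definable_subst (fun l => nth i [:: i; j; k] l) (omin_mul A).
by move=> /definable_eq; apply=> v /=; rewrite !mxE.
Qed.

Lemma definable_const n (i : 'I_n) (c : R) : A n [set v | v 0 i = c].
Proof.
have d1 : A 1%N [set v | v 0 0 = c].
  apply/omin_tame; exists [:: `[c, c]%R]; apply/seteqP; split=> v /=.
    by move=> ->; rewrite in_itv/= lexx.
  by rewrite orbF in_itv/= => /andP[h1 h2]; apply/eqP; rewrite eq_le h1 h2.
have := definable_subst (fun=> i) d1.
by move=> /definable_eq; apply=> v /=; rewrite !mxE.
Qed.

Lemma definable_plane n (i j : 'I_n) U : definable2 A U -> A n [set v | U (v 0 i, v 0 j)].
Proof.
move=> dU; have := definable_subst (fun l => nth i [:: i; j] l) dU.
by move=> /definable_eq; apply=> v /=; rewrite !mxE.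
Qed.

Lemma interval_germ (I : interval R) : exists2 e : R, 0 < e &
  (forall t, 0 < t < e -> t \in I) \/ (forall t, 0 < t < e -> t \notin I).
Proof.
case: I => a b.
have [e1 e10 H1] : exists2 e : R, 0 < e & (forall t, 0 < t < e -> (a <= BLeft t)%O) \/
    (forall t, 0 < t < e -> ~~ (a <= BLeft t)%O).
  case: a => [c x|c]; last by case: c; exists 1 => //; [left|right].
  have [x0|x0] := leP x 0.
    exists 1 => //; left=> t /andP[t0 _]; have xt := le_lt_trans x0 t0.
    by case: c; rewrite bnd_simp// ltW.
  exists x => //; right=> t /andP[_ tx].
  by case: c; rewrite bnd_simp -?leNgt -?ltNge// ltW.
have [e2 e20 H2] : exists2 e : R, 0 < e & (forall t, 0 < t < e -> (BRight t <= b)%O) \/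
    (forall t, 0 < t < e -> ~~ (BRight t <= b)%O).
  case: b => [c x|c]; last by case: c; exists 1 => //; [right|left].
  have [x0|x0] := leP x 0.
    exists 1 => //; right=> t /andP[t0 _]; have xt := le_lt_trans x0 t0.
    by case: c; rewrite bnd_simp -?leNgt -?ltNge// ltW.
  exists x => //; left=> t /andP[_ tx].
  by case: c; rewrite bnd_simp// ltW.
exists (Num.min e1 e2); first by rewrite lt_min e10.
case: H1 => H1; last first.
  by right=> t; rewrite lt_min => /and3P[t0 t1 _]; rewrite itv_boundlr negb_and H1// t0.
case: H2 => H2; last first.
  by right=> t; rewrite lt_min => /and3P[t0 _ t2]; rewrite itv_boundlr negb_and (H2 t) ?orbT// t0.
by left=> t; rewrite lt_min => /and3P[t0 t1 t2]; rewrite itv_boundlr H1 ?H2// t0.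
Qed.

(** A finite union of intervals does not oscillate at 0: membership is constant on the right of
    0. *)
Lemma tame_germ (S : set R) : A 1%N [set v | S (v 0 0)] -> exists2 e : R, 0 < e &
  (forall t, 0 < t < e -> S t) \/ (forall t, 0 < t < e -> ~ S t).
Proof.
move=> /omin_tame[s E].
have {E}E t : S t <-> has (fun I => t \in I) s.
  have : [set v : 'rV[R]_1 | S (v 0 0)] (const_mx t) <-> has (fun I => t \in I) s by rewrite E /= mxE.
  by rewrite /= mxE.
suff [e e0 H] : exists2 e : R, 0 < e & (forall t, 0 < t < e -> has (fun I => t \in I) s) \/
    (forall t, 0 < t < e -> ~~ has (fun I => t \in I) s).
  exists e => //; case: H => H; [left|right] => t /H; first by move/E.
  by move=> /negP N /E.
elim: s {E} => [|I s [e1 e10 IH]]; first by exists 1 => //; right.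
have [e2 e20 HI] := interval_germ I.
exists (Num.min e1 e2); first by rewrite lt_min e10.
case: IH => [H|H1]; first by left=> t; rewrite lt_min => /and3P[t0 t1 t2] /=; rewrite H ?orbT// t0.
case: HI => [H|H2]; first by left=> t; rewrite lt_min => /and3P[t0 t1 t2] /=; rewrite H// t0.
right=> t; rewrite lt_min => /and3P[t0 t1 t2] /=; rewrite negb_or H1 ?t0// H2// t0 //.
Qed.

(** The set of radii whose circle meets V minus U is definable in the line, being a projection, so
    [tame_germ] decides it for all small radii at once. *)
Lemma sphere_germ U V p : definable2 A U -> definable2 A V -> exists2 e : R, 0 < e &
  (forall t, 0 < t < e -> exists th, V (polar p t th) /\ ~ U (polar p t th)) \/
  (forall t, 0 < t < e -> forall th, V (polar p t th) -> U (polar p t th)).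
Proof.
(* The ten variables are t, x, y, x^2, y^2, t^2, the two coordinates of a point q, and those of [p],
   where (x, y) = q - p. The auxiliary ones reduce the condition to single sums and products; all
   but t are projected away. *)
move=> dU dV; pose c k : 'I_(1 + 9) := inord k.
pose B : set 'rV[R]_(1 + 9) := [set w | w 0 (c 1) * w 0 (c 1) = w 0 (c 3)] `&`
  [set w | w 0 (c 2) * w 0 (c 2) = w 0 (c 4)] `&` [set w | w 0 (c 0) * w 0 (c 0) = w 0 (c 5)] `&`
  [set w | w 0 (c 3) + w 0 (c 4) = w 0 (c 5)] `&` [set w | w 0 (c 8) = p.1] `&`
  [set w | w 0 (c 9) = p.2] `&` [set w | w 0 (c 8) + w 0 (c 1) = w 0 (c 6)] `&`
  [set w | w 0 (c 9) + w 0 (c 2) = w 0 (c 7)] `&` [set w | V (w 0 (c 6), w 0 (c 7))] `&`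
  ~` [set w | U (w 0 (c 6), w 0 (c 7))].
have dB : A (1 + 9)%N B.
  by rewrite /B; do !apply: definableI; try exact: definable_mul; try exact: definable_add;
    try exact: definable_const; try exact: definable_plane; apply: omin_setC; exact: definable_plane.
have c0 : lshift 9 0 = c 0 by apply: val_inj; rewrite /= inordK.
pose S t := exists q, [/\ sqd p q = t ^+ 2, V q & ~ U q].
have dS : A 1%N [set v | S (v 0 0)].
  apply: (definable_eq (omin_proj dB)) => v /=; split; last first.
    move=> [[q1 q2] [/= E Vq nUq]]; pose t := v 0 0; pose x := q1 - p.1; pose y := q2 - p.2.
    pose l := [:: t; x; y; x * x; y * y; t * t; q1; q2; p.1; p.2].
    pose w : 'rV[R]_(1 + 9) := \row_j nth 0 l j.
    have wE k : (k < 10)%N -> w 0 (c k) = nth 0 l k.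
      by move=> k10; rewrite mxE inordK.
    exists w; last by apply/rowP => j; rewrite mxE (ord1 j) c0 wE.
    rewrite /B/= !wE //=.
    do !split=> //; rewrite /x /y; try ring.
  move=> [w [[[[[[[[[H1 H2] H3] H4] H5] H6] H7] H8] H9] H10] <-]; rewrite /= in H1 H2 H3 H4 H5 H6 H7 H8 H9 H10.
  exists (w 0 (c 6), w 0 (c 7)); split=> //.
  have -> : lsubmx w 0 0 = w 0 (c 0) by rewrite mxE c0.
  by rewrite /sqd/= -H7 -H8 H5 H6 [RHS]expr2 H3 -H4 -H1 -H2; ring.
have [e e0 H] := tame_germ dS; exists e => //.
have HS t : 0 < t -> S t <-> exists th, V (polar p t th) /\ ~ U (polar p t th).
  move=> t0; split=> [[q [E Vq nUq]]|[th [H1 H2]]]; last by exists (polar p t th); rewrite sqd_polar.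
  have qp : q <> p.
    by move=> qp; move: E; rewrite qp /sqd !subrr expr0n addr0 => /esym/eqP; rewrite sqrf_eq0 gt_eqF.
  have [s [th [s0 _ Eq]]] := polar_surj 0 qp.
  have st : s = t.
    by move: E; rewrite Eq sqd_polar => /eqP; rewrite eqrXn2 ?ltW// => /eqP.
  by exists th; rewrite -st -Eq.
case: H => H; [left|right] => t te; have /andP[t0 _] := te; first by apply/HS => //; exact: H.
by move=> th Vq; apply: contrapT => nU; apply: (H t te); apply/HS => //; exists th.
Qed.

End Tame.

(** * Gluing at a corner *)

Section CornerGeometry.
Context {R : realType}.
Implicit Types (F G : plane R -> R) (x y z p : plane R) (r t s th w g : R) (n : int) (U V O W : set (plane R)).
Local Notation tau := (@tau R).

Lemma cos_gt_sector g psi : 0 < g -> g <= pi / 2 -> `|psi| < pi - g -> - cos g < cos psi :> R.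
Proof.
move=> g0 g1 H; have p0 := pi_gt0 R.
have -> : - cos g = cos (pi - g) by rewrite cosB cospi sinpi mul0r addr0 mulN1r.
have -> : cos psi = cos `|psi| by have [|] := ger0P psi => // _; rewrite cosN.
rewrite ltr_cos//; rewrite in_itv/= ?normr_ge0/=; last lra.
by apply: ltW; apply: (lt_le_trans H); lra.
Qed.

(** In coordinates (X, Y) centred at [p] and turned by [w], the two affine forms are kX + Y and kX -
    Y with k = sin g. The excluded set |Y| <= -kX is a sector around the direction opposite to [w]
    whose half-angle, the arctangent of sin g, is less than g. The sine, unlike the tangent, also
    serves for g = pi / 2. *)
Lemma sector_chart p w g : 0 < g -> g <= pi / 2 -> exists a b c a' b' c' : R, a * b' - a' * b != 0 /\
  let P := affmap a b c a' b' c' @^-1` (right `|` upper) in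
  (forall t th, 0 < t -> `|th - w| < pi - g -> P (polar p t th)) /\
  (forall y, P y -> exists t th, [/\ 0 < t, `|th - w| < pi & y = polar p t th]).
Proof.
move=> g0 g1; set k := sin g; set c := cos w; set s := sin w.
have p0 := pi_gt0 R.
have k0 : 0 < k by apply: sin_gt0_pi; apply/andP; split=> //; lra.
have cs : c ^+ 2 + s ^+ 2 = 1 := cos2Dsin2 w.
pose a := k * c - s; pose b := k * s + c; pose a' := k * c + s; pose b' := k * s - c.
exists a, b, (- (a * p.1 + b * p.2)), a', b', (- (a' * p.1 + b' * p.2)); split.
  have -> : a * b' - a' * b = - (2 * k * (c ^+ 2 + s ^+ 2)) by rewrite /a /b /a' /b'; ring.
  by rewrite cs mulr1 oppr_eq0 mulf_neq0// gt_eqF.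
move=> P.
have PE t th : P (polar p t th) <->
    0 < t * (sin (th - w) + k * cos (th - w)) \/ 0 < t * (k * cos (th - w) - sin (th - w)).
  rewrite /P /right /upper /affmap /polar/= sinB cosB -/c -/s.
  have -> : a * (p.1 + t * cos th) + b * (p.2 + t * sin th) - (a * p.1 + b * p.2) =
    t * (sin th * c - cos th * s + k * (cos th * c + sin th * s)).
    by rewrite /a /b; move: (cos th) (sin th) => C S; ring.
  have -> // : a' * (p.1 + t * cos th) + b' * (p.2 + t * sin th) - (a' * p.1 + b' * p.2) =
    t * (k * (cos th * c + sin th * s) - (sin th * c - cos th * s)).
    by rewrite /a' /b'; move: (cos th) (sin th) => C S; ring.
split=> [t th t0 H|y Py].
  have C := cos_gt_sector g0 g1 H; have E := cos2Dsin2 (th - w); have E' := cos2Dsin2 g.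
  have k1 : 0 <= cos g by apply: cos_ge0_pihalf; apply/andP; split; lra.
  apply/PE; rewrite !pmulr_rgt0//.
  rewrite -/k in E'.
  move: (cos (th - w)) (sin (th - w)) (cos g) C E E' k1 => C S cg H1 H2 H3 k1.
  have [C0|C0] := ltP 0 C.
    have kC := mulr_gt0 k0 C0.
    by have [S0|S0] := leP 0 S; [left|right]; lra.
  have [S0|S0] := leP 0 S; [left|right].
    rewrite -ltrBlDr sub0r -(ltr_pXn2r (n := 2))// ?nnegrE//; last by nra.
    by nra.
  by nra.
have yp : y <> p.
  move=> yp; have : P (polar p 0 0) by rewrite /polar !mul0r !addr0 -surjective_pairing -yp.
  by move/PE; rewrite !mul0r ltxx => -[].
have [t [th [t0 /andP[h1 h2] E]]] := polar_surj (w - pi) yp.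
exists t, th; split=> //; rewrite ltr_norml; apply/andP; split; last by move: h2; rewrite /tau; lra.
rewrite lt_neqAle; apply/andP; split; last lra.
apply/eqP => h3; move: Py; rewrite E => /PE; rewrite -h3 cosN sinN cospi sinpi.
by rewrite !pmulr_rgt0//; lra.
Qed.

(** Continuity of [m] and of polar coordinates makes both sides of the curve open. The window from
    [c] to [d] is at most one full turn wide, which prevents a point below the curve from
    re-entering the region through another lift of its angle. *)
Lemma curve_sides p r (m : R -> R) t th c d : 0 < t < r -> d - c <= tau -> {for t, continuous m} ->
  c < th < d ->
  (m t < th -> exists2 e, 0 < e & disc (polar p t th) e `<=` region p r m (cst d)) /\
  ((forall s, 0 < s < r -> c <= m s) -> th < m t -> exists2 e, 0 < e & forall y, disc (polar p t th) e y -> ~ region p r m (cst d) y).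
Proof.
move=> /andP[t0 tr] dc cm /andP[cth thd].
have near_ (del : R) : 0 < del -> exists2 e, 0 < e & forall y, disc (polar p t th) e y ->
    exists s u, [/\ 0 < s < r, `|m s - m t| < del, `|u - th| < del & y = polar p s u].
  move=> del0; have : \forall s \near t, `|m s - m t| < del.
    by near=> s; rewrite distrC; near: s; move/cvgrPdist_lt : cm; apply.
  move=> /nbhs_ballP[eta /= eta0 Heta].
  have e0 : 0 < Num.min del (Num.min eta (r - t)) by rewrite !lt_min del0 eta0 subr_gt0.
  have [e e'0 He] := polar_near p th t0 e0; exists e => // y /He[s [u [s0]]].
  rewrite !lt_min => /and3P[H1 H2 H3] /and3P[H4 _ _] Ey; exists s, u; split=> //.
    by rewrite s0; move: (ler_norm (s - t)); lra.
  by apply: Heta; rewrite /ball/= distrC.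
split=> [lt|mc lt].
  have [|e e0 He] := near_ (Num.min ((th - m t) / 2) (d - th)); first by rewrite lt_min; apply/andP; split; lra.
  exists e => // y /He[s [u [Hs]]]; rewrite !lt_min => /andP[H1 _] /andP[H2 H3] ->.
  exists s, u; split=> //; move: H1 H2 H3; rewrite !ltr_norml => /andP[h1 h2] /andP[h3 h4] /andP[h5 h6].
  by apply/andP; split; rewrite /cst; lra.
have [|e e0 He] := near_ (Num.min ((m t - th) / 2) (Num.min (th - c) (d - th))).
  by rewrite !lt_min; apply/and3P; split; lra.
exists e => // y /He[s [u [Hs]]]; rewrite !lt_min => /and3P[H1 _ _] /and3P[H2 H3 H4] -> [s' [u' [Hs' /andP[k1 k2] E]]].
have /andP[s0 _] := Hs; have /andP[s'0 _] := Hs'.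
have [ss [n En]] := polar_inj s0 s'0 E; subst s'.
move: H1 H2 H3 H4; rewrite !ltr_norml => /andP[h1 h2] /andP[h3 h4] /andP[h5 h6] /andP[h7 h8].
have := mc s Hs; rewrite /cst in k2 => cm'.
(* Both angles lie in the window, one of them strictly inside, so the two lifts agree. *)
have n0 : n = 0.
  by apply: (@tau_small R); move: (n%:~R * tau) En => z En; apply/andP; split; lra.
by move: En; rewrite n0 mul0r addr0 => En; lra.
Unshelve. all: by end_near.
Qed.

(* The two arcs overlap and together stay away from the direction opposite to [w]:
   a sector with apex [p] is then cut along the curve of angle [(a2 + b1) / 2],
   which runs in the intersection. *)
Lemma glue_overlapping_arcs k U V F G p r w g (a1 b1 a2 b2 : R -> R) :
  open U -> open V -> Wk k setT F -> Wk k setT G -> van (U `&` V) (F - G) ->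
  ~ U p -> ~ V p -> 0 < r -> 0 < g -> g <= pi / 2 ->
  (forall t, 0 < t < r -> arc (slice U p t) (a1 t) (b1 t)) ->
  (forall t, 0 < t < r -> arc (slice V p t) (a2 t) (b2 t)) ->
  (forall t, 0 < t < r -> [/\ w - (pi - g) < a1 t, a1 t < a2 t, a2 t < b1 t, b1 t < b2 t & b2 t < w + (pi - g)]) ->
  (forall t, 0 < t < r -> {for t, continuous a2} /\ {for t, continuous b1}) ->
  exists2 r', 0 < r' & exists2 u, Wk k setT u &
    (forall phi, test (disc p r' `&` U) phi -> pr u phi = pr F phi) /\
    (forall phi, test (disc p r' `&` V) phi -> pr u phi = pr G phi).
Proof.
move=> oU oV WF WG vFG nU nV r0 g0 g1 aU aV ord cont.
have [a [b [c [a' [b' [c' [D [P1 P2]]]]]]]] := sector_chart p w g0 g1.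
pose m t := (a2 t + b1 t) / 2; pose q := w + pi.
have cm t : 0 < t < r -> {for t, continuous m}.
  move=> /cont[c1 c2].
  have : {for t, continuous (a2 + b1)} by exact: continuousD.
  by move=> H; apply: continuousM => //; exact: cst_continuous.
have dc : q - (w - pi) <= tau by rewrite /q /tau; lra.
(* The side of the cut towards [b2], up to the direction opposite to [w]. A point of [U] lies
   strictly before the cut or in the intersection, a point of [V] strictly after it or in the
   intersection. *)
pose O := region p r m (cst q).
have mb t : 0 < t < r -> w - pi <= m t < q.
  by move=> /ord[h1 h2 h3 h4 h5]; rewrite /m /q; apply/andP; split; lra.
have mc t : 0 < t < r -> w - pi <= m t by move=> /mb/andP[].
have oO : open O.
  rewrite openE => y [t [th [tr /andP[h1 h2] ->]]].
  have /andP[h3 h4] := mb t tr.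
  have [|+ _] := @curve_sides p r m t th (w - pi) q tr dc (cm t tr).
    by apply/andP; split=> //; exact: le_lt_trans h1.
  by move=> /(_ h1)[e e0 He]; exact: filterS He (nbhs_disc _ e0).
have inUV t th : 0 < t < r -> a2 t < th < b1 t -> exists2 e, 0 < e & disc (polar p t th) e `<=` U `&` V.
  move=> tr /andP[h1 h2]; have [k1 k2 k3 k4 k5] := ord t tr.
  apply: open_disc_sub; first exact: openI.
  by split; [apply: (arc_mid (aU t tr))|apply: (arc_mid (aV t tr))]; apply/andP; split; lra.
have coordU y : disc p r y -> U y -> exists t th, [/\ 0 < t < r, a1 t < th < b1 t & y = polar p t th].
  move=> Dy Uy; have yp : y <> p by move=> E; apply: nU; rewrite -E.
  have [t [th [t0 _ E]]] := polar_surj 0 yp; move: Dy; rewrite E => /disc_polar => /(_ t0 r0) tr.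
  have tr' : 0 < t < r by rewrite t0.
  have [_ _ H] := aU t tr'; have /H[n Hn] : slice U p t th by rewrite /slice/= -E.
  by exists t, (th + n%:~R * tau); split=> //; rewrite polar_tau.
have coordV y : disc p r y -> V y -> exists t th, [/\ 0 < t < r, a2 t < th < b2 t & y = polar p t th].
  move=> Dy Uy; have yp : y <> p by move=> E; apply: nV; rewrite -E.
  have [t [th [t0 _ E]]] := polar_surj 0 yp; move: Dy; rewrite E => /disc_polar => /(_ t0 r0) tr.
  have tr' : 0 < t < r by rewrite t0.
  have [_ _ H] := aV t tr'; have /H[n Hn] : slice V p t th by rewrite /slice/= -E.
  by exists t, (th + n%:~R * tau); split=> //; rewrite polar_tau.
apply: (@glue_corner R k U V O F G p r a b c a' b' c' D r0 oO WF WG vFG).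
- move=> y Dy Py; have [t [th [t0 Hth E]]] := P2 y Py.
  have tr : t < r by apply/(disc_polar p th t0 r0); rewrite -E.
  have tr' : 0 < t < r by rewrite t0.
  move: Hth; rewrite ltr_norml => /andP[h1 h2].
  have hth : w - pi < th < q by rewrite /q; apply/andP; split; lra.
  have [H1 H2] := curve_sides p tr' dc (cm t tr') hth.
  rewrite E; case: (ltgtP (m t) th) => [/H1[e e0 He]|/(H2 mc)[e e0 He]|mth].
  + by exists e => //; apply: Or31.
  + by exists e => //; apply: Or32.
  + have [k1 k2 k3 k4 k5] := ord t tr'.
    have [|e e0 He] := inUV t th tr'; last by exists e => //; apply: Or33.
    by rewrite -mth /m; apply/andP; split; lra.
- move=> y Dy Uy; have [t [th [tr /andP[h1 h2] E]]] := coordU y Dy Uy.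
  have [k1 k2 k3 k4 k5] := ord t tr; have /andP[t0 _] := tr; rewrite E; split.
    by apply: P1 => //; rewrite ltr_norml; apply/andP; split; lra.
  have [lt|le] := ltP th (m t); last first.
    have [|e e0 He] := inUV t th tr; last by exists e => //; right.
    by rewrite /m in le; apply/andP; split; lra.
  have [|_ /(_ mc lt)[e e0 He]] := @curve_sides p r m t th (w - pi) q tr dc (cm t tr).
    by rewrite /q; apply/andP; split; lra.
  by exists e => //; left.
- move=> y Dy Uy; have [t [th [tr /andP[h1 h2] E]]] := coordV y Dy Uy.
  have [k1 k2 k3 k4 k5] := ord t tr; have /andP[t0 _] := tr; rewrite E; split.
    by apply: P1 => //; rewrite ltr_norml; apply/andP; split; lra.
  have [lt|le] := ltP (m t) th; last first.
    have [|e e0 He] := inUV t th tr; last by exists e => //; right.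
    by rewrite /m in le; apply/andP; split; lra.
  have [|/(_ lt)[e e0 He] _] := @curve_sides p r m t th (w - pi) q tr dc (cm t tr).
    by rewrite /q; apply/andP; split; lra.
  by exists e => //; left.
Qed.

Lemma near0_right (P : set R) : (\forall t \near 0^'+, P t) -> exists2 e, 0 < e & forall t, 0 < t < e -> P t.
Proof.
move=> /nbhs_ballP[e /= e0 He]; exists e => // t /andP[t0 te]; apply: He => //.
by rewrite /ball/= sub0r normrN gtr0_norm.
Qed.

(** Each circle provides some number of turns that brings one arc inside the other. As the ends
    converge and the larger opening has a limit below a full turn, two such numbers differ by less
    than 1 for small radii. *)
Lemma lift_const (a b u v : R -> R) (a0 b0 u0 v0 r : R) : 0 < r -> a t @[t --> 0^'+] --> a0 -> b t @[t --> 0^'+] --> b0 ->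
  u t @[t --> 0^'+] --> u0 -> v t @[t --> 0^'+] --> v0 -> b0 - a0 < tau -> u0 <= v0 ->
  (forall t, 0 < t < r -> exists n, a t <= u t + n%:~R * tau /\ v t + n%:~R * tau <= b t) ->
  exists n, exists2 r', 0 < r' & forall t, 0 < t < r' -> a t <= u t + n%:~R * tau /\ v t + n%:~R * tau <= b t.
Proof.
move=> r0 ca cb cu cv ba uv H.
(* Comparing two radii adds four errors smaller than [e] to [b0 - a0]; a fifth of the gap keeps the
   total below [tau]. *)
pose e := (tau - (b0 - a0)) / 5.
have e0 : 0 < e by rewrite divr_gt0// subr_gt0.
have : \forall t \near (0 : R)^'+, [/\ 0 < t < r, `|a0 - a t| < e, `|b0 - b t| < e & `|u0 - u t| < e /\ `|v0 - v t| < e].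
  near=> t; split.
  - by apply/andP; split; near: t; [exact: nbhs_right_gt|exact: nbhs_right_lt].
  - by near: t; move/cvgrPdist_lt : ca; apply.
  - by near: t; move/cvgrPdist_lt : cb; apply.
  - by split; near: t; [move/cvgrPdist_lt : cu; apply|move/cvgrPdist_lt : cv; apply].
move=> /near0_right[r' r'0 N].
have h0 : 0 < r' / 2 < r' by apply/andP; split; lra.
have [H1 H2 H3 [H4 H5]] := N _ h0; have [n [Hn1 Hn2]] := H _ H1.
exists n, r' => // t /N[K1 K2 K3 [K4 K5]]; have [n' [Kn1 Kn2]] := H _ K1.
suff -> : n = n' by [].
move: H2 H3 H4 H5 K2 K3 K4 K5; rewrite !ltr_norml.
move=> /andP[? ?] /andP[? ?] /andP[? ?] /andP[? ?] /andP[? ?] /andP[? ?] /andP[? ?] /andP[? ?].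
have t1 := @tau_gt0 R.
have e5 : e * 5 = tau - (b0 - a0) by rewrite /e divfK.
apply/eqP; rewrite -subr_eq0; apply/eqP; apply: (@tau_small R); rewrite rmorphB/= mulrBl.
move: (n%:~R * tau) (n'%:~R * tau) Hn1 Hn2 Kn1 Kn2 => z z' ? ? ? ?.
by apply/andP; split; lra.
Unshelve. all: by end_near.
Qed.

Lemma const_sign (d : R -> R) r : (forall t, 0 < t < r -> {for t, continuous d}) ->
  (forall t, 0 < t < r -> d t != 0) ->
  (forall t, 0 < t < r -> d t < 0) \/ (forall t, 0 < t < r -> 0 < d t).
Proof.
move=> cd d0; apply: contrapT => /not_orP[/existsNP[s /not_implyP[sr Hs]] /existsNP[t /not_implyP[tr Ht]]].
have {}Hs : 0 < d s by rewrite lt_neqAle eq_sym d0//= leNgt; apply/negP.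
have {}Ht : d t < 0 by rewrite lt_neqAle d0//= leNgt; apply/negP.
have key (x y v : R) : 0 < x < r -> 0 < y < r -> x <= y -> Num.min (d x) (d y) <= v <= Num.max (d x) (d y) -> 
    exists2 c, 0 < c < r & d c = v.
  move=> /andP[x0 xr] /andP[y0 yr] xy Hv.
  have [|c] := IVT xy _ Hv; last first.
    rewrite in_itv/= => /andP[xc cy] dc; exists c => //.
    by rewrite (lt_le_trans x0)// (le_lt_trans cy).
  apply: continuous_in_subspaceT => c; rewrite inE/= in_itv/= => /andP[xc cy]; apply: cd.
  by rewrite (lt_le_trans x0)// (le_lt_trans cy).
have [c cr dc] : exists2 c, 0 < c < r & d c = 0.
  have [st|ts] := leP s t; [apply: (key s t 0) => //|apply: (key t s 0) => //; first exact: ltW];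
    rewrite ge_min le_max ?(ltW Hs) ?(ltW Ht) ?orbT//.
by move: (d0 c cr); rewrite dc eqxx.
Qed.

End CornerGeometry.

(** * Gluing at a common boundary point of two cuspidal sets *)

Section CornerGeometry.
Context {R : realType}.
Implicit Types (F G : plane R -> R) (x y z p : plane R) (r t s th w g : R) (n : int) (U V O W : set (plane R)).
Local Notation tau := (@tau R).

Section Site.
Variable A : ominimal R.

(** [F] itself serves: near [p] a test function on [V] is one on [U ∩ V], where F and G agree. *)
Lemma glue_nested k U V F G p : Wk k setT F -> van (U `&` V) (F - G) -> L2 F -> L2 G ->
  (exists2 e, 0 < e & forall t, 0 < t < e -> forall th, V (polar p t th) -> U (polar p t th)) -> ~ V p ->
  exists2 r', 0 < r' & exists2 u, Wk k setT u &
    (forall phi, test (disc p r' `&` U) phi -> pr u phi = pr F phi) /\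
    (forall phi, test (disc p r' `&` V) phi -> pr u phi = pr G phi).
Proof.
move=> WF vFG LF LG [e e0 H] nV; exists e => //; exists F => //; split=> // phi tp.
apply/eqP; rewrite -subr_eq0 -(prBl_test LF LG tp); apply/eqP; apply: vFG.
apply: test_sub tp => y [Dy Vy]; split=> //.
have yp : y <> p by move=> E; apply: nV; rewrite -E.
have [t [th [t0 _ E]]] := polar_surj 0 yp.
rewrite E; apply: (H t); last by rewrite -E.
by rewrite t0/=; apply/(disc_polar p th t0 e0); rewrite -E.
Qed.

Lemma curve_pair_le p r a (th1 th2 : R -> R) : curve_pair A p r a th1 th2 -> th1 0 <= th2 0.
Proof.
move=> cp; have [C E] := angle_cvg cp; rewrite -subr_ge0 -E.
have [/andP[r0 ra] _ _ H] := cp.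
apply: (cvgr_to_ge C).
near=> t; have /andP[/ltW] // : 0 < th2 t - th1 t < 2 * pi.
apply: H; apply/andP; split; near: t; [exact: nbhs_right_gt|apply: nbhs_right_lt; exact: lt_trans ra].
Unshelve. all: by end_near.
Qed.

Lemma corner_glue k U V F G p : site A U -> site A V ->
  corner_arc A U p -> corner_arc A V p -> corner_arc A (U `|` V) p -> ~ U p -> ~ V p ->
  Wk k setT F -> Wk k setT G -> van (U `&` V) (F - G) ->
  exists2 r', 0 < r' & exists2 u, Wk k setT u &
    (forall phi, test (disc p r' `&` U) phi -> pr u phi = pr F phi) /\
    (forall phi, test (disc p r' `&` V) phi -> pr u phi = pr G phi).
Proof.
move=> [oU _ dU] [oV _ dV] cU cV cW nU nV WF WG vFG.
have [LF LG] := (Wk_L2 WF, Wk_L2 WG).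
have vGF : van (V `&` U) (G - F).
  by move=> phi tp; rewrite (prBl_test LG LF tp) -opprB -(prBl_test LF LG tp) vFG ?oppr0// setIC.
have [e1 e10 [H1|H1]] := sphere_germ p dU dV; last by apply: glue_nested => //; exists e1.
have [e2 e20 [H2|H2]] := sphere_germ p dV dU; last first.
  have [|r' r'0 [u Wu [h1 h2]]] := @glue_nested k V U G F p WG vGF LG LF _ nU; first by exists e2.
  by exists r' => //; exists u.
have [r1 [d1 [u1 [u2 [cp1 _ aU]]]]] := cU.
have [r2 [d2 [v1 [v2 [cp2 _ aV]]]]] := cV.
have [r3 [d3 [a [b [cp3 ang aW]]]]] := cW.
have [/andP[r10 rd1] /curve_continuous[l1 c1] /curve_continuous[l2 c2] _] := cp1.
have [/andP[r20 rd2] /curve_continuous[l3 c3] /curve_continuous[l4 c4] _] := cp2.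
have [/andP[r30 rd3] /curve_continuous[l5 c5] /curve_continuous[l6 c6] bnd3] := cp3.
have ba : b 0 - a 0 < tau.
  have [C E] := angle_cvg cp3; rewrite -E lt_neqAle; apply/andP; split; first exact/eqP.
  apply: (cvgr_to_le C).
  near=> t; have /andP[_ /ltW] // : 0 < b t - a t < 2 * pi.
  apply: bnd3; apply/andP; split; near: t; [exact: nbhs_right_gt|apply: nbhs_right_lt; exact: lt_trans rd3].
pose r := Num.min (Num.min r1 r2) (Num.min r3 (Num.min e1 e2)).
have r0 : 0 < r by rewrite !lt_min r10 r20 r30 e10.
have rP t : 0 < t < r -> [/\ 0 < t < r1, 0 < t < r2, 0 < t < r3 & 0 < t < e1 /\ 0 < t < e2].
  by rewrite !lt_min => /andP[-> /andP[/andP[-> ->] /and3P[-> -> ->]]].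
clearbody r.
(* The arcs of U and V are lifted into that of the union by shifts that do not depend on the radius,
   so the lifted ends are still continuous. *)
have [|n [ra ra0 Hn]] := lift_const r0 l5 l6 l1 l2 ba (curve_pair_le cp1).
  by move=> t /rP[h _ h3 _]; apply: (arc_sub (aW t h3) (aU t h)) => th; left.
have [|n' [rb rb0 Hn']] := lift_const r0 l5 l6 l3 l4 ba (curve_pair_le cp2).
  by move=> t /rP[_ h h3 _]; apply: (arc_sub (aW t h3) (aV t h)) => th; right.
pose a1 t := u1 t + n%:~R * tau; pose b1 t := u2 t + n%:~R * tau.
pose a2 t := v1 t + n'%:~R * tau; pose b2 t := v2 t + n'%:~R * tau.
(* With [w] the middle direction of the union and [g] a quarter of the free angle, [w - (pi - g)] is
   [a 0 - g] and [w + (pi - g)] is [b 0 + g]: small circles of the union fit between, and the free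
   sector keeps half-angle [g]. *)
pose g := (tau - (b 0 - a 0)) / 4; pose w := (a 0 + b 0) / 2.
have g0 : 0 < g by rewrite divr_gt0// subr_gt0.
have gpi : g <= pi / 2 by move: (curve_pair_le cp3); rewrite /g /tau; lra.
have [rc rc0 Hc] : exists2 e : R, 0 < e & forall t, 0 < t < e -> `|a 0 - a t| < g /\ `|b 0 - b t| < g.
  apply: near0_right; near=> t; split; near: t.
    by move/cvgrPdist_lt : l5; apply.
  by move/cvgrPdist_lt : l6; apply.
pose R' := Num.min (Num.min r ra) (Num.min rb rc).
have R'0 : 0 < R' by rewrite !lt_min r0 ra0 rb0.
have R'P t : 0 < t < R' -> [/\ 0 < t < r, 0 < t < ra, 0 < t < rb & 0 < t < rc].
  by rewrite !(lt_min t) => /andP[-> /andP[/andP[-> ->] /andP[-> ->]]].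
have aU' t : 0 < t < R' -> arc (slice U p t) (a1 t) (b1 t).
  by move=> /R'P[/rP[h _ _ _] _ _ _]; apply: arc_shift; exact: aU.
have aV' t : 0 < t < R' -> arc (slice V p t) (a2 t) (b2 t).
  by move=> /R'P[/rP[_ h _ _] _ _ _]; apply: arc_shift; exact: aV.
have aW' t : 0 < t < R' -> arc (slice (U `|` V) p t) (a t) (b t).
  by move=> /R'P[/rP[_ _ h _] _ _ _]; exact: aW.
have bU t : 0 < t < R' -> a t <= a1 t /\ b1 t <= b t by move=> /R'P[_ h _ _]; exact: Hn.
have bV t : 0 < t < R' -> a t <= a2 t /\ b2 t <= b t by move=> /R'P[_ _ h _]; exact: Hn'.
have nUV t : 0 < t < R' -> ~ (a2 t <= a1 t /\ b1 t <= b2 t).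
  move=> tR [h1 h2]; have [/rP[_ _ _ [_ t2]] _ _ _] := R'P t tR.
  have [th [Uth nVth]] := H2 t t2.
  have [_ _ /(_ th)[/(_ Uth)[m /andP[k1 k2]] _]] := aU' t tR; apply: nVth.
  have [_ _ HV] := aV' t tR; apply: (HV th).2; exists m; move: (th + m%:~R * tau) k1 k2 => z k1 k2.
  by rewrite (le_lt_trans h1)//= (lt_le_trans k2).
have nVU t : 0 < t < R' -> ~ (a1 t <= a2 t /\ b2 t <= b1 t).
  move=> tR [h1 h2]; have [/rP[_ _ _ [t1 _]] _ _ _] := R'P t tR.
  have [th [Uth nVth]] := H1 t t1.
  have [_ _ /(_ th)[/(_ Uth)[m /andP[k1 k2]] _]] := aV' t tR; apply: nVth.
  have [_ _ HV] := aU' t tR; apply: (HV th).2; exists m; move: (th + m%:~R * tau) k1 k2 => z k1 k2.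
  by rewrite (le_lt_trans h1)//= (lt_le_trans k2).
have shift_cont (f : R -> R) (m : int) t : {for t, continuous f} -> {for t, continuous (fun t => f t + m%:~R * tau)}.
  by move=> cf; apply: continuousD => //; exact: cst_continuous.
have dom t : 0 < t < R' -> [/\ 0 < t < d1, 0 < t < d2 & 0 < t < d3].
  by move=> /R'P[/rP[/andP[t0 h1] /andP[_ h2] /andP[_ h3] _] _ _ _]; rewrite t0 (lt_trans h1 rd1) (lt_trans h2 rd2) (lt_trans h3 rd3).
have ca1 t : 0 < t < R' -> {for t, continuous a1} by move=> /dom[h _ _]; apply: shift_cont; exact: c1.
have cb1 t : 0 < t < R' -> {for t, continuous b1} by move=> /dom[h _ _]; apply: shift_cont; exact: c2.
have ca2 t : 0 < t < R' -> {for t, continuous a2} by move=> /dom[_ h _]; apply: shift_cont; exact: c3.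
have cb2 t : 0 < t < R' -> {for t, continuous b2} by move=> /dom[_ h _]; apply: shift_cont; exact: c4.
have wab t : 0 < t < R' -> w - (pi - g) < a t /\ b t < w + (pi - g).
  move=> /R'P[_ _ _ /Hc[]]; rewrite !ltr_norml => /andP[? ?] /andP[? ?].
  have g4 : g * 4 = 2 * pi - (b 0 - a 0) by rewrite /g divfK.
  by rewrite /w; split; lra.
(* Equal left ends would make one arc contain the other. Hence one set has its left end first on all
   small circles, and the two cases are symmetric. *)
have [] := @const_sign R (a1 - a2) R'.
- by move=> t tR; apply: continuousB; [exact: ca1|exact: ca2].
- move=> t tR; have -> : (a1 - a2) t = a1 t - a2 t by [].
  rewrite subr_eq0; apply/eqP => E; have [le|/ltW le] := leP (b1 t) (b2 t).
    by apply: (nUV t tR); rewrite E.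
  by apply: (nVU t tR); rewrite E.
- move=> neg.
  apply: (@glue_overlapping_arcs R k U V F G p R' w g a1 b1 a2 b2) => //; last by move=> t tR; split; [exact: ca2|exact: cb1].
  move=> t tR; have lt : a1 t < a2 t by rewrite -subr_lt0; exact: neg.
  have [h1 h2] := bU t tR; have [h3 h4] := bV t tR; have [h5 h6] := wab t tR.
  have lb : b1 t < b2 t by rewrite ltNge; apply/negP => le; apply: (nVU t tR); split=> //; exact: ltW.
  have [ab1 _ _] := aU' t tR.
  (* Overlap: this end of the arc of U is interior to the arc of the union but not in U, so it lies
     in V. The union being an arc is what forbids a gap. *)
  have : slice (U `|` V) p t (b1 t) by apply: (arc_mid (aW' t tR)); apply/andP; split; lra.
  move=> [Ub|Vb]; first by case: (arc_endr (aU' t tR)).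
  have [_ ablt _] := aW' t tR.
  have /andP[k1 _] : a2 t < b1 t < b2 t.
    by apply/(arc_in (aV' t tR) h3 h4 (ltW ablt)) => //; apply/andP; split; lra.
  by split=> //; lra.
- move=> neg.
  suff [r' r'0 [u Wu [k1 k2]]] : exists2 r', 0 < r' & exists2 u, Wk k setT u &
    (forall phi, test (disc p r' `&` V) phi -> pr u phi = pr G phi) /\
    (forall phi, test (disc p r' `&` U) phi -> pr u phi = pr F phi).
    by exists r' => //; exists u.
  apply: (@glue_overlapping_arcs R k V U G F p R' w g a2 b2 a1 b1) => //; last by move=> t tR; split; [exact: ca1|exact: cb2].
  move=> t tR; have lt : a2 t < a1 t by rewrite -subr_gt0; exact: neg.
  have [h1 h2] := bU t tR; have [h3 h4] := bV t tR; have [h5 h6] := wab t tR.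
  have lb : b2 t < b1 t by rewrite ltNge; apply/negP => le; apply: (nUV t tR); split=> //; exact: ltW.
  have [ab1 _ _] := aV' t tR.
  have : slice (U `|` V) p t (b2 t) by apply: (arc_mid (aW' t tR)); apply/andP; split; lra.
  move=> [Ub|Vb]; last by case: (arc_endr (aV' t tR)).
  have [_ ablt _] := aW' t tR.
  have /andP[k1 _] : a1 t < b2 t < b1 t.
    by apply/(arc_in (aU' t tR) h1 h2 (ltW ablt)) => //; apply/andP; split; lra.
  by split=> //; lra.
Unshelve. all: by end_near.
Qed.

End Site.
End CornerGeometry.

(** * Exactness *)

Section Exactness.
Local Open Scope complex_scope.
Context {R : realType}.
Implicit Types (u w phi psi : plane R -> R) (x y p : plane R) (r : R) (U V : set (plane R)) (f g : @functional R).

Lemma distribution0 U f : distribution U f -> f 0 = 0.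
Proof.
move=> [lf _ _]; have := lf (-1) 0 0 (test0 U) (test0 U).
by rewrite scaler0 addr0 rmorphN1 mulN1r addNr.
Qed.

Lemma Sobolev_res_Fun k U u w : Wk k setT u -> Wk k setT w -> Sobolev k U (res U (Fun u w)).
Proof.
move=> Wu Ww; split; last by exists (Fun u w) => //; exact: Sobolev_plane_Fun.
by apply: (distribution_res (@subsetT _ U)); exact: Fun_distribution (Wk_L2 Wu) (Wk_L2 Ww).
Qed.

Lemma Sobolev_eq_res_Fun k U f : Sobolev k U f ->
  exists u1 u2, [/\ Wk k setT u1, Wk k setT u2 & f = res U (Fun u1 u2)].
Proof.
by move=> [_ [F /Sobolev_planeP[u1 [u2 [W1 W2 ->]]] <-]]; exists u1, u2.
Qed.

Lemma resB U u1 u2 w1 w2 : L2 u1 -> L2 u2 -> L2 w1 -> L2 w2 ->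
  res U (Fun u1 u2) - res U (Fun w1 w2) = res U (Fun (u1 - w1) (u2 - w2)).
Proof.
move=> L1 L2' L3 L4; apply/funext => phi.
have -> : (res U (Fun u1 u2) - res U (Fun w1 w2)) phi = res U (Fun u1 u2) phi - res U (Fun w1 w2) phi by [].
have [tp|ntp] := pselect (test U phi); last by rewrite !(res_out _ ntp) subr0.
rewrite !(resE _ tp) !(FunE _ _ tp) (prBl_test L1 L3 tp) (prBl_test L2' L4 tp).
by simpc.
Qed.

Lemma res_res U V f : V `<=` U -> res V (res U f) = res V f.
Proof.
move=> VU; apply/funext => phi; have [tp|ntp] := pselect (test V phi); last by rewrite !res_out.
by rewrite !(resE _ tp) (resE _ (test_sub VU tp)).
Qed.

Variables (A : ominimal R) (k : nat).

Lemma sheafF_cuspidal U : site A U -> only_cuspidal A U -> sheafF A k U = Sobolev k U.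
Proof.
move=> [oU bU _] cU; apply/seteqP; split=> f.
  move=> [[df loc] bd]; apply/SobolevP; split=> //.
  (* A single function is glued, over the closure: the local condition gives its representatives
     inside, the boundary condition those at the boundary. *)
  have [|||x Kx|u1 [u2 [W1 W2 H]]] := @glue R k unit (fun=> U) (fun=> f) (closure U).
  - exact: bounded_closure_compact.
  - by move=> _; exact: subset_closure.
  - by [].
  - have [r [r0 rf]] : exists r, 0 < r /\ rep k (disc x r `&` U) (res (disc x r `&` U) f).
      have [Ux|nUx] := pselect (U x).
        have [r [r0 rU /(Sobolev_res (@subIsetl _ (disc x r) U))/SobolevP[_]]] := loc x Ux.
        by rewrite res_res//; exists r.
      have bx : boundary U x by split.
      have [r [r0 /(Fhat_Sobolev (cuspidal_corner cU bx) r0)/SobolevP[_ rf]]] := bd x bx.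
      by exists r.
    have [u1 [u2 [W1 W2 H]]] := rf; exists r => //; exists u1, u2; split=> // _ phi tp.
    by rewrite -H// resE.
  - by exists u1, u2; split=> // phi; exact: (H tt).
move=> Sf; split.
  have [df _] := Sf; split=> // x Ux; have [r r0 rU] := open_disc_sub oU Ux.
  by exists r; split=> //; exact: Sobolev_res Sf.
move=> x /cU[r [r0 H]]; exists r; split=> //; left; left; right; left; split=> //.
by apply: Sobolev_res Sf; exact: subIsetr.
Qed.

Lemma Sobolev_glue U V f g : site A U -> site A V ->
  only_cuspidal A U -> only_cuspidal A V -> only_cuspidal A (U `|` V) ->
  Sobolev k U f -> Sobolev k V g -> res (U `&` V) f = res (U `&` V) g ->
  exists2 h, Sobolev k (U `|` V) h & res U h = f /\ res V h = g.
Proof.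
move=> sU sV cU cV cW Sf Sg fg.
have [oU bU _] := sU; have [oV bV _] := sV.
have [df [F1 [F2 [WF1 WF2 HF]]]] := (SobolevP k U f).1 Sf.
have [dg [G1 [G2 [WG1 WG2 HG]]]] := (SobolevP k V g).1 Sg.
have agree phi : test U phi -> test V phi -> f phi = g phi.
  move=> [sm cp sU'] [_ _ sV']; have tp : test (U `&` V) phi by split=> // x Sx; split; [exact: sU'|exact: sV'].
  by rewrite -(resE f tp) fg resE.
have tI1 (P Q : set (plane R)) phi : test (P `&` Q) phi -> test P phi by apply: test_sub; exact: subIsetl.
have tI2 (P Q : set (plane R)) phi : test (P `&` Q) phi -> test Q phi by apply: test_sub; exact: subIsetr.
(* The two functions form a family indexed by [bool], so that one gluing yields a common
   representative. *)
pose W (b : bool) := if b then U else V; pose h (b : bool) := if b then f else g.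
have dh b : distribution (W b) (h b) by case: b.
have empty x (P : set (plane R)) : ~ closure P x -> exists2 r, 0 < r & disc x r `&` P = set0.
  move=> nc; have [r r0 H] := open_disc_sub (closed_openC (@closed_closure _ P)) nc.
  by exists r => //; rewrite -subset0 => y [/H + Py]; apply; exact: subset_closure.
have test0' phi : test set0 phi -> forall b u w, h b phi = pr u phi +i* pr w phi.
  by move=> /test_set0 -> b u w; rewrite !pr0 (distribution0 (dh b)).
have [|||x Kx|u1 [u2 [W1 W2 H]]] := @glue R k bool W h (closure U `|` closure V).
- by apply: compactU; exact: bounded_closure_compact.
- by case=> x Px; [left|right]; exact: subset_closure.
- exact: dh.
(* Unless [x] is a boundary point of both sets, a representative of one of the functions serves for
   both near [x]. *)
- have [cUx|nUx] := pselect (closure U x); last first.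
    have [r r0 E] := empty x U nUx; exists r => //; exists G1, G2; split=> // -[] phi tp.
      by apply: test0'; rewrite -E.
    by apply: HG; exact: tI2 tp.
  have [cVx|nVx] := pselect (closure V x); last first.
    have [r r0 E] := empty x V nVx; exists r => //; exists F1, F2; split=> // -[] phi tp.
      by apply: HF; exact: tI2 tp.
    by apply: test0'; rewrite -E.
  have [Ux|nUx] := pselect (U x).
    have [r r0 rU] := open_disc_sub oU Ux; exists r => //; exists F1, F2; split=> // -[] phi tp.
      by apply: HF; exact: tI2 tp.
    have tU : test U phi by apply: (test_sub rU); exact: tI1 tp.
    by rewrite /h -(agree _ tU (tI2 _ _ _ tp)); exact: HF.
  have [Vx|nVx] := pselect (V x).
    have [r r0 rV] := open_disc_sub oV Vx; exists r => //; exists G1, G2; split=> // -[] phi tp; last first.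
      by apply: HG; exact: tI2 tp.
    have tV : test V phi by apply: (test_sub rV); exact: tI1 tp.
    by rewrite /h (agree _ (tI2 _ _ _ tp) tV); exact: HG.
  have bx : boundary (U `|` V) x.
    by split; [apply: (closureS (@subsetUl _ U V))|case].
  have arcs : [/\ corner_arc A U x, corner_arc A V x & corner_arc A (U `|` V) x].
    by split; [exact: (cuspidal_corner cU)|exact: (cuspidal_corner cV)|exact: (cuspidal_corner cW)].
  have [aU aV aW] := arcs.
  (* [P] will be the real or the imaginary part; each produces its own radius and the smaller one is
     kept. *)
  have part (F G : plane R -> R) (P : R[i] -> R) : Wk k setT F -> Wk k setT G ->
      (forall phi, test U phi -> P (f phi) = pr F phi) -> (forall phi, test V phi -> P (g phi) = pr G phi) ->
      exists2 r, 0 < r & exists2 u, Wk k setT u & forall b phi, test (disc x r `&` W b) phi -> P (h b phi) = pr u phi.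
    move=> WF WG PF PG.
    have [|r r0 [u Wu [H1 H2]]] := corner_glue sU sV aU aV aW nUx nVx WF WG.
      move=> phi tp; have [tU tV] := (tI1 _ _ _ tp, tI2 _ _ _ tp).
      by rewrite (prBl_test (Wk_L2 WF) (Wk_L2 WG) tp) -PF// -PG// agree// subrr.
    exists r => //; exists u => // -[] phi tp; first by rewrite H1// -PF//; exact: tI2 tp.
    by rewrite H2// -PG//; exact: tI2 tp.
  have [||r r0 [u1 W1 H1]] := part F1 G1 (@complex.Re R) WF1 WG1.
  + by move=> phi /HF ->.
  + by move=> phi /HG ->.
  have [||s s0 [u2 W2 H2]] := part F2 G2 (@complex.Im R) WF2 WG2.
  + by move=> phi /HF ->.
  + by move=> phi /HG ->.
  exists (Num.min r s); first by rewrite lt_min r0.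
  exists u1, u2; split=> // b phi tp.
  have m0 : 0 <= Num.min r s by rewrite le_min !ltW.
  have tpr : test (disc x r `&` W b) phi.
    by apply: test_sub tp; apply: setSI; apply: subset_disc; rewrite m0 ge_min lexx.
  have tps : test (disc x s `&` W b) phi.
    by apply: test_sub tp; apply: setSI; apply: subset_disc; rewrite m0 ge_min lexx orbT.
  by rewrite -(H1 _ _ tpr) -(H2 _ _ tps); case: (h b phi).
exists (res (U `|` V) (Fun u1 u2)); first exact: Sobolev_res_Fun.
have dF := Fun_distribution (Wk_L2 W1) (Wk_L2 W2).
rewrite (res_res _ (@subsetUl _ U V)) (res_res _ (@subsetUr _ U V)).
split; [apply: (distribution_eq _ df)|apply: (distribution_eq _ dg)]; try exact: distribution_res dF.
- by move=> phi tp; rewrite (resE _ tp) (FunE _ _ tp) -(H true).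
- by move=> phi tp; rewrite (resE _ tp) (FunE _ _ tp) -(H false).
Qed.

(** Locality of distributions: a test function on the union is a sum of test functions with supports
    in small discs, each contained in U or in V. *)
Lemma distribution_separated U V f : open U -> open V -> distribution (U `|` V) f ->
  res U f = 0 -> res V f = 0 -> f = 0.
Proof.
move=> oU oV df fU fV; have [lf _ f0] := df; apply/funext => phi.
have [tp|/f0 //] := pselect (test (U `|` V) phi).
apply: (@test_local_ind R (U `|` V) (fun phi => f phi = 0)) tp.
- exact: distribution0 df.
- by move=> phi1 phi2 t1 t2 E1 E2; have := lf 1 _ _ t1 t2; rewrite scale1r E1 E2 mulr0 addr0.
- move=> x [Ux|Vx].
    have [r r0 rU] := open_disc_sub oU Ux; exists r => // psi [sm cp _] sD.
    have tU : test U psi by split=> //; exact: subset_trans rU.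
    by rewrite -(resE f tU) fU.
  have [r r0 rV] := open_disc_sub oV Vx; exists r => // psi [sm cp _] sD.
  have tV : test V psi by split=> //; exact: subset_trans rV.
  by rewrite -(resE f tV) fV.
Qed.

End Exactness.

Theorem mainTheorem2 (R : realType) (A : ominimal R) (k : nat) :
  (forall U : set (plane R), site A U -> only_cuspidal A U -> sheafF A k U = Sobolev k U)
  /\
  (forall U V : set (plane R), site A U -> site A V ->
     only_cuspidal A U -> only_cuspidal A V ->
     only_cuspidal A (U `&` V) -> only_cuspidal A (U `|` V) ->
     short_exact (Sobolev k (U `|` V)) (Sobolev k U `*` Sobolev k V) (Sobolev k (U `&` V))
       (fun f : functional => (res U f, res V f))
       (fun fg : functional * functional =>
          res (U `&` V) fg.1 - res (U `&` V) fg.2)).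
Proof.
split=> [U|U V sU sV cU cV _ cW]; first exact: sheafF_cuspidal.
have [[oU _ _] [oV _ _]] := (sU, sV); split.
- by move=> f [df _] [fU fV]; exact: distribution_separated df fU fV.
- apply/seteqP; split=> [_ [f Sf <-]|[f g] [[/= Sf Sg] E]].
    split; first by split=> /=; apply: Sobolev_res Sf; [exact: subsetUl|exact: subsetUr].
    by rewrite /= (res_res _ (@subIsetl _ U V)) (res_res _ (@subIsetr _ U V)) subrr.
  have [h Sh [<- <-]] := Sobolev_glue sU sV cU cV cW Sf Sg (subr0_eq E).
  by exists h.
- apply/seteqP; split=> [_ [[f g] [/= Sf Sg] <-]|f /Sobolev_eq_res_Fun[u1 [u2 [W1 W2 ->]]]].
    have [u1 [u2 [W1 W2 ->]]] := Sobolev_eq_res_Fun Sf.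
    have [w1 [w2 [W3 W4 ->]]] := Sobolev_eq_res_Fun Sg.
    rewrite (res_res _ (@subIsetl _ U V)) (res_res _ (@subIsetr _ U V)).
    by rewrite (resB _ (Wk_L2 W1) (Wk_L2 W2) (Wk_L2 W3) (Wk_L2 W4)); apply: Sobolev_res_Fun; exact: WkB.
  have W0 := @Wk0 R k setT; have L0 := Wk_L2 W0.
  (* An element of W^{k,2}(U ∩ V) comes from the plane: restrict that function to U and take 0 on
     V. *)
  exists (res U (Fun u1 u2), res V (Fun 0 0)); first by split; exact: Sobolev_res_Fun.
  rewrite /= (res_res _ (@subIsetl _ U V)) (res_res _ (@subIsetr _ U V)).
  by rewrite (resB _ (Wk_L2 W1) (Wk_L2 W2) L0 L0) !subr0.
Qed.
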